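(* Let $G$ be a graph with $|V(G)|\geq 3$, let $\mathcal{C}_{3}=\{Id,C_{3},C_{3}^2\}$ be the symmetry group in dimension $2$ generated by the rotation $C_3$ about the origin by $\frac{2\pi}{3}$, and let $\Phi:\mathcal{C}_{3}\to \mathrm{Aut}(G)$ be a homomorphism. The following are equivalent: (i) $\mathscr{R}_{(G,\mathcal{C}_{3},\Phi)}\neq \emptyset$ and $G$ is $(\mathcal{C}_{3},\Phi)$-generically isostatic; (ii) $|E(G)|=2|V(G)|-3$, $|E(H)|\leq 2|V(H)|-3$ for all subgraphs $H\subseteq G$ with $|V(H)|\geq 2$, and $j_{\Phi(C_{3})}=0$; (iii) there exists a $(\mathcal{C}_{3},\Phi)$ construction sequence $$(K_{3},\Phi_{0})=(G_{0},\Phi_{0}),(G_{1},\Phi_{1}),\ldots,(G_{k},\Phi_{k})=(G,\Phi),$$ that is, a finite sequence of pairs ($k\ge 0$), starting from a complete graph on three vertices, such that (a) for all $i=0,1,\ldots,k-1$, $G_{i+1}$ is a $(\mathcal{C}_{3},\Phi_{i})$ vertex addition, a $(\mathcal{C}_{3},\Phi_{i})$ edge split, or a $(\mathcal{C}_{3},\Phi_{i})$ $\Delta$ extension of $G_{i}$ (performed with the triple of new vertices $(v_{i+1},w_{i+1},z_{i+1})$), with $V(G_{i+1})=V(G_{i})\cup \{v_{i+1},w_{i+1},z_{i+1}\}$; (b) $\Phi_{0}:\mathcal{C}_{3}\to \mathrm{Aut}(K_{3})$ is a non-trivial homomorphism and for all $i=0,1,\ldots,k-1$, $\Phi_{i+1}:\mathcal{C}_{3}\to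 \mathrm{Aut}(G_{i+1})$ is the homomorphism defined by $\Phi_{i+1}(x)|_{V(G_{i})}=\Phi_{i}(x)$ for all $x\in \mathcal{C}_{3}$ and $\Phi_{i+1}(C_{3})|_{\{v_{i+1},w_{i+1},z_{i+1}\}}=(v_{i+1}\,w_{i+1}\,z_{i+1})$ (the $3$-cycle $v_{i+1}\mapsto w_{i+1}\mapsto z_{i+1}\mapsto v_{i+1}$); (iv) $G$ has a proper $(\mathcal{C}_{3},\Phi)$ 3Tree2 partition.
   Context: Graphs are finite, without loops or multiple edges; edges are unordered pairs $\{u,v\}$. $\mathrm{Aut}(G)$ is the group of graph automorphisms of $G$ (permutations of $V(G)$ preserving adjacency and non-adjacency). $H\subseteq G$ means $V(H)\subseteq V(G)$ and $E(H)\subseteq E(G)$. For $\alpha\in\mathrm{Aut}(G)$ and a subgraph $H$ of $G$, $\alpha(H)$ is the subgraph with vertex set $\alpha(V(H))$ and edge set $\{\{\alpha(u),\alpha(v)\}:\{u,v\}\in E(H)\}$. **Frameworks and rigidity (in $\mathbb{R}^2$).** A framework is a pair $(G,p)$ with $G$ a graph and $p:V(G)\to\mathbb{R}^2$ a map with $p(u)\neq p(v)$ for all $\{u,v\}\in E(G)$; it is called a realization of $G$. An infinitesimal motion of $(G,p)$ is a function $u:V(G)\to\mathbb{R}^2$ with $(p(a)-p(b))\cdot(u(a)-u(b))=0$ for all $\{a,b\}\in E(G)$. It is an infinitesimal rigid motion if there are a skew-symmetric matrix $S$ and a vector $t$ with $u(v)=Sp(v)+t$ for all $v\in V(G)$.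 $(G,p)$ is infinitesimally rigid if every infinitesimal motion is an infinitesimal rigid motion. For $V(G)=\{v_1,\dots,v_n\}$ and any map $p:V(G)\to\mathbb{R}^2$ with $p_i=p(v_i)$, the rigidity matrix $\mathbf{R}(G,p)$ is the $|E(G)|\times 2n$ matrix having, for each edge $\{v_i,v_j\}$, a row with the two entries of $p_i-p_j$ in columns $2i-1,2i$, the two entries of $p_j-p_i$ in columns $2j-1,2j$, and $0$ elsewhere. $(G,p)$ is independent if the rows of $\mathbf{R}(G,p)$ are linearly independent, and isostatic if it is both independent and infinitesimally rigid. **Symmetric frameworks.** For $S=\mathcal{C}_3$ and a map $\Phi:S\to\mathrm{Aut}(G)$, $\mathscr{R}_{(G,S,\Phi)}$ is the set of all realizations $(G,p)$ of $G$ in $\mathbb{R}^2$ satisfying the symmetry equations $x(p(v))=p(\Phi(x)(v))$ for all $v\in V(G)$ and all $x\in S$. Let $K_n$ be the complete graph on $V(G)$. A framework $(G,p)\in\mathscr{R}_{(G,S,\Phi)}$ is $(S,\Phi)$-generic if the determinant of any (square) submatrix of $\mathbf{R}(K_n,p)$ is zero only if the determinant of the corresponding submatrix of $\mathbf{R}(K_n,p')$ is zero for all $p':V(G)\to\mathbb{R}^2$ satisfying these symmetry equations. $G$ is $(S,\Phi)$-generically isostatic if all $(S,\Phi)$-generic realizations of $G$ are isostatic. $j_{\Phi(C_3)}$ denotes the number of vertices $v\in V(G)$ with $\Phi(C_3)(v)=v$. **Symmetric inductive moves.** Let $G$ be a graph, $\Phi:\mathcal{C}_3\to\mathrm{Aut}(G)$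 a homomorphism, write $\gamma=\Phi(C_3)$, $\gamma^2=\Phi(C_3^2)$, and let $v,w,z\notin V(G)$ be three distinct new vertices. In each case the new graph $\widehat G$ has $V(\widehat G)=V(G)\cup\{v,w,z\}$. - $(\mathcal{C}_3,\Phi)$ vertex addition (by $(v,w,z)$) of $G$: for two distinct vertices $v_1,v_2$ of $G$, $E(\widehat G)=E(G)\cup\{\{v,v_1\},\{v,v_2\},\{w,\gamma(v_1)\},\{w,\gamma(v_2)\},\{z,\gamma^2(v_1)\},\{z,\gamma^2(v_2)\}\}$. - $(\mathcal{C}_3,\Phi)$ edge split of $G$ (with new vertices $(v,w,z)$): for three distinct vertices $v_1,v_2,v_3$ of $G$ such that $\{v_1,v_2\}\in E(G)$ and not both of $v_1,v_2$ are fixed by $\gamma$, $E(\widehat G)=\big(E(G)\setminus\{\{v_1,v_2\},\{\gamma(v_1),\gamma(v_2)\},\{\gamma^2(v_1),\gamma^2(v_2)\}\}\big)\cup\{\{v,v_i\}\mid i=1,2,3\}\cup\{\{w,\gamma(v_i)\}\mid i=1,2,3\}\cup\{\{z,\gamma^2(v_i)\}\mid i=1,2,3\}$. - $(\mathcal{C}_3,\Phi)$ $\Delta$ extension (by $(v,w,z)$) of $G$: for a vertex $v_0$ of $G$ that is not fixed by $\gamma$, $E(\widehat G)=E(G)\cup\{\{v,w\},\{w,z\},\{z,v\},\{v,v_0\},\{w,\gamma(v_0)\},\{z,\gamma^2(v_0)\}\}$. **3Tree2 partitions.** A 3Tree2 partition of $G$ is a partition of $E(G)$ into the edge sets of three edge-disjoint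 trees $T_0,T_1,T_2$ (subgraphs of $G$) such that each vertex of $G$ belongs to exactly two of the trees. It is proper if no non-trivial subtrees (i.e. subtrees with at least one edge) of distinct trees $T_i$ have the same vertex set. A $(\mathcal{C}_3,\Phi)$ 3Tree2 partition of $G$ is a 3Tree2 partition $\{E(T_0),E(T_1),E(T_2)\}$ such that $\Phi(C_3)(T_i)=T_{i+1}$ for $i=0,1,2$, with indices taken modulo $3$. *)

(* Defs.v *)
From HB Require Import structures.
From mathcomp Require Import all_boot all_order all_algebra all_fingroup.
From mathcomp Require Import reals trigo.

Set Implicit Arguments.
Unset Strict Implicit.
Unset Printing Implicit Defensive.

Import Order.TTheory GRing.Theory Num.Theory.
Local Open Scope ring_scope.

(* Vertices are taken in an ambient finite type, so that a graph and the
   smaller graphs of a construction sequence have the same Rocq type. *)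
Record graph (T : finType) := Graph {
  V : {set T};
  E : {set {set T}};
  graphP : [forall e in E, (e \subset V) && (#|e| == 2%N)] }.

Section Graphs.
Variable T : finType.
Implicit Types (G H K : graph T) (s : {perm T}).

Definition adj G : rel T := fun a b => [set a; b] \in E G.

Definition subgraph H G : Prop := V H \subset V G /\ E H \subset E G.

Lemma complete_graphP (A : {set T}) :
  [forall e in [set e : {set T} | (e \subset A) && (#|e| == 2%N)],
     (e \subset A) && (#|e| == 2%N)].
Proof. by apply/forall_inP => e; rewrite inE. Qed.

Definition complete_graph (A : {set T}) : graph T :=
  Graph (complete_graphP A).

(* A permutation of V(G) is represented by the permutation of T that extends
   it by the identity. *)
Definition Aut G : {set {perm T}} :=
  [set s | perm_on (V G) s
         & [forall a in V G, forall b in V G, adj G (s a) (s b) == adj G a b]].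

Lemma image_graphP s G :
  [forall e in [set s @: (e : {set T}) | e in E G],
     (e \subset s @: V G) && (#|e| == 2%N)].
Proof.
apply/forall_inP => _ /imsetP[e eE ->].
have /andP[eV e2] := forall_inP (graphP G) e eE.
by rewrite imsetS //= card_imset //; exact: perm_inj.
Qed.

Definition image_graph s G : graph T := Graph (image_graphP s G).

Definition connected G : Prop :=
  V G != set0 /\ {in V G &, forall a b, connect (adj G) a b}.

(* Sequences of size 2 are excluded: a single edge {a, b} makes [:: a; b] a
   ucycle. *)
Definition acyclic G : Prop :=
  forall c : seq T, ucycle (adj G) c -> (size c <= 2)%N.

Definition tree G : Prop := connected G /\ acyclic G.

Definition threeTree2 G (Tr : 'Z_3 -> graph T) : Prop :=
  [/\ forall i, tree (Tr i) /\ subgraph (Tr i) G,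
      forall i j, i != j -> [disjoint E (Tr i) & E (Tr j)],
      E G = \bigcup_(i : 'Z_3) E (Tr i)
    & forall a, a \in V G -> #|[set i | a \in V (Tr i)]| = 2%N].

Definition proper_family (Tr : 'Z_3 -> graph T) : Prop :=
  forall i j H K, i != j ->
    tree H -> subgraph H (Tr i) -> E H != set0 ->
    tree K -> subgraph K (Tr j) -> E K != set0 ->
    V H <> V K.

End Graphs.

(* A placement p : V(G) -> R^2 is the restriction to V(G) of a function on T;
   none of the notions below depends on its values outside V(G). *)
Section Frameworks.
Variables (R : realType) (T : finType).
Implicit Types (G : graph T) (p u : T -> 'cV[R]_2).

Definition dot (x y : 'cV[R]_2) : R := (x^T *m y) 0 0.

Definition realization G p : Prop := forall a b, adj G a b -> p a <> p b.

Definition inf_motion G p u : Prop :=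
  forall a b, adj G a b -> dot (p a - p b) (u a - u b) = 0.

Definition inf_rigid_motion G p u : Prop :=
  exists (S : 'M[R]_2) (t : 'cV[R]_2),
    S^T = - S /\ forall a, a \in V G -> u a = S *m p a + t.

Definition inf_rigid G p : Prop :=
  forall u, inf_motion G p u -> inf_rigid_motion G p u.

(* The pair of entries of the row of the edge e at the vertex a: for
   e = {a, b} the sum has the single term p a - p b. *)
Definition rigidity_entry p (e : {set T}) (a : T) : 'rV[R]_2 :=
  if a \in e then \sum_(b in e :\ a) (p a - p b)^T else 0.

(* mxvec is row-major: it puts the entries of the i-th vertex (numbered from
   0) in columns 2i and 2i+1. *)
Definition rigidity_matrix G p : 'M[R]_(#|E G|, #|V G| * 2) :=
  \matrix_(k < #|E G|)
    mxvec (\matrix_(i < #|V G|) rigidity_entry p (enum_val k) (enum_val i)).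

Definition independent G p : Prop := row_free (rigidity_matrix G p).

Definition isostatic G p : Prop := independent G p /\ inf_rigid G p.

End Frameworks.

Section C3Symmetry.
Variable R : realType.

Definition rotation (t : R) : 'M[R]_2 :=
  \matrix_(i, j) if i == j then cos t
                 else if i == 0 then - sin t else sin t.

Definition C3 : 'M[R]_2 := rotation (2 * pi / 3).

Definition C3_group : seq 'M[R]_2 := [:: 1%:M; C3; C3 *m C3].

Variable T : finType.
Implicit Types (G : graph T) (p : T -> 'cV[R]_2) (Phi : 'M[R]_2 -> {perm T}).

(* Only the values of Phi on C3_group matter.  Since (s * t)%g a = t (s a) for
   permutations, Phi y * Phi x is the composite Phi x \o Phi y. *)
Definition C3_hom G Phi : Prop :=
  {in C3_group, forall x, Phi x \in Aut G} /\
  {in C3_group &, forall x y, Phi (x *m y) = (Phi y * Phi x)%g}.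

Definition symmetric G Phi p : Prop :=
  {in C3_group, forall x, {in V G, forall a, x *m p a = p (Phi x a)}}.

Definition sym_realization G Phi p : Prop :=
  realization G p /\ symmetric G Phi p.

Definition generic G Phi p : Prop :=
  let K := complete_graph (V G) in
  forall (m : nat) (f : 'I_m -> 'I_#|E K|) (g : 'I_m -> 'I_(#|V K| * 2)),
    injective f -> injective g ->
    \det (mxsub f g (rigidity_matrix K p)) = 0 ->
    forall p', symmetric G Phi p' ->
      \det (mxsub f g (rigidity_matrix K p')) = 0.

Definition generically_isostatic G Phi : Prop :=
  forall p, sym_realization G Phi p -> generic G Phi p -> isostatic G p.

Definition fixed_vertices G (s : {perm T}) : {set T} :=
  [set a in V G | s a == a].

Definition new_vertices G (v w z : T) (G' : graph T) : Prop :=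
  [/\ uniq [:: v; w; z],
      [/\ v \notin V G, w \notin V G & z \notin V G]
    & V G' = V G :|: [set v; w; z]].

Definition vertex_addition G Phi (v w z : T) (G' : graph T) : Prop :=
  let g := Phi C3 in let g2 := Phi (C3 *m C3) in
  new_vertices G v w z G' /\
  exists v1 v2 : T,
    [/\ v1 \in V G, v2 \in V G, v1 != v2
      & E G' = E G :|: [set [set v; v1]; [set v; v2];
                            [set w; g v1]; [set w; g v2];
                            [set z; g2 v1]; [set z; g2 v2]]].

Definition edge_split G Phi (v w z : T) (G' : graph T) : Prop :=
  let g := Phi C3 in let g2 := Phi (C3 *m C3) in
  new_vertices G v w z G' /\
  exists v1 v2 v3 : T,
    [/\ [/\ v1 \in V G, v2 \in V G & v3 \in V G],
        uniq [:: v1; v2; v3],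
        [set v1; v2] \in E G,
        ~ (g v1 = v1 /\ g v2 = v2)
      & E G' = (E G :\: [set [set v1; v2]; [set g v1; g v2];
                             [set g2 v1; g2 v2]])
               :|: [set [set v; a] | a in [set v1; v2; v3]]
               :|: [set [set w; g a] | a in [set v1; v2; v3]]
               :|: [set [set z; g2 a] | a in [set v1; v2; v3]]].

Definition Delta_extension G Phi (v w z : T) (G' : graph T) : Prop :=
  let g := Phi C3 in let g2 := Phi (C3 *m C3) in
  new_vertices G v w z G' /\
  exists v0 : T,
    [/\ v0 \in V G, g v0 != v0
      & E G' = E G :|: [set [set v; w]; [set w; z]; [set z; v];
                            [set v; v0]; [set w; g v0]; [set z; g2 v0]]].

Definition construction_step G Phi (G' : graph T) (Phi' : 'M[R]_2 -> {perm T})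
    : Prop :=
  exists v w z : T,
    [/\ [\/ vertex_addition G Phi v w z G',
            edge_split G Phi v w z G'
          | Delta_extension G Phi v w z G'],
        {in C3_group, forall x, {in V G, Phi' x =1 Phi x}}
      & [/\ Phi' C3 v = w, Phi' C3 w = z & Phi' C3 z = v]].

(* Only the terms of index at most k of the sequences Gs and Phis matter. *)
Definition has_construction_sequence G Phi : Prop :=
  exists (k : nat) (Gs : nat -> graph T) (Phis : nat -> 'M[R]_2 -> {perm T}),
    [/\ exists A : {set T}, #|A| = 3%N /\ Gs 0%N = complete_graph A,
        forall i, (i <= k)%N -> C3_hom (Gs i) (Phis i),
        exists2 x, x \in C3_group & Phis 0%N x <> 1%g,
        forall i, (i < k)%N ->
          construction_step (Gs i) (Phis i) (Gs i.+1) (Phis i.+1)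
      & Gs k = G /\ {in C3_group, Phis k =1 Phi}].

Definition has_proper_C3_threeTree2 G Phi : Prop :=
  exists Tr : 'Z_3 -> graph T,
    [/\ threeTree2 G Tr, proper_family Tr
      & forall i, image_graph (Phi C3) (Tr i) = Tr (i + 1)].

End C3Symmetry.

Arguments C3 {R}.
Arguments C3_group {R}.

(* Main.v *)
Require Import Defs.
From HB Require Import structures.
From mathcomp Require Import all_boot all_order all_algebra all_fingroup.
From mathcomp Require Import boolp reals trigo.
From mathcomp Require Import zify ring lra.
(* The group library also defines [Aut]; the automorphisms meant below are those
   of a graph. *)
Import Defs.

Set Implicit Arguments.
Unset Strict Implicit.
Unset Printing Implicit Defensive.

Import Order.TTheory GRing.Theory Num.Theory.
Local Open Scope ring_scope.

(** The proof is a cycle: a generically isostatic graph is sparse without fixed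
    vertices, a sparse graph without fixed vertices has a construction sequence,
    a construction sequence yields a proper partition into three trees, and a
    proper partition yields isostatic generic realizations.

    Independence of a placement is used in its dual form: every assignment of
    numbers to the edges is attained by a velocity field, since the rigidity
    matrix has independent rows exactly when it is onto ([onto_edges],
    [independentE]). Counts then come from dimensions of linear maps. Pinning one
    vertex and one coordinate of another gives at most [2 #|V| - 3] edges in any
    subgraph of an independent framework ([onto_edges_sparse]) and at least as
    many in a rigid one ([inf_rigid_maxwell]). The symmetric count works with
    orbits: symmetric edge values are attained by a symmetric velocity field
    (take averages), the rotation about the origin is a symmetric motion, and
    fixed vertices lie at the origin and contribute no coordinate; this leaves
    room for [2 #|V| - 3] edges only if no vertex is fixed ([onto_edges_fixed]).
    Generic symmetric placements exist because minors are polynomial along lines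
    of placements ([exists_generic]).

    In a sparse symmetric graph with more than three vertices some vertex has
    degree two or three; its orbit is removed by the inverse of one of the three
    moves ([reduce_vertex]). The delicate case is a vertex of degree three whose
    orbit is independent. Two of its neighbours lie in no tight set avoiding the
    orbit ([exists_unblocked]), and then the whole orbit of that pair may be added
    at once: a set obstructing two or three of the new edges could be replaced by
    its hull under the symmetry without losing tightness, but the numbers of
    vertices and edges of the hull are multiples of three ([add_orbit_sparse]).

    Along a construction sequence two objects are carried. One is a symmetric
    independent placement: after a perturbation that avoids degenerate positions,
    the velocities of the new vertices solve explicit linear systems
    ([attach_solve], [split_solve], [delta_solve]). The other is a single tree
    meeting every orbit of edges once and avoiding one vertex of each orbit of
    vertices ([C3tree]); its three rotated copies form the partition. The
    partition is proper because the final graph, being independent, is sparse,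
    whereas two of the trees spanning the same set [X] would have [2 #|X| - 2]
    edges ([sparse_proper]).

    Conversely a proper partition makes the graph sparse ([proper_sparse]) without
    fixed vertices, so the graph has a construction sequence, hence a symmetric
    independent placement. Independence passes to generic placements through the
    nonvanishing of a maximal minor ([generic_onto_edges]), and rigidity follows
    from the number of edges ([onto_edges_rigid]). *)

(** * Linear maps between spaces of finite dimension *)

Section LinearDimension.
Variables (F : fieldType) (aT rT : vectType F) (L : aT -> rT).
Hypothesis linL : linear L.

Let Lf := HB.pack_for {linear aT -> rT} L
  (GRing.isLinear.Build F aT rT *:%R L linL).

Let surj_limg : (forall y, exists x, L x = y) -> limg (linfun Lf) = fullv.
Proof.
move=> surj; apply/eqP; rewrite eqEsubv subvf; apply/subvP => y _.
by have [x <-] := surj y; have := memv_img (linfun Lf) (memvf x); rewrite lfunE.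
Qed.

Lemma linear_surj_dim : (forall y, exists x, L x = y) ->
  (\dim {:rT} <= \dim {:aT})%N.
Proof.
by move=> /surj_limg fullL; rewrite -(limg_ker_dim (linfun Lf) fullv) fullL leq_addl.
Qed.

Lemma linear_inj_dim : (forall x, L x = 0 -> x = 0) ->
  (\dim {:aT} <= \dim {:rT})%N.
Proof.
move=> inj; have ker0 : lker (linfun Lf) = 0%VS.
  apply/eqP; rewrite -subv0; apply/subvP => x.
  by rewrite memv_ker lfunE memv0 => /eqP /inj ->.
rewrite -(limg_ker_dim (linfun Lf) fullv) ker0 capv0 dimv0 add0n.
exact: dimvS (subvf _).
Qed.

Lemma linear_surj_inj : (forall y, exists x, L x = y) ->
  (\dim {:aT} <= \dim {:rT})%N -> forall x, L x = 0 -> x = 0.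
Proof.
move=> /surj_limg fullL le_dim x Lx0.
have := limg_ker_dim (linfun Lf) fullv; rewrite fullL capfv => dimE.
have /eqP : (\dim (lker (linfun Lf)) = 0)%N by lia.
rewrite dimv_eq0 => /eqP ker0.
apply/eqP; rewrite -memv0 -ker0 memv_ker lfunE; exact/eqP.
Qed.

End LinearDimension.

Lemma dim_ffun_pred (F : fieldType) (T : finType) (B : {pred T}) (vT : vectType F) :
  \dim {: {ffun {a : T | a \in B} -> vT}} = (#|B| * \dim {:vT})%N.
Proof. by rewrite !dimvf /dim /= card_sig. Qed.

(** * Maps of order three *)

Section OrderThree.
Variables (X : finType) (s : X -> X).
Hypothesis s3 : forall x, s (s (s x)) = x.

Lemma order3_inj : injective s.
Proof. by move=> x y eq_sxy; rewrite -(s3 x) eq_sxy s3. Qed.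

(** The orbit of [x]; the three listed elements coincide when [x] is fixed. *)
Definition orbit3 x : {set X} := [set x; s x; s (s x)].

Lemma orbit3_step x : orbit3 (s x) = orbit3 x.
Proof.
by apply/setP => y; rewrite !inE s3 orbC orbA.
Qed.

(** A representative of the orbit of [x], which depends on the orbit only. The
    default value [x] is never used, as the orbit is not empty. *)
Definition orep x : X := odflt x [pick y in orbit3 x].

Lemma orep_in x : orep x \in orbit3 x.
Proof.
rewrite /orep; case: pickP => [y //|/(_ x)]; by rewrite !inE eqxx.
Qed.

Lemma orep_step x : orep (s x) = orep x.
Proof.
rewrite /orep orbit3_step; case: pickP => [y //|/(_ x)]; by rewrite !inE eqxx.
Qed.

Lemma orep_id x : orep (orep x) = orep x.
Proof.
by have := orep_in x; rewrite !inE => /orP[/orP[]|] /eqP {1}->;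
  rewrite ?orep_step.
Qed.

Lemma orepP x : [\/ x = orep x, x = s (orep x) | x = s (s (orep x))].
Proof.
have := orep_in x; rewrite !inE => /orP[/orP[]|] /eqP ->.
- by constructor 1.
- by rewrite s3; constructor 3.
- by rewrite s3; constructor 2.
Qed.

Lemma orep_fixed x : (s (orep x) == orep x) = (s x == x).
Proof.
by move: (orep x) (orepP x) => r [->|->|->] //; rewrite !(inj_eq order3_inj).
Qed.

Lemma order3_step2_neq x : s x != x -> s (s x) != x.
Proof. by apply: contraNneq => /(congr1 s); rewrite s3 => <-. Qed.

Lemma card_order3 (A : {set X}) :
    {in A, forall x, s x \in A} -> {in A, forall x, s x != x} ->
  #|A| = (3 * #|[set x in A | orep x == x]|)%N.
Proof.
move=> sA nofix; set B := [set x in A | _].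
have BA x : x \in B -> x \in A by rewrite inE => /andP[].
have Br x : x \in B -> orep x = x by rewrite inE => /andP[_ /eqP].
have -> : A = B :|: (s @: B :|: (s \o s) @: B).
  apply/setP => x; apply/idP/idP => [xA|]; last first.
    rewrite !inE => /or3P[/andP[] //|/imsetP[y /BA yA ->]|/imsetP[y /BA yA ->]].
      exact: sA.
    exact: sA (sA _ yA).
  have rB : orep x \in B.
    rewrite inE orep_id eqxx andbT.
    by have := orep_in x; rewrite !inE => /orP[/orP[]|] /eqP ->; rewrite ?sA.
  rewrite !inE; have [xE|xE|xE] := orepP x.
  - by rewrite xA -xE eqxx.
  - by apply/or3P/Or32; rewrite xE imset_f.
  - by apply/or3P/Or33; rewrite xE; apply/imsetP; exists (orep x).
have inj2 : injective (s \o s) by apply: inj_comp; exact: order3_inj.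
have disj1 : [disjoint B & s @: B].
  apply/pred0P => x /=; apply/negbTE/andP => -[xB /imsetP[y yB xE]].
  have := Br _ xB; rewrite xE orep_step Br // => yE.
  by have := nofix _ (BA _ yB); rewrite -yE eqxx.
have disj2 : [disjoint B & (s \o s) @: B].
  apply/pred0P => x /=; apply/negbTE/andP => -[xB /imsetP[y yB /= xE]].
  have := Br _ xB; rewrite xE !orep_step Br // => yE.
  by have := order3_step2_neq (nofix _ (BA _ yB)); rewrite -yE eqxx.
have disj3 : [disjoint s @: B & (s \o s) @: B].
  apply/pred0P => x /=; apply/negbTE/andP => -[/imsetP[y yB ->] /imsetP[z zB /=]].
  move=> /order3_inj yE; have := Br _ yB; rewrite yE orep_step Br // => zE.
  by have := nofix _ (BA _ zB); rewrite -zE eqxx.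
rewrite !cardsU (disjoint_setI0 disj3) setIUr.
rewrite (disjoint_setI0 disj1) (disjoint_setI0 disj2) setU0 cards0.
rewrite (card_imset _ order3_inj) (card_imset _ inj2); lia.
Qed.

Variables (W : zmodType) (C : W -> W).
Hypotheses (C3id : forall w, C (C (C w)) = w) (C0 : C 0 = 0).

(** The equivariant extension, for an action [C] of order three on the values, of
    a function given on the orbit representatives; it vanishes at fixed points. *)
Definition equiv_ext (f : X -> W) x : W :=
  if s x == x then 0 else
  if x == orep x then f (orep x) else
  if x == s (orep x) then C (f (orep x)) else C (C (f (orep x))).

Lemma equiv_ext_step f x : equiv_ext f (s x) = C (equiv_ext f x).
Proof.
rewrite /equiv_ext (inj_eq order3_inj); case: ifPn => [_|sx]; first by rewrite C0.
rewrite orep_step; have rfix : s (orep x) != orep x by rewrite orep_fixed.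
have r2 := order3_step2_neq rfix.
move: (orep x) (orepP x) rfix r2 => r xE rfix r2.
case: xE => ->; rewrite ?s3 ?eqxx.
- by rewrite (negbTE rfix).
- by rewrite (negbTE r2) (inj_eq order3_inj) (negbTE rfix).
- by rewrite (negbTE r2) (inj_eq order3_inj) (negbTE rfix) C3id.
Qed.

Lemma equiv_ext_rep f x : s x != x -> orep x = x -> equiv_ext f x = f x.
Proof. by rewrite /equiv_ext => /negbTE -> ->; rewrite eqxx. Qed.

End OrderThree.

(** * The plane and its rotation of order three *)

Section Plane.
Variable R : realType.
Implicit Types x y : 'cV[R]_2.

Lemma ord2P (i : 'I_2) : i = 0 \/ i = 1.
Proof.
case: i => -[|[|n]] ltn2; last by [].
  by left; apply: val_inj.
by right; apply: val_inj.
Qed.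

Lemma cV2P x y : x 0 0 = y 0 0 -> x 1 0 = y 1 0 -> x = y.
Proof.
by move=> e0 e1; apply/colP => i; case: (ord2P i) => ->.
Qed.

Lemma dotE x y : dot x y = x 0 0 * y 0 0 + x 1 0 * y 1 0.
Proof.
by rewrite /dot mxE !big_ord_recl big_ord0 addr0 !mxE (_ : lift _ _ = 1) //;
  exact: val_inj.
Qed.

Lemma mul2E n (A : 'M[R]_2) (B : 'M_(2, n)) i j :
  (A *m B) i j = A i 0 * B 0 j + A i 1 * B 1 j.
Proof.
by rewrite mxE !big_ord_recl big_ord0 addr0 (_ : lift _ _ = 1) //; exact: val_inj.
Qed.

(** The rotation by a quarter turn; its multiples are the linear maps with a
    skew-symmetric matrix. *)
Definition turn x : 'cV[R]_2 := \col_i (if i == 0 then - x 1 0 else x 0 0).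

Lemma turnE x : (turn x 0 0 = - x 1 0) * (turn x 1 0 = x 0 0).
Proof. by split; rewrite mxE. Qed.

(** As three times the angle is a full turn, the cosine [c] satisfies
    [(c - 1) * (2 * c + 1) ^+ 2 = 0]. *)
Lemma C3_cos : cos (2 * pi / 3 : R) = - (1 / 2).
Proof.
set t := _ / 3; have c2s2 := cos2Dsin2 t.
have pi0 : 0 < pi :> R := pi_gt0 R.
have t0 : 0 < t by rewrite /t; lra.
have tpi : t <= pi by rewrite /t; lra.
have clt1 : cos t < 1.
  rewrite -cos0 ltr_cos // in_itv /= ?lexx ?ltW // /t; lra.
have : cos (t + t + t) = 1.
  rewrite -cos2pi; congr cos; rewrite /t mulr2n; lra.
rewrite !cosD !sinD => c3; have : (cos t - 1) * (2 * cos t + 1) ^+ 2 = 0.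
  have -> : (cos t - 1) * (2 * cos t + 1) ^+ 2 =
     (cos t * cos t - sin t * sin t) * cos t -
     (sin t * cos t + cos t * sin t) * sin t - 1
     + 3 * cos t * (cos t ^+ 2 + sin t ^+ 2 - 1) by ring.
  by rewrite c3 c2s2; ring.
move/eqP; rewrite mulf_eq0 expf_eq0 /= => /orP[|] /eqP ?; lra.
Qed.

Lemma C3_sin2 : sin (2 * pi / 3 : R) ^+ 2 = 3 / 4.
Proof. by rewrite sin2cos2 C3_cos; field. Qed.

Let sn : R := sin (2 * pi / 3).

Lemma C3_mulE x :
  ((C3 *m x) 0 0 = - (1 / 2) * x 0 0 - sn * x 1 0) *
  ((C3 *m x) 1 0 = sn * x 0 0 - (1 / 2) * x 1 0).
Proof. by split; rewrite mul2E !mxE /= C3_cos /sn; ring. Qed.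

Lemma C3_mul_mx : (C3 : 'M[R]_2) *m C3 = - 1%:M - C3.
Proof.
apply/matrixP => i j; rewrite mul2E !mxE.
rewrite -/sn C3_cos; have := C3_sin2; rewrite -/sn expr2 => s2.
by case: (ord2P i) => ->; case: (ord2P j) => -> /=; lra.
Qed.

Lemma C3_twice x : C3 *m (C3 *m x) = - x - C3 *m x.
Proof. by rewrite mulmxA C3_mul_mx mulmxBl mulNmx mul1mx. Qed.

Lemma C3_sum x : x + C3 *m x + C3 *m (C3 *m x) = 0.
Proof. by rewrite C3_twice -opprD subrr. Qed.

Lemma C3_cubed x : C3 *m (C3 *m (C3 *m x)) = x.
Proof. by rewrite !C3_twice opprB opprK addKr. Qed.

Lemma C3_dot x y : dot (C3 *m x) (C3 *m y) = dot x y.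
Proof.
rewrite !dotE !C3_mulE; have := C3_sin2; rewrite -/sn => s2.
have -> : (- (1 / 2) * x 0 0 - sn * x 1 0) * (- (1 / 2) * y 0 0 - sn * y 1 0) +
  (sn * x 0 0 - 1 / 2 * x 1 0) * (sn * y 0 0 - 1 / 2 * y 1 0) =
  (sn ^+ 2 + 1 / 4) * (x 0 0 * y 0 0 + x 1 0 * y 1 0) by field.
by rewrite s2; field.
Qed.

Lemma C3_turn x : C3 *m turn x = turn (C3 *m x).
Proof. by apply: cV2P; rewrite !(C3_mulE, turnE); ring. Qed.

Lemma C3_fix x : C3 *m x = x -> x = 0.
Proof.
move=> xE; have := C3_sum x; rewrite !xE => /colP x3.
by apply: cV2P; [have := x3 0 | have := x3 1]; rewrite !mxE; lra.
Qed.

Lemma dot_eq0 x : dot x x = 0 -> x = 0.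
Proof.
rewrite dotE -!expr2 => /eqP; rewrite paddr_eq0 ?sqr_ge0 // !expf_eq0 /=.
by move=> /andP[/eqP x0 /eqP x1]; apply: cV2P; rewrite mxE.
Qed.

(** The cross product of two plane vectors. *)
Definition cross x y : R := x 0 0 * y 1 0 - x 1 0 * y 0 0.

Lemma dot_solve x y (a b : R) : cross x y != 0 ->
  exists z, dot x z = a /\ dot y z = b.
Proof.
move=> xy0; pose d := cross x y.
exists (\col_i (if i == 0 then (a * y 1 0 - b * x 1 0) / d
               else (b * x 0 0 - a * y 0 0) / d)).
by rewrite !dotE !mxE /=; move: xy0; rewrite /d /cross => ?; split; field.
Qed.

End Plane.

(** * Finite graphs and trees *)

Section GraphBasics.
Variable T : finType.
Implicit Types (G H : graph T) (X Y A : {set T}) (a b x y : T).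

Lemma graph_ext G H : V G = V H -> E G = E H -> G = H.
Proof.
case: G H => VG EG GP [VH EH HP] /= eV eE; subst VH EH.
by congr Graph; exact: bool_irrelevance.
Qed.

Lemma edge_sub G e : e \in E G -> e \subset V G.
Proof. by move/(forall_inP (graphP G)) => /andP[]. Qed.

Lemma edge_card G e : e \in E G -> #|e| = 2%N.
Proof. by move/(forall_inP (graphP G)) => /andP[_ /eqP]. Qed.

Lemma edgeP G e : e \in E G ->
  exists a b, [/\ e = [set a; b], a != b, a \in V G & b \in V G].
Proof.
move=> eE; have /eqP/cards2P[a [b [ab eab]]] := edge_card eE.
have := edge_sub eE; rewrite eab => /subsetP sV.
by exists a, b; split; rewrite ?sV ?set21 ?set22.
Qed.

Lemma adjC G a b : adj G a b = adj G b a.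
Proof. by rewrite /adj setUC. Qed.

Lemma adj_neq G a b : adj G a b -> a != b.
Proof. by move/edge_card; rewrite cards2; case: (a != b). Qed.

Lemma adj_Vl G a b : adj G a b -> a \in V G.
Proof. by move/edge_sub/subsetP; apply; exact: set21. Qed.

Lemma adj_Vr G a b : adj G a b -> b \in V G.
Proof. by rewrite adjC; exact: adj_Vl. Qed.

Lemma set2_inj a b c : [set a; b] = [set a; c] -> b = c.
Proof.
move=> /setP eq_ab; have := eq_ab b; have := eq_ab c.
by rewrite !inE !eqxx !orbT => /orP[]/eqP-> // /esym /orP[]/eqP.
Qed.

Lemma set2_eq a b c d : ([set a; b] == [set c; d]) =
  ((a == c) && (b == d)) || ((a == d) && (b == c)).
Proof.
apply/eqP/idP => [/setP eqS|/orP[]/andP[/eqP-> /eqP->] //]; last by rewrite setUC.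
have := eqS a; have := eqS b; have := eqS c; have := eqS d; rewrite !inE !eqxx ?orbT /=.
rewrite ![d == _]eq_sym ![c == _]eq_sym.
by do 4!case: eqP => ? //=.
Qed.

Lemma mkgraphP A (F : {set {set T}}) :
  [forall e in [set e in F | (e \subset A) && (#|e| == 2%N)],
     (e \subset A) && (#|e| == 2%N)].
Proof. by apply/forall_inP => e; rewrite inE => /andP[]. Qed.

(** The graph on [A] whose edges are the pairs of vertices of [A] in [F]. *)
Definition mkgraph A (F : {set {set T}}) : graph T := Graph (mkgraphP A F).

Lemma mkgraphE A (F : {set {set T}}) : F \subset E (complete_graph A) -> E (mkgraph A F) = F.
Proof.
move=> /subsetP sF; apply/setP => e; rewrite /= inE.
by case: (boolP (e \in F)) => // /sF; rewrite inE => ->.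
Qed.

(** The edges of [G] with both ends in [X]. *)
Definition spanned G X : {set {set T}} := [set e in E G | e \subset X].

Lemma spannedE G X : E (mkgraph X (E G)) = spanned G X.
Proof.
apply/setP => e; rewrite /= !inE.
by case: (boolP (e \in E G)) => //= /edge_card ->; rewrite andbT.
Qed.

(** The neighbours of [x]; their number is the degree of [x]. *)
Definition nbrs G x : {set T} := [set b | adj G x b].

Lemma card_star G x : #|[set e in E G | x \in e]| = #|nbrs G x|.
Proof.
rewrite -(@card_in_imset _ _ (fun b => [set x; b])); last by move=> b c _ _ /set2_inj.
congr #|pred_of_set _|; apply/setP => e; rewrite inE; apply/andP/imsetP => [[eE xe]|[b]].
  have [a [b [eab ab _ _]]] := edgeP eE.
  move: xe; rewrite eab !inE => /orP[]/eqP xE.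
    by exists b; rewrite ?xE // inE /adj -eab.
  by exists a; rewrite ?inE /adj xE setUC // -eab.
by rewrite inE => ab ->; rewrite set21.
Qed.

Lemma card_edges_del G x : #|E G| = (#|spanned G (V G :\ x)| + #|nbrs G x|)%N.
Proof.
rewrite -card_star -(cardsID [set e : {set T} | x \in e] (E G)) addnC; congr (_ + _)%N.
  apply: eq_card => e; rewrite !inE andbC; apply: andb_id2l => eE.
  by rewrite subsetD1 edge_sub.
by apply: eq_card => e; rewrite !inE.
Qed.

Lemma connect_adjC G : connect_sym (adj G).
Proof. by apply: sym_connect_sym => a b; exact: adjC. Qed.

Lemma connected_root G r : r \in V G ->
  (forall a, a \in V G -> connect (adj G) r a) -> connected G.
Proof.
move=> rV conr; split=> [|a b aV bV]; first by apply/set0Pn; exists r.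
by apply: connect_trans (conr b bV); rewrite connect_adjC; exact: conr.
Qed.

(** A set containing a root [r] and spanning at least as many edges as it has
    vertices other than [r] can be enlarged as long as an edge leaves it. *)
Lemma connected_card G : connected G -> (#|V G| <= #|E G|.+1)%N.
Proof.
case=> /set0Pn[r rV] conG.
pose P (S : {set T}) := [&& S \subset V G, r \in S & (#|S| <= #|spanned G S|.+1)%N].
have P0 : P [set r] by rewrite /P sub1set rV set11 cards1.
case: (@arg_maxnP _ [set r] P (fun S => #|S|) P0) => S /and3P[SV rS cS] Smax.
suff VS : V G \subset S.
  apply: leq_trans (subset_leq_card VS) (leq_trans cS _).
  by rewrite ltnS; apply: subset_leq_card; apply/subsetP => e; rewrite inE => /andP[].
apply/subsetP => b bV.
have closS : closed (adj G) (mem S).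
  have half x y : adj G x y -> x \in S -> y \in S.
    move=> xy xS; apply/negP => /negP yS.
    have : P (y |: S).
      rewrite /P subUset sub1set (adj_Vr xy) SV setU1r //= cardsU1 yS add1n ltnS.
      rewrite (leq_trans cS) // -add1n.
      have xyN : [set x; y] \notin spanned G S.
        by rewrite inE subUset !sub1set (negbTE yS) !andbF.
      have <- : #|[set x; y] |: spanned G S| = (1 + #|spanned G S|)%N.
        by rewrite cardsU1 xyN.
      apply: subset_leq_card; apply/subsetP => e; rewrite !inE => /orP[/eqP->|/andP[-> sS]].
        by rewrite (xy : _ \in _) subUset !sub1set !inE xS eqxx orbT.
      by rewrite (subset_trans sS) // subsetU1.
    by move/Smax; rewrite /= cardsU1 yS add1n ltnn.
  by move=> x y xy; apply/idP/idP; apply: half; rewrite // adjC.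
by have := closed_connect closS (conG _ _ rV bV); rewrite rS => <-.
Qed.

Lemma acyclic_sub G H : subrel (adj H) (adj G) -> acyclic G -> acyclic H.
Proof.
move=> sHG acG c /andP[cyc u]; apply: acG; rewrite /ucycle u andbT.
exact: sub_cycle cyc.
Qed.

(** If all degrees are at least two, a path without repetition can be extended at
    its head for ever, as an edge back to the path would close a cycle. *)
Lemma acyclic_leaf G : acyclic G -> V G != set0 ->
  exists2 x, x \in V G & (#|nbrs G x| <= 1)%N.
Proof.
move=> acG /set0Pn[r rV].
case: (boolP [exists x in V G, #|nbrs G x| <= 1]%N) => [/exists_inP//|/exists_inPn deg2].
suff /(_ #|T|)[x [p [_ _ /card_uniqP u sp]]] : forall n, exists x p,
    [/\ x \in V G, path (adj G) x p, uniq (x :: p) & size p = n].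
  by have := max_card [in x :: p]; rewrite u /= sp ltnn.
elim=> [|n [x [p [xV xp up sp]]]]; first by exists r, [::].
have [b xb bp] : exists2 b, adj G x b & b != head x p.
  have := deg2 _ xV; rewrite -ltnNge => /card_gt1P[b [c [/[!inE] xb xc bc]]].
  case: (eqVneq b (head x p)) => [bE|]; last by exists b.
  by exists c => //; rewrite -bE eq_sym.
exists b, (x :: p); split; rewrite ?(adj_Vr xb) //=; last by rewrite sp.
  by rewrite adjC xb.
move: (up) => /= ->; rewrite andbT inE negb_or eq_sym (adj_neq xb) /=.
apply/negP => bp'; case: p xp up sp bp bp' => [//|y q] /= /andP[xy yq] up _ by_.
rewrite inE (negbTE by_) /= => bq; case/splitPr: bq yq up => q1 q2.
rewrite cat_path /= => /and3P[yq1 q1b _] up.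
have uc : uniq [:: x, y & rcons q1 b].
  apply: (@subseq_uniq _ _ [:: x, y & q1 ++ b :: q2]) up.
  by rewrite -cat_rcons; exact: (prefix_subseq [:: x, y & _]).
have := acG [:: x, y & rcons q1 b]; rewrite /ucycle uc andbT /= size_rcons => ac.
suff : false by []; apply: ac.
by rewrite !rcons_path last_rcons xy yq1 q1b adjC xb.
Qed.

Lemma spanned_del_sub G x : subrel (adj (mkgraph (V G :\ x) (E G))) (adj G).
Proof. by move=> a b; rewrite /adj /= inE => /andP[]. Qed.

(** A forest has fewer edges than vertices; the difference is one only for a
    tree. *)
Lemma acyclic_card G : acyclic G -> V G != set0 ->
  (#|E G| < #|V G|)%N /\ (#|V G| = #|E G|.+1 -> connected G).
Proof.
move=> acG; move Vn : #|V G|.-1 => n.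
elim: n => [|n IHn] in G acG Vn * => V0; have Vgt0 := V0; rewrite -card_gt0 in Vgt0.
  have /eqP/cards1P[x Vx] : #|V G| = 1%N by lia.
  have E0 : E G = set0.
    apply/setP => e; rewrite inE; apply/negP => eE.
    have := subset_leq_card (edge_sub eE); rewrite (edge_card eE); lia.
  rewrite E0 cards0 Vgt0; split=> // _; split=> // a b.
  by rewrite Vx !inE => /eqP-> /eqP->.
have [x xV degx] := acyclic_leaf acG V0.
set G' := mkgraph (V G :\ x) (E G).
have cV : #|V G| = #|V G'|.+1 by rewrite (cardsD1 x) xV.
have cE : #|E G| = (#|E G'| + #|nbrs G x|)%N by rewrite spannedE; exact: card_edges_del.
have V'0 : V G' != set0 by rewrite -card_gt0; lia.
have acG' : acyclic G' := acyclic_sub (@spanned_del_sub G x) acG.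
have Vn' : #|V G'|.-1 = n by lia.
have [ltE' conE'] := IHn _ acG' Vn' V'0.
split=> [|VE]; first by lia.
have [_ conG'] : connected G' by apply: conE'; lia.
have /card_gt0P[y] : (0 < #|nbrs G x|)%N by lia.
rewrite inE => xy; apply: (connected_root xV) => a aV.
have [->//|ax] := eqVneq a x.
apply: connect_trans (connect1 xy) _.
have yV' : y \in V G' by rewrite !inE eq_sym (adj_neq xy) (adj_Vr xy).
have aV' : a \in V G' by rewrite !inE ax.
apply: connect_sub (conG' _ _ yV' aV') => b c bc.
exact: connect1 (spanned_del_sub bc).
Qed.

(** A connected graph with [#|V G| = #|E G|.+1] has no cycle, since it would stay
    connected after the removal of an edge [{x, y}] of the cycle. *)
Lemma tree_card G : tree G <-> connected G /\ #|V G| = #|E G|.+1.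
Proof.
split=> [[conG acG]|[conG VE]].
  split=> //; apply/eqP; rewrite eqn_leq connected_card //.
  by have [] := acyclic_card acG conG.1.
split=> // c /andP[cyc uc]; rewrite leqNgt; apply/negP.
case: c cyc uc => [//|x [//|y [//|z q]]] /= /and3P[xy yz cyc] /and3P[xu yu zu] _.
pose G' := mkgraph (V G) (E G :\ [set x; y]).
have EG' : E G' = E G :\ [set x; y].
  apply: mkgraphE; apply/subsetP => e; rewrite !inE => /andP[_ eE].
  by rewrite (edge_sub eE) (edge_card eE).
have adjG' a b : adj G' a b = adj G a b && ([set a; b] != [set x; y]).
  by rewrite /adj EG' in_setD1 andbC.
have yx : connect (adj G') y x.
  apply: (@connect_trans _ _ z); first apply: connect1.
    rewrite adjG' yz set2_eq eqxx /= negb_or /=.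
    move: xu yu; rewrite !inE !negb_or ![_ == x]eq_sym ![_ == y]eq_sym.
    by move=> /and3P[/negbTE-> /negbTE-> _] /andP[/negbTE-> _].
  apply/connectP; exists (rcons q x); last by rewrite last_rcons.
  apply: (@sub_in_path _ (fun a => a != y)) cyc => [a b ay b_y ab|].
    by rewrite adjG' ab set2_eq negb_or (negbTE ay) (negbTE b_y) !andbF.
  rewrite /= all_rcons; move: xu yu; rewrite !inE !negb_or => /andP[-> _] /andP[zy yq].
  rewrite eq_sym zy /=; apply/allP => b bq; by apply: contraNneq yq => <-.
have conG' : connected G'.
  split=> [|a b aV bV]; first exact: conG.1.
  apply: (connect_sub _ (conG.2 _ _ aV bV)) => c d cd.
  case: (boolP (adj G' c d)) => [/connect1 //|]; rewrite adjG' cd /= negbK set2_eq.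
  by case/orP => /andP[/eqP-> /eqP->] //; rewrite connect_adjC.
have := connected_card conG'; rewrite [V G']/= VE EG' (cardsD1 [set x; y] (E G)).
by move: (xy : _ \in _) => ->; rewrite ltnn.
Qed.

End GraphBasics.

(** * Independence and rigidity as properties of a linear map *)

Section Rigidity.
Variables (R : realType) (T : finType).
Implicit Types (G H : graph T) (p u w : T -> 'cV[R]_2) (e : {set T}) (a b : T).

Lemma dotDr (x y z : 'cV[R]_2) : dot z (x + y) = dot z x + dot z y.
Proof. by rewrite !dotE !mxE; ring. Qed.

Lemma dotZr (c : R) (x y : 'cV[R]_2) : dot x (c *: y) = c * dot x y.
Proof. by rewrite !dotE !mxE; ring. Qed.

Lemma dotN (x y : 'cV[R]_2) : dot (- x) (- y) = dot x y.
Proof. by rewrite !dotE !mxE; ring. Qed.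

Lemma dotBr (x y z : 'cV[R]_2) : dot z (x - y) = dot z x - dot z y.
Proof. by rewrite !dotE !mxE; ring. Qed.

Lemma dot_turn (x : 'cV[R]_2) : dot x (turn x) = 0.
Proof. by rewrite dotE !turnE; ring. Qed.

Lemma dot_turn2 (x y : 'cV[R]_2) : dot (turn x) (turn y) = dot x y.
Proof. by rewrite !dotE !turnE; ring. Qed.

Lemma turnB (x y : 'cV[R]_2) : turn (x - y) = turn x - turn y.
Proof. by apply: cV2P; rewrite !(turnE, mxE) /=; ring. Qed.

Lemma skew_turn (S : 'M[R]_2) : S^T = - S -> forall x, S *m x = S 1 0 *: turn x.
Proof.
move=> /matrixP skew x; have s0 := skew 0 0; have s1 := skew 1 1; have s2 := skew 0 1.
by apply: cV2P; rewrite mul2E !mxE /=; move: s0 s1 s2; rewrite !mxE => ? ? ?; nra.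
Qed.

Lemma turn_skew (c : R) : exists2 S : 'M[R]_2, S^T = - S &
  forall x, S *m x = c *: turn x.
Proof.
exists (\matrix_(i, j) (if i == j then 0 else if i == 0 then - c else c)).
  apply/matrixP => i j; rewrite !mxE.
  by case: (ord2P i) => ->; case: (ord2P j) => -> /=; ring.
by move=> x; apply: cV2P; rewrite mul2E !mxE /=; ring.
Qed.

(** The entry at the edge [e] of the product of the rigidity matrix at [p] with
    the velocity field [u]. *)
Definition edge_val p u e : R := \sum_(a in e) (rigidity_entry p e a *m u a) 0 0.

Lemma edge_valE p u a b : a != b ->
  edge_val p u [set a; b] = dot (p a - p b) (u a - u b).
Proof.
move=> ab; rewrite /edge_val big_setU1 ?inE //= big_set1 /rigidity_entry !inE !eqxx orbT.
have -> : [set a; b] :\ a = [set b] by rewrite setU1K // inE.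
have -> : [set a; b] :\ b = [set a] by rewrite setUC setU1K // inE eq_sym.
rewrite !big_set1 -[b in RHS]/b -!/(dot _ _) !dotE !mxE; ring.
Qed.

Lemma edge_val_lin p e : forall (c : R) u w,
  edge_val p (fun a => c *: u a + w a) e = c * edge_val p u e + edge_val p w e.
Proof.
move=> c u w; rewrite /edge_val mulr_sumr -big_split; apply: eq_bigr => a _ /=.
by rewrite mulmxDr -scalemxAr !mxE.
Qed.

Lemma eq_edge_val p u w e : {in e, u =1 w} -> edge_val p u e = edge_val p w e.
Proof. by move=> eq_uw; apply: eq_bigr => a ae; rewrite eq_uw. Qed.

Lemma inf_motionE G p u :
  inf_motion G p u <-> (forall e, e \in E G -> edge_val p u e = 0).
Proof.
split=> [mot e /[dup] eE /edgeP[a [b [eab ab _ _]]]|mot a b ab].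
  by rewrite eab edge_valE // mot // /adj -eab.
by rewrite -edge_valE ?mot // (adj_neq ab).
Qed.

(** Adding an infinitesimal rigid motion does not change the edge values. *)
Lemma edge_val_rigid p u (c : R) (t q : 'cV[R]_2) G e : e \in E G ->
  edge_val p (fun a => u a + t + c *: turn (p a - q)) e = edge_val p u e.
Proof.
move=> /edgeP[a [b [-> ab _ _]]]; rewrite !edge_valE //.
rewrite (_ : u a + _ + _ - _ = u a - u b + c *: turn (p a - p b)).
  by rewrite dotDr dotZr dot_turn mulr0 addr0.
by apply: cV2P; rewrite !mxE /=; ring.
Qed.

(** Every prescription of edge values is attained: this is the surjectivity of
    the rigidity matrix, that is, the independence of its rows. *)
Definition onto_edges G p : Prop :=
  forall f : {set T} -> R, exists u, {in E G, forall e, edge_val p u e = f e}.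

(* The velocity field [u], written as a column in the order of the columns of the
   rigidity matrix. *)
Let colvec G u : 'cV[R]_(#|V G| * 2) :=
  (mxvec (\matrix_(i < #|V G|) (u (enum_val i))^T))^T.

Lemma colvec_surj G (y : 'cV[R]_(#|V G| * 2)) : exists u, colvec G u = y.
Proof.
pose M := vec_mx y^T.
exists (fun a => if [pick i | enum_val i == a] is Some i then (row i M)^T else 0).
apply: trmx_inj; rewrite trmxK; apply: (can_inj vec_mxK); rewrite mxvecK.
apply/row_matrixP => i; rewrite rowK; case: pickP => [j|/(_ i)]; last by rewrite eqxx.
by move=> /eqP /enum_val_inj ->; rewrite trmxK.
Qed.

Lemma rigidity_mul G p u k :
  (rigidity_matrix G p *m colvec G u) k 0 = edge_val p u (enum_val k).
Proof.
rewrite mxE (reindex _ (curry_mxvec_bij _ _)) /=.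
transitivity (\sum_ij rigidity_entry p (enum_val k) (enum_val ij.1) 0 ij.2 *
    (u (enum_val (ij.1 : 'I_#|V G|)))^T 0 ij.2).
  apply: eq_bigr => -[i j] _ /=.
  by rewrite [(_^T) _ _]mxE /rigidity_matrix mxE !mxvecE !mxE mxvecE !mxE.
transitivity (\sum_(i < #|V G|) \sum_(j < 2)
    rigidity_entry p (enum_val k) (enum_val i) 0 j * (u (enum_val i))^T 0 j).
  by rewrite pair_bigA.
rewrite /edge_val.
transitivity (\sum_(a in V G) (rigidity_entry p (enum_val k) a *m u a) 0 0).
  rewrite [RHS]big_enum_val /=; apply: eq_bigr => i _; rewrite [in RHS]mxE.
  by apply: eq_bigr => j _; rewrite [(_^T) _ _]mxE.
have /subsetP sV := edge_sub (enum_valP k).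
rewrite (big_setID (enum_val k)) /= [X in _ + X]big1 ?addr0 => [|a].
  by apply: eq_bigl => a; rewrite inE; case: (boolP (a \in enum_val k)) => [/sV->|]; rewrite ?andbF.
by rewrite inE /rigidity_entry => /andP[/negbTE-> _]; rewrite mul0mx mxE.
Qed.

(** If [v] is a dependency between the rows and [v^T] is attained by the rigidity
    matrix, then [v *m v^T = 0]. *)
Lemma independentE G p : independent G p <-> onto_edges G p.
Proof.
split=> [/row_freeP[B RB] f|onto].
  pose F : 'cV[R]_#|E G| := \col_k f (enum_val k).
  have [u uE] := colvec_surj (B *m F); exists u => e eE.
  rewrite -(enum_rankK_in eE eE) -rigidity_mul uE mulmxA RB mul1mx mxE.
  by rewrite enum_rankK_in.
apply: inj_row_free => v v0.
have [u uE] := onto (fun e => \sum_(k | enum_val k == e) v 0 k).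
have Ru : rigidity_matrix G p *m colvec G u = v^T.
  apply/colP => k; rewrite rigidity_mul uE ?enum_valP // mxE.
  by rewrite (big_pred1 k) // => j; rewrite (inj_eq enum_val_inj).
have : v *m v^T = 0 by rewrite -Ru mulmxA v0 mul0mx.
move/matrixP/(_ 0 0); rewrite !mxE => /eqP.
under eq_bigr do rewrite mxE -expr2.
rewrite psumr_eq0 => [/allP vv0|k _]; last exact: sqr_ge0.
apply/rowP => k; have := vv0 k (mem_index_enum _); rewrite expf_eq0 /= => /eqP ->.
by rewrite mxE.
Qed.

End Rigidity.

Section Pinning.
Variables (R : realType) (T : finType).
Implicit Types (G H : graph T) (p u w : T -> 'cV[R]_2) (e : {set T}) (a b : T).

(** Extension by zero of a function on the members of a set. *)
Definition ext0 (X : finType) (A : {pred X}) (W : zmodType) (f : {x | x \in A} -> W) x : W :=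
  if insub x is Some y then f y else 0.

Lemma ext0E (X : finType) (A : {pred X}) (W : zmodType) (f : {x | x \in A} -> W) y :
  ext0 f (val y) = f y.
Proof. by rewrite /ext0 valK. Qed.

Lemma dim_pair (vT wT : vectType R) :
  \dim {: (vT * wT)%type} = (\dim {:vT} + \dim {:wT})%N.
Proof. by rewrite !dimvf. Qed.

Section Pins.
Variables (G : graph T) (p : T -> 'cV[R]_2) (a0 b0 : T).
Hypotheses (a0V : a0 \in V G) (b0V : b0 \in V G) (pab : p a0 <> p b0).

Let d := turn (p b0 - p a0).

Let d_neq0 : dot d d != 0.
Proof.
rewrite dot_turn2; apply/eqP => /dot_eq0 /eqP; rewrite subr_eq0 => /eqP pE.
by apply: pab.
Qed.

(* The three last coordinates are zero only for the trivial infinitesimal rigid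
   motion: they fix [a0], and [b0] in the direction orthogonal to [p b0 - p a0]. *)
Let pinned (u : {ffun T -> 'cV[R]_2}) :
    {ffun {e | e \in E G} -> R^o} *
    ({ffun {a | a \in ~: V G} -> 'cV[R]_2} * ('cV[R]_2 * R^o)) :=
  ([ffun e => edge_val p u (val e)], ([ffun a => u (val a)], (u a0, dot d (u b0)))).

Let pinned_linear : linear pinned.
Proof.
move=> c u w; congr (_, (_, (_, _))).
- apply/ffunP => e; rewrite !ffunE -[RHS]edge_val_lin.
  by apply: eq_edge_val => a _; rewrite !ffunE.
- by apply/ffunP => a; rewrite !ffunE.
- by rewrite !ffunE.
- by rewrite !ffunE dotDr dotZr.
Qed.

Let dim_source : \dim {: {ffun T -> 'cV[R]_2}} = (2 * #|V G| + 2 * #|~: V G|)%N.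
Proof. by rewrite -mulnDr cardsC dimvf /dim /= mulnC. Qed.

Let dim_target : \dim {: ({ffun {e | e \in E G} -> R^o} *
    ({ffun {a | a \in ~: V G} -> 'cV[R]_2} * ('cV[R]_2 * R^o)))%type} =
  (#|E G| + 3 + 2 * #|~: V G|)%N.
Proof.
rewrite !dim_pair !dim_ffun_pred !dimvf /dim /=; lia.
Qed.

Let pinned_onto : onto_edges G p -> forall y, exists u : {ffun T -> 'cV[R]_2}, pinned u = y.
Proof.
move=> onto [f [g [t r]]]; have [u0 u0E] := onto (ext0 f).
pose s := t - u0 a0; pose c := (r - dot d (u0 b0 + s)) / dot d d.
pose u1 a := u0 a + s + c *: turn (p a - p a0).
exists [ffun a => if a \in V G then u1 a else ext0 g a].
congr (_, (_, (_, _))).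
- apply/ffunP => e; rewrite ffunE -[RHS]ext0E -u0E ?(valP e) //.
  rewrite -(edge_val_rigid p u0 c s (p a0) (valP e)).
  apply: eq_edge_val => a ae; rewrite ffunE.
  by rewrite (subsetP (edge_sub (valP e)) _ ae).
- apply/ffunP => a; rewrite !ffunE; have := valP a; rewrite inE => /negbTE ->.
  exact: ext0E.
- rewrite ffunE a0V /u1 subrr (_ : turn 0 = 0) ?scaler0 ?addr0 /s ?subrKC //.
  by apply: cV2P; rewrite turnE !mxE ?oppr0.
- by rewrite ffunE b0V /u1 dotDr dotZr -/d /c divfK // addrC subrK.
Qed.

(** Edge values and pinning conditions can be prescribed together: a rigid motion
    adjusts the latter without changing the former. *)
Lemma onto_edges_card : onto_edges G p -> (#|E G| + 3 <= 2 * #|V G|)%N.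
Proof.
move=> onto; have := linear_surj_dim pinned_linear (pinned_onto onto).
rewrite dim_source dim_target; lia.
Qed.

(** A motion of a rigid framework that satisfies the pinning conditions is zero. *)
Lemma inf_rigid_card : inf_rigid G p -> (2 * #|V G| <= #|E G| + 3)%N.
Proof.
move=> rigid; suff inj : forall u : {ffun T -> 'cV[R]_2}, pinned u = 0 -> u = 0.
  by have := linear_inj_dim pinned_linear inj; rewrite dim_source dim_target; lia.
move=> u [/ffunP u0 /ffunP uout ua0 ub0].
have /rigid[S [t [skew uE]]] : inf_motion G p u.
  by apply/inf_motionE => e eE; have := u0 (Sub e eE); rewrite !ffunE.
have tE : t = - (S 1 0 *: turn (p a0)).
  have := uE _ a0V; rewrite ua0 (skew_turn skew) => /esym /eqP.
  by rewrite addr_eq0 => /eqP ->; rewrite opprK.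
have uE' a : a \in V G -> u a = S 1 0 *: turn (p a - p a0).
  by move=> aV; rewrite uE // (skew_turn skew) tE turnB scalerBr.
have S0 : S 1 0 = 0.
  move: ub0; rewrite uE' // dotZr => /eqP; rewrite mulf_eq0 (negbTE d_neq0) orbF.
  by move/eqP.
apply/ffunP => a; rewrite ffunE; case: (boolP (a \in V G)) => aV.
  by rewrite uE' // S0 scale0r.
have aV' : a \in ~: V G by rewrite inE.
by have := uout (Sub a aV'); rewrite !ffunE.
Qed.

(** With at least [2 #|V G| - 3] edges the pinned map is also injective, so a motion
    agrees with the rigid motion that has the same pinned coordinates. *)
Lemma onto_edges_rigid : onto_edges G p -> (2 * #|V G| <= #|E G| + 3)%N ->
  inf_rigid G p.
Proof.
move=> onto le_card u /inf_motionE mot.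
pose s := - u a0; pose c := - dot d (u b0 + s) / dot d d.
pose u1 a := u a + s + c *: turn (p a - p a0).
pose w : {ffun T -> 'cV[R]_2} := [ffun a => if a \in V G then u1 a else 0].
have w0 : w = 0.
  apply: (linear_surj_inj pinned_linear (pinned_onto onto)).
    by rewrite dim_source dim_target; lia.
  congr (_, (_, (_, _))).
  - apply/ffunP => e; rewrite !ffunE -[RHS](mot _ (valP e)).
    rewrite -(edge_val_rigid p u c s (p a0) (valP e)).
    apply: eq_edge_val => a ae; rewrite ffunE.
    by rewrite (subsetP (edge_sub (valP e)) _ ae).
  - by apply/ffunP => a; rewrite !ffunE; have := valP a; rewrite inE => /negbTE ->.
  - rewrite ffunE a0V /u1 /s subrr add0r subrr (_ : turn 0 = 0) ?scaler0 //.
    by apply: cV2P; rewrite turnE !mxE ?oppr0.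
  - by rewrite ffunE b0V /u1 dotDr dotZr -/d /c divfK // subrr.
have [S skew SE] := turn_skew (- c).
exists S, (c *: turn (p a0) - s); split=> // a aV.
have := congr1 (fun f : {ffun T -> 'cV[R]_2} => f a) w0.
rewrite /w !ffunE aV /u1 => uE.
by rewrite SE; apply: cV2P; have /colP uEc := uE; [have := uEc 0 | have := uEc 1];
  rewrite !mxE /= => ?; lra.
Qed.

End Pins.

(** A rigid framework with at least three vertices has an edge, since its
    infinitesimal motions depend on three parameters only. *)
Lemma inf_rigid_edge G p : inf_rigid G p -> (3 <= #|V G|)%N -> E G != set0.
Proof.
move=> rigid V3; apply/eqP => E0.
pose L (x : R^o * 'cV[R]_2) : {ffun {a | a \in V G} -> 'cV[R]_2} :=
  [ffun a => x.1 *: turn (p (val a)) + x.2].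
have linL : linear L.
  move=> c x y; apply/ffunP => a; rewrite !ffunE /=.
  by rewrite scalerDl scalerDr scalerA addrACA.
have surjL y : exists x, L x = y.
  have [|S [t [skew uE]]] := rigid (ext0 y).
    by apply/inf_motionE => e; rewrite E0 inE.
  exists (S 1 0, t); apply/ffunP => a; rewrite ffunE -[RHS]ext0E uE ?(valP a) //.
  by rewrite (skew_turn skew).
have := linear_surj_dim linL surjL.
by rewrite dim_pair dim_ffun_pred !dimvf /dim /=; lia.
Qed.

(** Maxwell's lower bound on the number of edges of a rigid framework. *)
Lemma inf_rigid_maxwell G p : realization G p -> inf_rigid G p ->
  (3 <= #|V G|)%N -> (2 * #|V G| <= #|E G| + 3)%N.
Proof.
move=> real rigid V3; have /set0Pn[e eE] := inf_rigid_edge rigid V3.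
have [a [b [eab ab aV bV]]] := edgeP eE.
apply: (inf_rigid_card aV bV _ rigid); apply: real; by rewrite /adj -eab.
Qed.

(** An edge with coincident ends has the value zero for every velocity field. *)
Lemma onto_edges_neq G p a b : onto_edges G p -> adj G a b -> p a <> p b.
Proof.
move=> /(_ (fun=> 1))[u uE] ab pab; have := uE _ ab.
rewrite edge_valE ?(adj_neq ab) // pab subrr dotE !mxE !mul0r addr0 => /eqP.
by rewrite eq_sym oner_eq0.
Qed.

Lemma onto_edges_sub G H p : onto_edges G p -> E H \subset E G -> onto_edges H p.
Proof.
move=> onto /subsetP sHG f; have [u uE] := onto f; exists u => e /sHG; exact: uE.
Qed.

(** Every subgraph of an independent framework is sparse. *)
Lemma onto_edges_sparse G p H : onto_edges G p -> subgraph H G ->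
  (2 <= #|V H|)%N -> (#|E H| <= 2 * #|V H| - 3)%N.
Proof.
move=> onto [_ EHG] V2; have ontoH := onto_edges_sub onto EHG.
have [->|/set0Pn[e eE]] := eqVneq (E H) set0; first by rewrite cards0.
have [a [b [eab ab aV bV]]] := edgeP eE; have adj_ab : adj H a b by rewrite /adj -eab.
have := onto_edges_card aV bV (onto_edges_neq ontoH adj_ab) ontoH; lia.
Qed.

End Pinning.

(** * Frameworks with three-fold rotational symmetry *)

Section Symmetry.
Variables (R : realType) (T : finType).
Implicit Types (G H : graph T) (p u w : T -> 'cV[R]_2) (e : {set T}) (a b : T).
Implicit Types (s : {perm T}) (Phi : 'M[R]_2 -> {perm T}).

Lemma aut_V G s a : s \in Aut G -> (s a \in V G) = (a \in V G).
Proof. by rewrite inE => /andP[/perm_closed]. Qed.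

Lemma aut_adj G s a b : s \in Aut G -> adj G (s a) (s b) = adj G a b.
Proof.
move=> sA; case: (boolP (a \in V G)) => aV; last first.
  rewrite (contraNF (@adj_Vl _ _ _ _) aV) (contraNF (@adj_Vl _ _ _ _)) //.
  by rewrite aut_V.
case: (boolP (b \in V G)) => bV; last first.
  rewrite (contraNF (@adj_Vr _ _ _ _) bV) (contraNF (@adj_Vr _ _ _ _)) //.
  by rewrite aut_V.
by move: sA; rewrite inE => /andP[_ /forall_inP/(_ a aV)/forall_inP/(_ b bV)/eqP].
Qed.

Lemma imset_pair s a b : s @: [set a; b] = [set s a; s b].
Proof. by rewrite imsetU !imset_set1. Qed.

Lemma aut_edge G s e : s \in Aut G -> e \in E G -> s @: e \in E G.
Proof.
move=> sA /[dup] eE /edgeP[a [b [eab _ _ _]]]; move: eE.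
by rewrite eab imset_pair -[_ \in _](aut_adj a b sA).
Qed.

Lemma C3_cube : C3 *m (C3 *m C3) = 1%:M :> 'M[R]_2.
Proof. by rewrite !C3_mul_mx mulmxBr mulmxN mulmx1 C3_mul_mx opprB opprK addKr. Qed.

(** A homomorphism is determined by the image of the generator, an automorphism of
    order dividing three. *)
Lemma C3_homE G Phi : C3_hom G Phi ->
  [/\ Phi 1%:M = 1%g, Phi (C3 *m C3) = (Phi C3 * Phi C3)%g,
      forall x, Phi C3 (Phi C3 (Phi C3 x)) = x & Phi C3 \in Aut G].
Proof.
case=> PhiA PhiM.
have c1 : (1%:M : 'M[R]_2) \in C3_group by rewrite !inE eqxx.
have c2 : (C3 : 'M[R]_2) \in C3_group by rewrite !inE eqxx orbT.
have c3 : (C3 *m C3 : 'M[R]_2) \in C3_group by rewrite !inE eqxx !orbT.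
have Phi1 : Phi 1%:M = 1%g.
  by apply: (mulgI (Phi 1%:M)); rewrite -PhiM // mulmx1 mulg1.
have Phi2 := PhiM _ _ c2 c2; split; rewrite ?PhiA // => x.
by rewrite -!permM mulgA -Phi2 -PhiM // C3_cube Phi1 perm1.
Qed.

(** The placement [p] is carried to itself by the rotation acting on the plane and
    [s] acting on the vertices of [G]. *)
Definition equivariant G s p := {in V G, forall a, C3 *m p a = p (s a)}.

(** The symmetry equations follow from the one of the generator. *)
Lemma symmetricE G Phi p : C3_hom G Phi ->
  symmetric G Phi p <-> equivariant G (Phi C3) p.
Proof.
move=> /C3_homE[Phi1 Phi2 _ PhiA]; split=> [sym a aV|eqv x].
  by rewrite sym // !inE eqxx orbT.
rewrite !inE => /or3P[]/eqP-> a aV; first by rewrite mul1mx Phi1 perm1.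
  exact: eqv.
by rewrite -mulmxA !eqv ?Phi2 ?permM ?aut_V.
Qed.

Section FixedVertices.
Variables (G : graph T) (s : {perm T}) (p : T -> 'cV[R]_2).
Hypotheses (sA : s \in Aut G) (s3 : forall x, s (s (s x)) = x).
Hypotheses (symp : equivariant G s p) (real : realization G p) (E0 : E G != set0).

Let sE (e : {set T}) : {set T} := s @: e.

Let sE3 e : sE (sE (sE e)) = e.
Proof.
rewrite /sE -!imset_comp -[RHS]imset_id; apply: eq_imset => x; exact: s3.
Qed.

Let fixed_origin a : a \in V G -> s a = a -> p a = 0.
Proof. by move=> aV sa; apply: C3_fix; rewrite symp // sa. Qed.

Let sE_nofix : {in E G, forall e, sE e != e}.
Proof.
move=> e /[dup] eE /edgeP[a [b [eab ab aV bV]]]; apply/eqP.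
rewrite /sE eab imset_pair => /eqP; rewrite set2_eq => /orP[]/andP[/eqP sa /eqP sb].
  by apply: (real (a := a) (b := b)); rewrite /adj -?eab // !fixed_origin.
by have := s3 a; rewrite sa sb sa => ba; rewrite ba eqxx in ab.
Qed.

Let NF := [set a in V G | s a != a].
Let NR := [set a in NF | orep s a == a].
Let ER := [set e in E G | orep sE e == e].

Let card_NF : #|NF| = (3 * #|NR|)%N.
Proof.
apply: card_order3 => // a; rewrite !inE => /andP[aV sa] //.
by rewrite aut_V // aV (inj_eq perm_inj).
Qed.

Let card_ER : #|E G| = (3 * #|ER|)%N.
Proof. by apply: card_order3 => // e; exact: aut_edge. Qed.

(* The symmetric velocity field with values [f] at the orbit representatives. *)
Let ext (f : T -> 'cV[R]_2) a := equiv_ext s (mulmx C3) f a.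

Let ext_lin (c : R) (f g : T -> 'cV[R]_2) a :
  ext (fun b => c *: f b + g b) a = c *: ext f a + ext g a.
Proof.
rewrite /ext /equiv_ext; do ![case: ifP => _] => //;
  by rewrite ?mulmxDr -?scalemxAr ?scaler0 ?addr0 // mulmxDr -scalemxAr.
Qed.

Let ext_eq (f g : T -> 'cV[R]_2) a : (f =1 g) -> ext f a = ext g a.
Proof. by move=> fg; rewrite /ext /equiv_ext !fg. Qed.

(* Averaging a velocity field over the three rotations; the inverse of [C3] is
   written as the composite of two copies. *)
Let avg u a := 3^-1 *: (u a + C3 *m (C3 *m u (s a)) + C3 *m u (s (s a))).

Let avg_equiv u a : C3 *m avg u a = avg u (s a).
Proof.
rewrite /avg -scalemxAr !mulmxDr C3_cubed s3; congr (_ *: _).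
by rewrite [RHS]addrC addrA.
Qed.

Let edge_val_step u e : e \in E G ->
  edge_val p (fun a => C3 *m (C3 *m u (s a))) e = edge_val p u (sE e).
Proof.
move=> /edgeP[a [b [-> ab aV bV]]]; rewrite /sE imset_pair !edge_valE ?(inj_eq perm_inj) //.
by rewrite -!symp // -!mulmxBr -[LHS]C3_dot C3_cubed.
Qed.

Let edge_val_avg u e : e \in E G -> edge_val p (avg u) e =
  3^-1 * (edge_val p u e + edge_val p u (sE e) + edge_val p u (sE (sE e))).
Proof.
move=> eE; have sEe : sE e \in E G := aut_edge sA eE.
rewrite -(edge_val_step u sEe) -[edge_val p _ (sE e)](edge_val_step _ eE).
rewrite -[edge_val _ _ (sE e)]edge_val_step //.
move: eE => /edgeP[a [b [-> ab aV bV]]]; rewrite !edge_valE //.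
by rewrite -!dotDr -dotZr /avg !C3_cubed -scalerBr; congr (dot _ (_ *: _));
  rewrite opprD addrACA; congr (_ + _); rewrite opprD addrACA.
Qed.

(** The fixed vertices sit at the origin, and the rotation about the origin is a
    symmetric infinitesimal motion: comparing the numbers of orbits of edges and
    of coordinates excludes fixed vertices in a minimally rigid framework. *)
Lemma onto_edges_fixed : onto_edges G p -> (#|E G| + 3 <= 2 * #|NF|)%N.
Proof.
move=> onto.
have [a0 a0N pa0] : exists2 a, a \in NF & p a != 0.
  have /set0Pn[e /[dup] eE /edgeP[a [b [eab ab aV bV]]]] := E0.
  have pab : p a <> p b by apply: real; rewrite /adj -eab.
  have [pa|pa] := eqVneq (p a) 0; last first.
    exists a => //; rewrite inE aV; apply: contra pa => /eqP sa.
    by rewrite fixed_origin.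
  have pb : p b != 0 by apply/eqP => pb; apply: pab; rewrite pa pb.
  exists b => //; rewrite inE bV; apply: contra pb => /eqP sb.
  by rewrite fixed_origin.
have d0 : dot (p a0) (p a0) != 0 by apply/eqP => /dot_eq0 /eqP; exact/negP.
have a0V : a0 \in V G by move: a0N; rewrite inE => /andP[].
pose L (f : {ffun T -> 'cV[R]_2}) : {ffun {e | e \in ER} -> R^o} *
    ({ffun {a | a \in ~: NR} -> 'cV[R]_2} * R^o) :=
  ([ffun e => edge_val p (ext f) (val e)],
   ([ffun a => f (val a)], dot (turn (p a0)) (ext f a0))).
(* The last coordinate pins the symmetric motion, the rotation about the origin. *)
have linL : linear L.
  move=> c f g.
  have extE : ext (c *: f + g) =1 (fun a => c *: ext f a + ext g a).
    by move=> a; rewrite -ext_lin; apply: ext_eq => b; rewrite !ffunE.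
  congr (_, (_, _)).
  - apply/ffunP => e; rewrite !ffunE -[RHS]edge_val_lin.
    by apply: eq_edge_val => a _.
  - by apply/ffunP => a; rewrite !ffunE.
  - by rewrite extE dotDr dotZr.
have surjL y : exists f : {ffun T -> 'cV[R]_2}, L f = y.
  case: y => [f [g r]].
  have [u0 u0E] := onto (fun e => ext0 f (orep sE e)).
  pose c := (r - dot (turn (p a0)) (avg u0 a0)) / dot (p a0) (p a0).
  pose u a := avg u0 a + 0 + c *: turn (p a - 0).
  have uequiv : {in V G, forall a, C3 *m u a = u (s a)}.
    by move=> a aV; rewrite /u !subr0 !addr0 mulmxDr avg_equiv -scalemxAr C3_turn symp.
  pose F : {ffun T -> 'cV[R]_2} := [ffun a => if a \in NR then u a else ext0 g a].
  have extF : {in V G, ext F =1 u}.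
    move=> a aV; have [sa|sa] := eqVneq (s a) a.
      rewrite /ext /equiv_ext sa eqxx; apply/esym/C3_fix; by rewrite uequiv // sa.
    have rV : orep s a \in V G.
      by have := orep_in s a; rewrite !inE => /orP[/orP[]|] /eqP->; rewrite ?aut_V.
    have rN : orep s a \in NR by rewrite !inE rV orep_fixed // sa orep_id // eqxx.
    have extr : ext F (orep s a) = u (orep s a).
      by rewrite /ext equiv_ext_rep ?orep_id ?orep_fixed // ffunE rN.
    have step b : ext F (s b) = C3 *m ext F b.
      by rewrite /ext equiv_ext_step ?mulmx0 // => w; exact: C3_cubed.
    case: (orepP s3 a) => ->; rewrite ?step extr //.
      by rewrite uequiv.
    by rewrite !uequiv ?aut_V.
  exists F; congr (_, (_, _)).
  - apply/ffunP => e; rewrite ffunE.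
    have /[!inE]/andP[eE /eqP re] := valP e.
    rewrite (@eq_edge_val _ _ _ _ u) => [|a ae]; last first.
      by rewrite extF // (subsetP (edge_sub eE)).
    rewrite (edge_val_rigid p _ _ _ _ eE) edge_val_avg //.
    rewrite !u0E ?aut_edge // ?[sE _](aut_edge) //.
    by rewrite !orep_step // re ext0E; field.
  - apply/ffunP => a; rewrite !ffunE; have := valP a; rewrite inE => /negbTE ->.
    exact: ext0E.
  - rewrite extF // /u subr0 addr0 dotDr (dotZr c) dot_turn2 /c divfK //.
    by rewrite addrC subrK.
have dimS : \dim {: {ffun T -> 'cV[R]_2}} = (2 * #|T|)%N by rewrite dimvf /dim /= mulnC.
have := linear_surj_dim linL surjL.
rewrite dimS !dim_pair !dim_ffun_pred !dimvf /dim /=.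
have := cardsC NR; rewrite card_NF card_ER.
by move: #|T| #|NR| #|ER| #|~: NR| => ? ? ? ?; lia.
Qed.

End FixedVertices.
End Symmetry.

(** * Generic symmetric placements *)

Section Generic.
Variables (R : realType) (T : finType).
Local Notation placement := (T -> 'cV[R]_2).
Implicit Types (G : graph T) (p q : placement) (F : placement -> R).
Implicit Types (s : {perm T}) (S : placement -> Prop) (a b c : T).

(** The line through the placements [p] and [q], at the times 0 and 1. *)
Definition line p q (t : R) : placement := fun a => p a + t *: (q a - p a).

Lemma line0 p q : line p q 0 = p.
Proof. by apply: funext => a; rewrite /line scale0r addr0. Qed.

Lemma line1 p q : line p q 1 = q.
Proof. by apply: funext => a; rewrite /line scale1r addrC subrK. Qed.

(** Functions of a placement that are polynomial along every line. *)
Definition line_poly F : Prop :=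
  forall p q, exists P : {poly R}, forall t, F (line p q t) = P.[t].

Lemma eq_line_poly F1 F2 : F1 =1 F2 -> line_poly F2 -> line_poly F1.
Proof. by move=> /funext->. Qed.

Lemma line_poly_const (c : R) : line_poly (fun=> c).
Proof. by move=> p q; exists c%:P => t; rewrite hornerC. Qed.

Lemma line_poly_coord a i : line_poly (fun p => p a i 0).
Proof.
move=> p q; exists ((p a i 0)%:P + 'X * (q a i 0 - p a i 0)%:P) => t.
by rewrite !hornerE !mxE.
Qed.

Lemma line_polyD F1 F2 : line_poly F1 -> line_poly F2 -> line_poly (fun p => F1 p + F2 p).
Proof.
move=> l1 l2 p q; have [P PE] := l1 p q; have [Q QE] := l2 p q.
by exists (P + Q) => t; rewrite hornerD PE QE.
Qed.

Lemma line_polyN F : line_poly F -> line_poly (fun p => - F p).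
Proof.
by move=> l p q; have [P PE] := l p q; exists (- P) => t; rewrite hornerN PE.
Qed.

Lemma line_polyM F1 F2 : line_poly F1 -> line_poly F2 -> line_poly (fun p => F1 p * F2 p).
Proof.
move=> l1 l2 p q; have [P PE] := l1 p q; have [Q QE] := l2 p q.
by exists (P * Q) => t; rewrite hornerM PE QE.
Qed.

Lemma line_poly_sum (I : Type) (r : seq I) (Pr : pred I) (F : I -> placement -> R) :
  (forall i, line_poly (F i)) -> line_poly (fun p => \sum_(i <- r | Pr i) F i p).
Proof.
move=> lF; elim: r => [|i r IHr].
  by apply: (eq_line_poly (fun p => big_nil _ _ _ _)); exact: line_poly_const.
apply: (eq_line_poly (fun p => big_cons _ _ _ _ _ _)).
by case: (Pr i) => //; apply: line_polyD.
Qed.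

Lemma line_poly_prod (I : Type) (r : seq I) (Pr : pred I) (F : I -> placement -> R) :
  (forall i, line_poly (F i)) -> line_poly (fun p => \prod_(i <- r | Pr i) F i p).
Proof.
move=> lF; elim: r => [|i r IHr].
  by apply: (eq_line_poly (fun p => big_nil _ _ _ _)); exact: line_poly_const.
apply: (eq_line_poly (fun p => big_cons _ _ _ _ _ _)).
by case: (Pr i) => //; apply: line_polyM.
Qed.

Lemma line_poly_det n (A : placement -> 'M[R]_n) :
  (forall i j, line_poly (fun p => A p i j)) -> line_poly (fun p => \det (A p)).
Proof.
move=> lA; apply: line_poly_sum => s; apply: line_polyM; first exact: line_poly_const.
exact: line_poly_prod.
Qed.

Lemma line_poly_rigidity G k j : line_poly (fun p => rigidity_matrix G p k j).
Proof.
case/mxvec_indexP: j => i j.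
apply: (@eq_line_poly _
    (fun p => rigidity_entry p (enum_val k) (enum_val i) 0 j)) => [p|].
  by rewrite mxE mxvecE mxE.
case: (boolP (enum_val i \in enum_val k)) => ik; last first.
  apply: (@eq_line_poly _ (fun=> 0)) => [p|]; last exact: line_poly_const.
  by rewrite /rigidity_entry (negbTE ik) mxE.
apply: (@eq_line_poly _
    (fun p => \sum_(b in enum_val k :\ enum_val i) (p (enum_val i) j 0 + - p b j 0))) => [p|].
  by rewrite /rigidity_entry ik summxE; apply: eq_bigr => b _; rewrite !mxE.
apply: line_poly_sum => b; apply: line_polyD; last apply: line_polyN.
all: exact: line_poly_coord.
Qed.

(** A nonzero polynomial has fewer roots than there are natural numbers. *)
Lemma poly_nonroot (P : {poly R}) : P != 0 -> exists t, P.[t] != 0.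
Proof.
move=> P0; pose rs : seq R := [seq n%:R | n <- iota 0 (size P)].
case: (boolP (all (root P) rs)) => [roots|/allPn[t _ Pt]]; last by exists t.
have /(max_poly_roots P0 roots) : uniq rs.
  rewrite map_inj_uniq ?iota_uniq // => m n /eqP; rewrite eqr_nat; exact/eqP.
by rewrite size_map size_iota ltnn.
Qed.

(** Two such functions that do not vanish at [p] and at [q] have a common point of
    nonvanishing on the line. *)
Lemma line_poly_both F1 F2 p q : line_poly F1 -> line_poly F2 ->
  F1 p != 0 -> F2 q != 0 -> exists t, F1 (line p q t) != 0 /\ F2 (line p q t) != 0.
Proof.
move=> l1 l2 F1p F2q; have [P PE] := l1 p q; have [Q QE] := l2 p q.
have P0 : P != 0.
  by apply: contraNneq F1p => P0; rewrite -(line0 p q) PE P0 horner0.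
have Q0 : Q != 0.
  by apply: contraNneq F2q => Q0; rewrite -(line1 p q) QE Q0 horner0.
have [t] := poly_nonroot (mulf_neq0 P0 Q0).
by rewrite hornerM mulf_eq0 negb_or -PE -QE => /andP[]; exists t.
Qed.

(** Sets of placements containing the line through any two of their members. *)
Definition line_closed S : Prop := forall p q t, S p -> S q -> S (line p q t).

(** Finitely many polynomial functions have a common point of a line-closed set
    where none of them vanishes, except those that vanish on the whole set. The
    point found for some of the functions is moved along a line on which their
    product and the next function are not zero. *)
Lemma line_poly_generic (I : finType) (F : I -> placement -> R) S p0 :
    (forall i, line_poly (F i)) -> line_closed S -> S p0 ->
  exists2 p, S p & forall i, F i p = 0 -> forall q, S q -> F i q = 0.
Proof.
move=> lF lS Sp0; suff [p Sp pP] : exists2 p, S p & forall i, i \in index_enum I ->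
    F i p = 0 -> forall q, S q -> F i q = 0.
  by exists p => // i; apply: pP; exact: mem_index_enum.
elim: (index_enum I) => [|i r [p Sp pP]]; first by exists p0.
have [[q Sq Fq]|Fi] := pselect (exists2 q, S q & F i q != 0); last first.
  exists p => // j; rewrite inE => /orP[/eqP->|jr]; last exact: pP.
  move=> _ q Sq; apply/eqP/negPn/negP => Fq; apply: Fi; by exists q.
pose H p' := \prod_(j <- r | F j p != 0) F j p'.
have lH : line_poly H by exact: line_poly_prod.
have Hp : H p != 0 by rewrite /H prodf_seq_neq0; apply/allP => j _; exact/implyP.
have [t [Ht Ft]] := line_poly_both lH (lF i) Hp Fq.
exists (line p q t); first exact: lS.
move=> j; rewrite inE => /orP[/eqP-> F0|jr F0]; first by rewrite F0 eqxx in Ft.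
apply: pP => //; apply/eqP; apply: contraLR Ht => Fj.
by rewrite negbK /H prodf_seq_eq0; apply/hasP; exists j; rewrite ?Fj ?F0 /=.
Qed.

Lemma equivariant_line G s : line_closed (equivariant G s).
Proof.
move=> p q t ep eq a aV; rewrite /line mulmxDr -scalemxAr mulmxBr.
by rewrite ep // eq.
Qed.

(** Independence is a nonvanishing condition on a maximal minor. *)
Lemma onto_edges_minor G p : onto_edges G p ->
  exists2 g : 'I_#|E G| -> 'I_(#|V G| * 2), injective g &
    \det (colsub g (rigidity_matrix G p)) != 0.
Proof.
move=> /independentE ind.
have fullA : row_full (rigidity_matrix G p)^T by rewrite /row_full mxrank_tr; exact: ind.
exists (fullrankfun fullA); first exact: fullrankfun_inj.
have := fullrowsub_unit fullA; rewrite unitmxE unitfE -det_tr.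
by rewrite trmx_mxsub trmxK.
Qed.

Lemma minor_onto_edges G p (g : 'I_#|E G| -> 'I_(#|V G| * 2)) :
  \det (colsub g (rigidity_matrix G p)) != 0 -> onto_edges G p.
Proof.
rewrite -unitfE -unitmxE => unitA; apply/independentE; apply: inj_row_free => v v0.
have : v *m colsub g (rigidity_matrix G p) = 0.
  by rewrite mulmx_colsub v0; apply/matrixP => i j; rewrite !mxE.
by move/(congr1 (mulmx^~ (invmx (colsub g (rigidity_matrix G p))))); rewrite mulmxK // mul0mx.
Qed.

Lemma onto_edges_line_poly G p : onto_edges G p ->
  exists F, [/\ line_poly F, F p != 0 & forall q, F q != 0 -> onto_edges G q].
Proof.
move=> /onto_edges_minor[g _ gp].
exists (fun q => \det (colsub g (rigidity_matrix G q))); split=> // [|q].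
  apply: line_poly_det => i j.
  apply: (@eq_line_poly _ (fun q => rigidity_matrix G q i (g j))) => [q|].
    by rewrite mxE.
  exact: line_poly_rigidity.
exact: minor_onto_edges.
Qed.

(** The minor that witnesses the independence of [q] is a minor of the rigidity
    matrix of the complete graph, hence does not vanish at the generic [p]. *)
Lemma generic_onto_edges G (Phi : 'M[R]_2 -> {perm T}) p q :
  generic G Phi p -> symmetric G Phi q -> onto_edges G q -> onto_edges G p.
Proof.
move=> gen symq /onto_edges_minor[g g_inj gq].
pose K := complete_graph (V G).
have eK (k : 'I_#|E G|) : enum_val k \in E K.
  have eE := enum_valP k; rewrite inE edge_sub //; exact/eqP/edge_card/eE.
pose f k : 'I_#|E K| := enum_rank_in (eK k) (enum_val k).
have fE k : enum_val (f k) = enum_val k by rewrite enum_rankK_in.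
have f_inj : injective f by move=> j k /(congr1 enum_val); rewrite !fE => /enum_val_inj.
have subE r : mxsub f g (rigidity_matrix K r) = colsub g (rigidity_matrix G r).
  by apply/matrixP => k j; rewrite !mxE; congr (mxvec _ _ _); apply/matrixP => i l; rewrite !mxE fE.
apply: (@minor_onto_edges _ _ g); rewrite -subE; apply: contraNneq gq => gp.
by rewrite -subE; apply/eqP; exact: (gen _ f g f_inj g_inj gp).
Qed.

(** The finitely many conditions are the minors of the complete graph and the
    squared lengths of the edges of [G]. Injectivity of the row selection bounds
    the order of a minor. *)
Lemma exists_generic G (Phi : 'M[R]_2 -> {perm T}) p0 : C3_hom G Phi ->
  sym_realization G Phi p0 -> exists2 p, sym_realization G Phi p & generic G Phi p.
Proof.
move=> hPhi [real0 /(symmetricE _ hPhi) sym0].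
pose K := complete_graph (V G); pose N := #|E K|.
pose minors := {m : 'I_N.+1 & ({ffun 'I_m -> 'I_N} * {ffun 'I_m -> 'I_(#|V K| * 2)})%type}.
pose edges := {e | e \in E G}.
pose F (x : minors + edges) p : R := match x with
  | inl y => \det (mxsub (tagged y).1 (tagged y).2 (rigidity_matrix K p))
  | inr e => edge_val p p (val e) end.
have lF x : line_poly (F x).
  case: x => [[m [f g]]|[e eE]] /=.
    apply: line_poly_det => i j.
    apply: (@eq_line_poly _ (fun q => rigidity_matrix K q (f i) (g j))) => [q|].
      by rewrite mxE.
    exact: line_poly_rigidity.
  have [a [b [eab ab _ _]]] := edgeP eE; rewrite /F /= eab.
  apply: (@eq_line_poly _ (fun p =>
      (p a 0 0 + - p b 0 0) * (p a 0 0 + - p b 0 0) +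
      (p a 1 0 + - p b 1 0) * (p a 1 0 + - p b 1 0))) => [p|].
    by rewrite edge_valE // dotE !mxE.
  apply: line_polyD; apply: line_polyM; apply: line_polyD; try apply: line_polyN;
    exact: line_poly_coord.
have [p symp genp] := line_poly_generic lF (@equivariant_line G (Phi C3)) sym0.
exists p; first split.
- move=> a b ab pab; pose x : minors + edges := inr (exist _ [set a; b] ab).
  have Fx q : F x q = dot (q a - q b) (q a - q b).
    by rewrite /F /= edge_valE // (adj_neq ab).
  have : F x p0 = 0.
    by apply: genp sym0; rewrite Fx pab subrr dotE !mxE !mul0r addr0.
  by rewrite Fx => /dot_eq0 /eqP; rewrite subr_eq0 => /eqP; exact: real0.
- exact/(symmetricE _ hPhi).
move=> m f g f_inj g_inj detp q /(symmetricE _ hPhi) symq.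
have mN : (m < N.+1)%N.
  by have := leq_card f f_inj; rewrite !card_ord.
pose x : minors := Tagged
  (fun m : 'I_N.+1 => ({ffun 'I_m -> 'I_N} * {ffun 'I_m -> 'I_(#|V K| * 2)})%type)
  (i := Ordinal mN) (finfun f, finfun g).
have FE r : F (inl x) r = \det (mxsub f g (rigidity_matrix K r)).
  rewrite /F /=; congr (\det _); apply/matrixP => i j; rewrite !mxE !ffunE.
  by [].
by rewrite -FE; apply: genp => //; rewrite FE.
Qed.

End Generic.

(** * Symmetric moves preserve independence *)

Section PlaneSystems.
Variable R : realType.
Implicit Types (x y q d n : 'cV[R]_2) (f g : R).

Lemma cross_C3 x y : cross (C3 *m x) (C3 *m y) = cross x y.
Proof.
rewrite /cross !C3_mulE; have := @C3_sin2 R; set sn := sin _ => s2.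
transitivity ((sn ^+ 2 + 1 / 4) * (x 0 0 * y 1 0 - x 1 0 * y 0 0)); first by field.
by rewrite s2; field.
Qed.

Lemma cross_rot x : x != 0 -> cross x (C3 *m x) != 0.
Proof.
move=> x0; have -> : cross x (C3 *m x) = sin (2 * pi / 3) * dot x x.
  by rewrite /cross dotE !C3_mulE; ring.
rewrite mulf_neq0 //; last by apply/eqP => /dot_eq0 /eqP; exact/negP.
by rewrite -sqrf_eq0 C3_sin2 lt0r_neq0 //; lra.
Qed.

Lemma cross_turn d : d != 0 -> cross (turn d) d != 0.
Proof.
move=> d0; have -> : cross (turn d) d = - dot d d by rewrite /cross dotE !turnE; ring.
by rewrite oppr_eq0; apply/eqP => /dot_eq0 /eqP; exact/negP.
Qed.

(** The velocity of a new vertex joined to two vertices of velocities [y1], [y2]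
    along the independent directions [d1], [d2]. *)
Lemma attach_solve d1 d2 y1 y2 f1 f2 : cross d1 d2 != 0 ->
  exists z, dot d1 (z - y1) = f1 /\ dot d2 (z - y2) = f2.
Proof.
move=> d12; have [z [z1 z2]] := dot_solve (f1 + dot d1 y1) (f2 + dot d2 y2) d12.
by exists z; rewrite !dotBr z1 z2 !addrK.
Qed.

(** The middle of the segment between two points. *)
Definition midpoint x y : 'cV[R]_2 := 2^-1 *: (x + y).

Lemma C3_midpoint x y : C3 *m midpoint x y = midpoint (C3 *m x) (C3 *m y).
Proof. by rewrite /midpoint -scalemxAr mulmxDr. Qed.

(** The velocity of a vertex placed at the middle of a removed edge: the first two
    equations have parallel directions, and are compatible exactly when the edge
    carries the value [2 * (f1 + f2)]. *)
Lemma split_solve q1 q2 q3 y1 y2 y3 f1 f2 f3 :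
    cross (q2 - q1) (q3 - q1) != 0 -> dot (q1 - q2) (y1 - y2) = 2 * (f1 + f2) ->
  exists z, [/\ dot (midpoint q1 q2 - q1) (z - y1) = f1,
    dot (midpoint q1 q2 - q2) (z - y2) = f2 & dot (midpoint q1 q2 - q3) (z - y3) = f3].
Proof.
move=> cr e12; have [|z [z1 z3]] := @attach_solve (midpoint q1 q2 - q1)
    (midpoint q1 q2 - q3) y1 y3 f1 f3.
  apply: contraNneq cr => cr0.
  have -> : cross (q2 - q1) (q3 - q1) =
      -2 * cross (midpoint q1 q2 - q1) (midpoint q1 q2 - q3).
    by rewrite /cross !mxE; field.
  by rewrite cr0 mulr0.
exists z; split=> //.
have -> : f2 = 2^-1 * (2 * (f1 + f2)) - f1 by field.
by rewrite -e12 -z1 !dotE !mxE; field.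
Qed.

(** A regular triangle is independent. *)
Lemma triangle_solve x g0 g1 g2 : x != 0 -> exists z0 z1 z2,
  [/\ dot (x - C3 *m x) (z0 - z1) = g0,
      dot (C3 *m x - C3 *m (C3 *m x)) (z1 - z2) = g1
    & dot (C3 *m (C3 *m x) - x) (z2 - z0) = g2].
Proof.
move=> x0; have cx := cross_rot x0.
have cx' : cross (x - C3 *m x) (C3 *m x - C3 *m (C3 *m x)) != 0.
  rewrite C3_twice (_ : cross _ _ = 3 * cross x (C3 *m x)); last first.
    by rewrite /cross !mxE; ring.
  by rewrite mulf_neq0 // pnatr_eq0.
have [z2 [z2E _]] : exists z, dot (C3 *m (C3 *m x) - x) (z - 0) = g2 /\
    dot x (z - 0) = 0.
  apply: attach_solve; rewrite C3_twice (_ : cross _ _ = cross x (C3 *m x)) //.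
  by rewrite /cross !mxE; ring.
have [z1 [z1E z1E']] := attach_solve 0 z2 (- g0) g1 cx'.
exists 0, z1, z2; split=> //.
by rewrite -[RHS]opprK -z1E subr0 sub0r !dotE !mxE; ring.
Qed.

(** A triangle attached by three bars with the directions [turn q] and its images.
    The lengths of the triangle are prescribed first; a rotation about the origin
    then settles the sum of the three bar equations, as the bar directions have
    sum zero, and a translation settles two of them. *)
Lemma delta_solve q y0 y1 y2 g0 g1 g2 f0 f1 f2 : q != 0 ->
  let x := q + turn q in
  exists z0 z1 z2,
  [/\ dot (x - C3 *m x) (z0 - z1) = g0,
      dot (C3 *m x - C3 *m (C3 *m x)) (z1 - z2) = g1
    & dot (C3 *m (C3 *m x) - x) (z2 - z0) = g2] /\
  [/\ dot (x - q) (z0 - y0) = f0,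
      dot (C3 *m x - C3 *m q) (z1 - y1) = f1
    & dot (C3 *m (C3 *m x) - C3 *m (C3 *m q)) (z2 - y2) = f2].
Proof.
move=> q0 x; have m0 : dot q q != 0 by apply/eqP => /dot_eq0 /eqP; exact/negP.
have x0 : x != 0.
  apply: contraNneq m0 => x0; have -> : dot q q = dot q x.
    by rewrite /x dotDr dot_turn addr0.
  by rewrite x0 dotE !mxE !mulr0 addr0.
have [a0 [a1 [a2 [A0 A1 A2]]]] := triangle_solve g0 g1 g2 x0.
pose n := turn q.
have n0 : n != 0.
  by apply: contraNneq m0 => n0; rewrite -dot_turn2 -/n n0 dotE !mxE mulr0 addr0.
have xq : x - q = n by rewrite /x addrC addKr.
rewrite -!mulmxBr xq.
pose h0 := f0 - dot n (a0 - y0).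
pose h1 := f1 - dot (C3 *m n) (a1 - y1).
pose h2 := f2 - dot (C3 *m (C3 *m n)) (a2 - y2).
pose m := dot q q; pose c := (h0 + h1 + h2) / (3 * m).
have [t [t0 t1]] := dot_solve (h0 - c * m) (h1 - c * m) (cross_rot n0).
have t2 : dot (C3 *m (C3 *m n)) t = h2 - c * m.
  have -> : dot (C3 *m (C3 *m n)) t = - (dot n t) - dot (C3 *m n) t.
    by rewrite C3_twice !dotE !mxE; ring.
  by rewrite t0 t1 /c; field; rewrite m0.
have nx : dot n (turn x) = m.
  by rewrite dot_turn2 /x dotDr dot_turn addr0.
exists (a0 + t + c *: turn x), (a1 + t + c *: turn (C3 *m x)),
  (a2 + t + c *: turn (C3 *m (C3 *m x))).
have rigid (b b' r r' : 'cV[R]_2) : dot (r - r') ((b + t + c *: turn r) - (b' + t + c *: turn r'))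
    = dot (r - r') (b - b').
  rewrite [X in dot _ X = _](_ : _ = b - b' + c *: turn (r - r')).
    by rewrite dotDr dotZr dot_turn mulr0 addr0.
  by apply: cV2P; rewrite !mxE /=; ring.
rewrite !mulmxBr !rigid; split=> //.
have pend (b y k r : 'cV[R]_2) h f : dot k (turn r) = m -> dot k t = h - c * m ->
    h = f - dot k (b - y) -> dot k (b + t + c *: turn r - y) = f.
  move=> kr kt hE; rewrite [X in dot _ X](_ : _ = b - y + t + c *: turn r).
    by rewrite 2!dotDr dotZr kr kt hE; ring.
  by apply: cV2P; rewrite !mxE /=; ring.
split; apply: pend; rewrite ?t0 ?t1 ?t2 //.
- by rewrite -C3_turn C3_dot.
- by rewrite -!C3_turn !C3_dot.
Qed.

End PlaneSystems.

Section FreeAction.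
Variable T : finType.
Implicit Types (G : graph T) (s : {perm T}) (e : {set T}) (a : T).

(** No vertex of [G] is fixed by [s]. *)
Definition free_on G s := {in V G, forall a, s a != a}.

Lemma imset_order3 s e : (forall x, s (s (s x)) = x) -> s @: (s @: (s @: e)) = e.
Proof. by move=> s3; rewrite -!imset_comp -[RHS]imset_id; apply: eq_imset => x; exact: s3. Qed.

Lemma free_edge G s e : (forall x, s (s (s x)) = x) -> free_on G s ->
  e \in E G -> s @: e != e.
Proof.
move=> s3 free /edgeP[a [b [-> ab aV bV]]]; rewrite imset_pair set2_eq.
rewrite (negbTE (free _ aV)) /=; apply/andP => -[/eqP sa /eqP sb].
by have := s3 a; rewrite sa sb sa => ba; rewrite ba eqxx in ab.
Qed.

Lemma free_edges_uniq G s e : (forall x, s (s (s x)) = x) -> free_on G s -> e \in E G ->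
  [/\ s @: e != e, s @: (s @: e) != e & s @: (s @: e) != s @: e].
Proof.
move=> s3 free eE; have se := free_edge s3 free eE; split=> //.
  by apply: contraNneq se => /(congr1 (fun f : {set T} => s @: f)); rewrite imset_order3 // => <-.
apply: contraNneq se => /(congr1 (fun f : {set T} => s @: (s @: f))).
by rewrite !imset_order3 // => ->.
Qed.

End FreeAction.

Section Moves.
Variables (R : realType) (T : finType).
Implicit Types (G : graph T) (p u : T -> 'cV[R]_2) (s : {perm T}) (a b c v w z : T).

(** Redefinition of a function at three points. *)
Definition put3 (W : Type) v w z (xv xw xz : W) (p : T -> W) a : W :=
  if a == v then xv else if a == w then xw else if a == z then xz else p a.

(** The placement [p], with the orbit of [a] moved so that [a] is at [x]. *)
Definition put_orbit s a (x : 'cV[R]_2) p : T -> 'cV[R]_2 :=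
  put3 a (s a) (s (s a)) x (C3 *m x) (C3 *m (C3 *m x)) p.

Section PutOrbit.
Variable s : {perm T}.
Hypothesis s3 : forall x, s (s (s x)) = x.

Let symm p := forall a, C3 *m p a = p (s a).

Lemma put_orbit_sym a x p : s a != a -> symm p -> symm (put_orbit s a x p).
Proof.
move=> sa symp b; have ssa := order3_step2_neq s3 sa.
rewrite /put_orbit /put3.
have [->|ba] := eqVneq b a; first by rewrite (negbTE sa) eqxx.
have [->|bsa] := eqVneq b (s a).
  by rewrite (negbTE ssa) (inj_eq perm_inj) (negbTE sa) eqxx.
have [->|bssa] := eqVneq b (s (s a)); first by rewrite s3 eqxx C3_cubed.
have -> : (s b == a) = false.
  by apply: contraNF bssa => /eqP <-; rewrite s3.
by rewrite !(inj_eq perm_inj) (negbTE ba) (negbTE bsa).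
Qed.

Lemma put_orbit_at a x p : put_orbit s a x p a = x.
Proof. by rewrite /put_orbit /put3 eqxx. Qed.

Lemma put_orbit_out a x p b : b \notin orbit3 s a -> put_orbit s a x p b = p b.
Proof.
rewrite !inE !negb_or => /andP[/andP[ba bsa] bssa].
by rewrite /put_orbit /put3 (negbTE ba) (negbTE bsa) (negbTE bssa).
Qed.

Lemma sym_zero : symm (fun=> 0).
Proof. by move=> a; rewrite mulmx0. Qed.

Let e1 : 'cV[R]_2 := const_mx 1.

Let e1_neq0 : e1 != 0.
Proof. by apply/eqP => /colP/(_ 0); rewrite !mxE => /eqP; rewrite oner_eq0. Qed.

(** Some symmetric placement separates two given vertices. *)
Lemma sym_separate2 a b : s a != a -> a != b -> exists2 p, symm p & p a != p b.
Proof.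
move=> sa ab; exists (put_orbit s a e1 (fun=> 0)).
  by apply: put_orbit_sym => //; exact: sym_zero.
rewrite put_orbit_at /put_orbit /put3 (eq_sym b a) (negbTE ab).
have Ce1 (x : 'cV[R]_2) : x != 0 -> C3 *m x != x.
  by apply: contraNneq => /C3_fix ->.
case: (b =P s a) => _; first by rewrite eq_sym Ce1.
case: (b =P s (s a)) => _; last exact: e1_neq0.
by apply: contraNneq e1_neq0 => E; apply/eqP/C3_fix; rewrite {1}E C3_cubed.
Qed.

Let sep_alone a b c : s a != a -> s b != b -> b != c ->
    b \notin orbit3 s a -> c \notin orbit3 s a ->
  exists2 p, symm p & cross (p b - p a) (p c - p a) != 0.
Proof.
move=> sa sb bc ba ca; have [p symp pbc] := sym_separate2 sb bc.
exists (put_orbit s a (p b + turn (p c - p b)) p); first exact: put_orbit_sym.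
rewrite put_orbit_at !put_orbit_out //.
have d0 : p c - p b != 0 by rewrite subr_eq0 eq_sym.
have := cross_turn d0; rewrite -oppr_eq0; apply: contraNneq => cr.
by apply/eqP; rewrite -{}cr /cross !mxE /=; ring.
Qed.

(** Some symmetric placement puts three given vertices in general position: an
    orbit of three vertices is a regular triangle, and otherwise one of them is
    alone in its orbit and can be moved off the line through the others. *)
Lemma sym_separate3 a b c : s a != a -> s b != b -> s c != c -> uniq [:: a; b; c] ->
  exists2 p, symm p & cross (p b - p a) (p c - p a) != 0.
Proof.
move=> sa sb sc; rewrite /= !inE negb_or andbT => /andP[/andP[ab ac] bc].
have orbE x y : (x \in orbit3 s y) = (orbit3 s x == orbit3 s y).
  apply/idP/eqP => [|<-]; last by rewrite !inE eqxx.
  by rewrite !inE => /orP[/orP[]|]/eqP->; rewrite ?orbit3_step.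
case: (boolP (b \in orbit3 s a)) => ba; case: (boolP (c \in orbit3 s a)) => ca.
- exists (put_orbit s a e1 (fun=> 0)).
    by apply: put_orbit_sym => //; exact: sym_zero.
  have ssa := order3_step2_neq s3 sa.
  have Pa := put_orbit_at a e1 (fun=> 0).
  have Psa : put_orbit s a e1 (fun=> 0) (s a) = C3 *m e1.
    by rewrite /put_orbit /put3 (negbTE sa) eqxx.
  have Pssa : put_orbit s a e1 (fun=> 0) (s (s a)) = C3 *m (C3 *m e1).
    by rewrite /put_orbit /put3 (negbTE ssa) (inj_eq perm_inj) (negbTE sa) eqxx.
  have cr0 : 3 * cross e1 (C3 *m e1) != 0 by rewrite mulf_neq0 ?pnatr_eq0 // cross_rot.
  have cr0' : - (3 * cross e1 (C3 *m e1)) != 0 by rewrite oppr_eq0.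
  move: ba ca bc; rewrite !inE (eq_sym b) (negbTE ab) (eq_sym c) (negbTE ac) /=.
  move=> /orP[]/eqP-> /orP[]/eqP->; rewrite ?eqxx // => _; rewrite Pa Psa Pssa.
    apply: contraNneq cr0 => cr; apply/eqP; rewrite -{}cr C3_twice /cross !mxE; ring.
  apply: contraNneq cr0' => cr; apply/eqP; rewrite -{}cr C3_twice /cross !mxE; ring.
- have [||p symp p0] := @sep_alone c a b sc sa ab.
  + by rewrite orbE eq_sym -orbE.
  + by move: ba ca; rewrite !orbE => /eqP->; rewrite eq_sym.
  exists p => //; apply: contraNneq p0 => cr; rewrite -cr /cross !mxE; apply/eqP; ring.
- have [|||p symp p0] := @sep_alone b c a sb sc.
  + by rewrite eq_sym.
  + by move: ba ca; rewrite !orbE => ba /eqP->; rewrite eq_sym.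
  + by rewrite orbE eq_sym -orbE.
  exists p => //; apply: contraNneq p0 => cr; rewrite -cr /cross !mxE; apply/eqP; ring.
- have [p symp p0] := sep_alone sa sb bc ba ca; by exists p.
Qed.

End PutOrbit.
End Moves.

Section MovesIndependent.
Variables (R : realType) (T : finType).
Implicit Types (G : graph T) (p u : T -> 'cV[R]_2) (s : {perm T}) (a b c v w z : T).

(** [G] has an independent placement that is symmetric under [s]. *)
Definition sym_independent G s : Prop :=
  exists2 p : T -> 'cV[R]_2, equivariant G s p & onto_edges G p.

(** A symmetric independent placement may be required to satisfy one more
    polynomial condition that is attained by symmetric placements. *)
Lemma sym_independent_generic G s (F : (T -> 'cV[R]_2) -> R) q :
    sym_independent G s -> line_poly F -> equivariant G s q -> F q != 0 ->
  exists p, [/\ equivariant G s p, onto_edges G p & F p != 0].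
Proof.
move=> [p symp ontop] lF symq Fq.
have [F1 [lF1 F1p F1onto]] := onto_edges_line_poly ontop.
have [t [F1t Ft]] := line_poly_both lF1 lF F1p Fq.
by exists (line p q t); split; [exact: equivariant_line | exact: F1onto |].
Qed.

Section Step.
Variables (G G' : graph T) (s s' : {perm T}) (v w z : T).
Hypotheses (sA : s \in Aut G) (s3 : forall x, s (s (s x)) = x) (free : free_on G s).
Hypothesis newV : new_vertices G v w z G'.
Hypotheses (s'E : {in V G, s' =1 s}) (s'v : s' v = w) (s'w : s' w = z) (s'z : s' z = v).

Let vw : v != w. Proof. by case: newV => /= /and3P[]; rewrite !inE negb_or => /andP[]. Qed.
Let vz : v != z. Proof. by case: newV => /= /and3P[]; rewrite !inE negb_or => /andP[]. Qed.
Let wz : w != z. Proof. by case: newV => /= /and3P[]; rewrite !inE. Qed.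

Section Put3.
Variables (W : Type) (xv xw xz : W) (p : T -> W).

Lemma put3_old a : a \in V G -> put3 v w z xv xw xz p a = p a.
Proof.
move=> aV; rewrite /put3; case: newV => _ [vV wV zV] _.
do 3![case: eqP => [E|_]; first by move: aV; rewrite E ?(negbTE vV) ?(negbTE wV) ?(negbTE zV)].
by [].
Qed.

Lemma put3_v : put3 v w z xv xw xz p v = xv.
Proof. by rewrite /put3 eqxx. Qed.

Lemma put3_w : put3 v w z xv xw xz p w = xw.
Proof. by rewrite /put3 eq_sym (negbTE vw) eqxx. Qed.

Lemma put3_z : put3 v w z xv xw xz p z = xz.
Proof. by rewrite /put3 ![z == _]eq_sym (negbTE vz) (negbTE wz) eqxx. Qed.

End Put3.

Lemma put3_equivariant p x : equivariant G s p ->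
  equivariant G' s' (put3 v w z x (C3 *m x) (C3 *m (C3 *m x)) p).
Proof.
move=> symp a; case: newV => _ _ ->; rewrite !inE => /orP[aV|].
  by rewrite s'E // !put3_old ?aut_V // symp.
by move=> /orP[/orP[]|]/eqP->; rewrite ?s'v ?s'w ?s'z ?put3_v ?put3_w ?put3_z // C3_cubed.
Qed.

Lemma step_free : free_on G' s'.
Proof.
move=> a; case: newV => _ _ ->; rewrite !inE => /orP[aV|].
  by rewrite s'E // free.
by move=> /orP[/orP[]|]/eqP->; rewrite ?s'v ?s'w ?s'z // eq_sym.
Qed.

Lemma edge_val_put3 p u xv xw xz yv yw yz e : e \in E G ->
  edge_val (put3 v w z xv xw xz p) (put3 v w z yv yw yz u) e = edge_val p u e.
Proof. by move=> /edgeP[a [b [-> ab aV bV]]]; rewrite !edge_valE // !put3_old. Qed.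

Let newold x a : x \in [set v; w; z] -> a \in V G -> x != a.
Proof.
case: newV => _ [vV wV zV] _; rewrite !inE => /orP[/orP[]|]/eqP->;
  by apply: contraTneq => <-.
Qed.

Lemma edge_val_put3_v p u xv xw xz yv yw yz a : a \in V G ->
  edge_val (put3 v w z xv xw xz p) (put3 v w z yv yw yz u) [set v; a] =
    dot (xv - p a) (yv - u a).
Proof. by move=> aV; rewrite edge_valE ?newold ?inE ?eqxx // !put3_v !put3_old. Qed.

Lemma edge_val_put3_w p u xv xw xz yv yw yz a : a \in V G ->
  edge_val (put3 v w z xv xw xz p) (put3 v w z yv yw yz u) [set w; a] =
    dot (xw - p a) (yw - u a).
Proof. by move=> aV; rewrite edge_valE ?newold ?inE ?eqxx ?orbT // !put3_w !put3_old. Qed.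

Lemma edge_val_put3_z p u xv xw xz yv yw yz a : a \in V G ->
  edge_val (put3 v w z xv xw xz p) (put3 v w z yv yw yz u) [set z; a] =
    dot (xz - p a) (yz - u a).
Proof. by move=> aV; rewrite edge_valE ?newold ?inE ?eqxx ?orbT // !put3_z !put3_old. Qed.

(** The new vertex is placed off the line through [v1] and [v2], which are first
    separated. *)
Lemma vertex_addition_independent v1 v2 :
    v1 \in V G -> v2 \in V G -> v1 != v2 ->
    E G' = E G :|: [set [set v; v1]; [set v; v2]; [set w; s v1]; [set w; s v2];
                        [set z; s (s v1)]; [set z; s (s v2)]] ->
  sym_independent G s -> sym_independent G' s'.
Proof.
move=> v1V v2V v12 EG' indG.
have [q symq q12] := @sym_separate2 R T s s3 _ _ (free v1V) v12.
pose F p : R := dot (p v1 - p v2) (p v1 - p v2).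
have lF : line_poly F.
  apply: (@eq_line_poly _ _ _ (fun p => (p v1 0 0 + - p v2 0 0) * (p v1 0 0 + - p v2 0 0) +
      (p v1 1 0 + - p v2 1 0) * (p v1 1 0 + - p v2 1 0))) => [p|].
    by rewrite /F dotE !mxE.
  by apply: line_polyD; apply: line_polyM; apply: line_polyD; try apply: line_polyN;
    exact: line_poly_coord.
have Fq : F q != 0 by apply: contra q12 => /eqP/dot_eq0/eqP; rewrite subr_eq0.
have symq' : equivariant G s q by move=> a _; exact: symq.
have [p [symp ontop Fp]] := sym_independent_generic indG lF symq' Fq.
have d0 : p v2 - p v1 != 0.
  by apply: contraNneq Fp => d0; rewrite /F -dotN opprB d0 dotE !mxE !mulr0 addr0.
pose x := p v1 + turn (p v2 - p v1).
have cx : cross (x - p v1) (x - p v2) != 0.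
  have := cross_turn d0; rewrite -oppr_eq0; apply: contraNneq => cr.
  by apply/eqP; rewrite -{}cr /cross !mxE /=; ring.
exists (put3 v w z x (C3 *m x) (C3 *m (C3 *m x)) p); first exact: put3_equivariant.
move=> f; have [u uE] := ontop f.
have [yv [yv1 yv2]] := attach_solve (u v1) (u v2) (f [set v; v1]) (f [set v; v2]) cx.
rewrite -cross_C3 in cx.
have [yw [yw1 yw2]] := attach_solve (u (s v1)) (u (s v2))
  (f [set w; s v1]) (f [set w; s v2]) cx.
rewrite -cross_C3 in cx.
have [yz [yz1 yz2]] := attach_solve (u (s (s v1))) (u (s (s v2)))
  (f [set z; s (s v1)]) (f [set z; s (s v2)]) cx.
exists (put3 v w z yv yw yz u) => e; rewrite EG' inE => /orP[eE|].
  by rewrite edge_val_put3 // uE.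
have sV a : a \in V G -> s a \in V G by rewrite aut_V.
rewrite !inE -!orbA => /or4P[||| /or3P[||]] /eqP->.
- by rewrite edge_val_put3_v.
- by rewrite edge_val_put3_v.
- by rewrite edge_val_put3_w ?sV // -symp // -mulmxBr.
- by rewrite edge_val_put3_w ?sV // -symp // -mulmxBr.
- by rewrite edge_val_put3_z ?sV // -!symp ?sV // -!mulmxBr.
- by rewrite edge_val_put3_z ?sV // -!symp ?sV // -!mulmxBr.
Qed.

(** The new vertex is placed at the middle of the removed edge, which is not in
    line with [v3]. *)
Lemma edge_split_independent v1 v2 v3 :
    v1 \in V G -> v2 \in V G -> v3 \in V G -> uniq [:: v1; v2; v3] ->
    [set v1; v2] \in E G ->
    E G' = (E G :\: [set [set v1; v2]; [set s v1; s v2]; [set s (s v1); s (s v2)]])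
               :|: [set [set v; a] | a in [set v1; v2; v3]]
               :|: [set [set w; s a] | a in [set v1; v2; v3]]
               :|: [set [set z; s (s a)] | a in [set v1; v2; v3]] ->
  sym_independent G s -> sym_independent G' s'.
Proof.
move=> v1V v2V v3V uniq123 e12 EG' indG.
have [q symq q123] := @sym_separate3 R T s s3 _ _ _ (free v1V) (free v2V) (free v3V) uniq123.
pose F p : R := cross (p v2 - p v1) (p v3 - p v1).
have lF : line_poly F.
  apply: (@eq_line_poly _ _ _ (fun p => (p v2 0 0 + - p v1 0 0) * (p v3 1 0 + - p v1 1 0) +
      - ((p v2 1 0 + - p v1 1 0) * (p v3 0 0 + - p v1 0 0)))) => [p|].
    by rewrite /F /cross !mxE.
  by apply: line_polyD; [|apply: line_polyN]; apply: line_polyM; apply: line_polyD;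
    try apply: line_polyN; exact: line_poly_coord.
have symq' : equivariant G s q by move=> a _; exact: symq.
have [p [symp ontop Fp]] := sym_independent_generic indG lF symq' q123.
have sV a : a \in V G -> s a \in V G by rewrite aut_V.
pose x := midpoint (p v1) (p v2).
exists (put3 v w z x (C3 *m x) (C3 *m (C3 *m x)) p); first exact: put3_equivariant.
move=> f.
pose e1 := [set v1; v2]; pose e2 := [set s v1; s v2]; pose e3 := [set s (s v1); s (s v2)].
have e2S : e2 = s @: e1 by rewrite imset_pair.
have e3S : e3 = s @: (s @: e1) by rewrite !imset_pair.
have [e21 e31 e32] : [/\ e2 != e1, e3 != e1 & e3 != e2].
  by rewrite e3S e2S; exact: free_edges_uniq e12.
have e2E : e2 \in E G by rewrite e2S aut_edge.
have e3E : e3 \in E G by rewrite e3S !aut_edge.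
pose f' (e : {set T}) := if e == e1 then 2 * (f [set v; v1] + f [set v; v2])
  else if e == e2 then 2 * (f [set w; s v1] + f [set w; s v2])
  else if e == e3 then 2 * (f [set z; s (s v1)] + f [set z; s (s v2)]) else f e.
have [u uE] := ontop f'.
have v12 : v1 != v2 by have := adj_neq e12.
have u1 : dot (p v1 - p v2) (u v1 - u v2) = 2 * (f [set v; v1] + f [set v; v2]).
  by rewrite -edge_valE // uE // /f' eqxx.
have u2 : dot (C3 *m p v1 - C3 *m p v2) (u (s v1) - u (s v2)) =
    2 * (f [set w; s v1] + f [set w; s v2]).
  by rewrite !symp // -edge_valE ?(inj_eq perm_inj) // uE // /f' (negbTE e21) eqxx.
have u3 : dot (C3 *m (C3 *m p v1) - C3 *m (C3 *m p v2)) (u (s (s v1)) - u (s (s v2))) =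
    2 * (f [set z; s (s v1)] + f [set z; s (s v2)]).
  rewrite !symp ?sV // -edge_valE ?(inj_eq perm_inj) // uE // /f'.
  by rewrite (negbTE e31) (negbTE e32) eqxx.
have [yv [yv1 yv2 yv3]] := split_solve (u v3) (f [set v; v3]) Fp u1.
have Fp2 : cross (C3 *m p v2 - C3 *m p v1) (C3 *m p v3 - C3 *m p v1) != 0.
  by rewrite -!mulmxBr cross_C3.
have [yw [yw1 yw2 yw3]] := split_solve (u (s v3)) (f [set w; s v3]) Fp2 u2.
have Fp3 : cross (C3 *m (C3 *m p v2) - C3 *m (C3 *m p v1))
    (C3 *m (C3 *m p v3) - C3 *m (C3 *m p v1)) != 0.
  by rewrite -!mulmxBr !cross_C3.
have [yz [yz1 yz2 yz3]] := split_solve (u (s (s v3))) (f [set z; s (s v3)]) Fp3 u3.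
exists (put3 v w z yv yw yz u) => e; rewrite EG' 3!inE -!orbA => /or4P[|||].
- rewrite !inE !negb_or => /andP[/andP[/andP[ee1 ee2] ee3] eE].
  by rewrite edge_val_put3 // uE // /f' (negbTE ee1) (negbTE ee2) (negbTE ee3).
- by move=> /imsetP[a]; rewrite !inE => /orP[/orP[]|]/eqP-> ->; rewrite edge_val_put3_v.
- by move=> /imsetP[a]; rewrite !inE => /orP[/orP[]|]/eqP-> ->;
    rewrite edge_val_put3_w ?sV // -symp // C3_midpoint.
- by move=> /imsetP[a]; rewrite !inE => /orP[/orP[]|]/eqP-> ->;
    rewrite edge_val_put3_z ?sV // -!symp ?sV // !C3_midpoint.
Qed.

(** The new triangle is placed so that its bars are tangent to the circle about the
    origin through [v0]: lines through the origin would be concurrent. *)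
Lemma Delta_extension_independent v0 : v0 \in V G ->
    E G' = E G :|: [set [set v; w]; [set w; z]; [set z; v];
                        [set v; v0]; [set w; s v0]; [set z; s (s v0)]] ->
  sym_independent G s -> sym_independent G' s'.
Proof.
move=> v0V EG' indG.
have sv0 : v0 != s v0 by rewrite eq_sym free.
have [q symq q0] := @sym_separate2 R T s s3 _ _ (free v0V) sv0.
pose F p : R := dot (p v0) (p v0).
have lF : line_poly F.
  apply: (@eq_line_poly _ _ _ (fun p => p v0 0 0 * p v0 0 0 + p v0 1 0 * p v0 1 0)) => [p|].
    by rewrite /F dotE.
  by apply: line_polyD; apply: line_polyM; exact: line_poly_coord.
have Fq : F q != 0.
  by apply: contra q0 => /eqP/dot_eq0 q0; rewrite -symq q0 mulmx0.
have symq' : equivariant G s q by move=> a _; exact: symq.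
have [p [symp ontop Fp]] := sym_independent_generic indG lF symq' Fq.
have p0 : p v0 != 0.
  by apply: contraNneq Fp => p0; rewrite /F p0 dotE !mxE !mulr0 addr0.
have sV a : a \in V G -> s a \in V G by rewrite aut_V.
pose x := p v0 + turn (p v0).
exists (put3 v w z x (C3 *m x) (C3 *m (C3 *m x)) p); first exact: put3_equivariant.
move=> f; have [u uE] := ontop f.
have [yv [yw [yz [[yvw ywz yzv] [yv0 yw0 yz0]]]]] :=
  delta_solve (u v0) (u (s v0)) (u (s (s v0))) (f [set v; w]) (f [set w; z]) (f [set z; v])
    (f [set v; v0]) (f [set w; s v0]) (f [set z; s (s v0)]) p0.
exists (put3 v w z yv yw yz u) => e; rewrite EG' inE => /orP[eE|].
  by rewrite edge_val_put3 // uE.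
rewrite !inE -!orbA => /or4P[||| /or3P[||]] /eqP->.
- by rewrite edge_valE // !put3_v !put3_w.
- by rewrite edge_valE // !put3_z !put3_w.
- by rewrite edge_valE ?(eq_sym z) // !put3_z !put3_v.
- by rewrite edge_val_put3_v.
- by rewrite edge_val_put3_w ?sV // -symp.
- by rewrite edge_val_put3_z ?sV // -!symp ?sV.
Qed.

End Step.

Lemma triangle_independent G s a : (forall x, s (s (s x)) = x) -> s a != a ->
  V G = orbit3 s a -> sym_independent G s.
Proof.
move=> s3 sa VG; have ssa := order3_step2_neq s3 sa.
pose x : 'cV[R]_2 := const_mx 1.
have x0 : x != 0 by apply/eqP => /colP/(_ 0); rewrite !mxE => /eqP; rewrite oner_eq0.
have sym0 : forall b, C3 *m (0 : 'cV[R]_2) = 0 by move=> _; exact: mulmx0.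
pose p := put_orbit s a x (fun=> 0).
exists p; first by move=> b _; exact: (put_orbit_sym s3 x sa sym0).
move=> f.
have [y0 [y1 [y2 [Y0 Y1 Y2]]]] := triangle_solve (f [set a; s a])
  (f [set s a; s (s a)]) (f [set s (s a); a]) x0.
pose u := put3 a (s a) (s (s a)) y0 y1 y2 (fun=> 0).
have P W (z0 z1 z2 z3 : W) : let r := put3 a (s a) (s (s a)) z0 z1 z2 (fun=> z3) in
    [/\ r a = z0, r (s a) = z1 & r (s (s a)) = z2].
  by rewrite /put3 !eqxx (negbTE sa) (negbTE ssa) (inj_eq perm_inj) (negbTE sa).
have [p0 p1 p2] := P _ x (C3 *m x) (C3 *m (C3 *m x)) 0.
have [u0 u1 u2] := P _ y0 y1 y2 0.
have ev b c : b != c -> edge_val p u [set b; c] = dot (p b - p c) (u b - u c).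
  exact: edge_valE.
have v01 : edge_val p u [set a; s a] = f [set a; s a].
  by rewrite ev 1?eq_sym // /p /put_orbit /u p0 p1 u0 u1.
have v12 : edge_val p u [set s a; s (s a)] = f [set s a; s (s a)].
  by rewrite ev ?(inj_eq perm_inj) 1?eq_sym // /p /put_orbit /u p1 p2 u1 u2.
have v20 : edge_val p u [set s (s a); a] = f [set s (s a); a].
  by rewrite ev // /p /put_orbit /u p0 p2 u0 u2.
exists u => e /edgeP[b [c [-> bc]]]; rewrite VG !inE => bV cV.
have {bV cV} [] : [\/ [set b; c] = [set a; s a], [set b; c] = [set s a; s (s a)]
    | [set b; c] = [set s (s a); a]].
  move: bV cV bc => /orP[/orP[]|]/eqP-> /orP[/orP[]|]/eqP->; rewrite ?eqxx // => _;
    first [by constructor 1 | by constructor 2 | by constructor 3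
    | by rewrite setUC; first [by constructor 1 | by constructor 2 | by constructor 3]].
all: by move=> ->.
Qed.

(** A nontrivial symmetry of a triangle permutes its vertices cyclically. *)
Lemma nontrivial_triangle (A : {set T}) (Phi : 'M[R]_2 -> {perm T}) :
    C3_hom (complete_graph A) Phi -> #|A| = 3%N ->
    (exists2 x, x \in C3_group & Phi x <> 1%g) ->
  exists2 a, Phi C3 a != a & A = orbit3 (Phi C3) a.
Proof.
move=> hPhi A3 [x xC Phix]; have [Phi1 Phi2 s3 sA] := C3_homE hPhi.
case: (boolP [exists a, Phi C3 a != a]) => [/existsP[a sa]|/existsPn nofix]; last first.
  case: Phix; have s1 : Phi C3 = 1%g.
    by by apply/permP => a; rewrite perm1; apply/eqP; have := nofix a; rewrite negbK.
  by move: xC; rewrite !inE => /or3P[]/eqP->; rewrite ?Phi2 ?s1 ?mulg1.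
exists a => //; have aA : a \in A.
  apply: contraR sa => aA; move: sA; rewrite inE => /andP[/subsetP onA _].
  by apply: contraR aA => sa; apply: onA; rewrite inE.
have aV b : (Phi C3 b \in A) = (b \in A) := aut_V b sA.
apply/esym/eqP; rewrite eqEcard A3; apply/andP; split.
  by apply/subsetP => b; rewrite !inE => /orP[/orP[]|]/eqP->; rewrite ?aV.
have ssa := order3_step2_neq s3 sa.
rewrite /orbit3 -setUA cardsU1 cards2 !inE negb_or !(eq_sym a) sa ssa.
by rewrite (inj_eq perm_inj) eq_sym sa.
Qed.

(** Induction along a construction sequence. *)
Lemma construction_ind (P : graph T -> ('M[R]_2 -> {perm T}) -> Prop) :
    (forall A Phi a, C3_hom (complete_graph A) Phi -> Phi C3 a != a ->
      A = orbit3 (Phi C3) a -> P (complete_graph A) Phi) ->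
    (forall G Phi G' Phi', C3_hom G Phi -> free_on G (Phi C3) -> P G Phi ->
      C3_hom G' Phi' -> construction_step G Phi G' Phi' -> P G' Phi') ->
  forall G Phi, has_construction_sequence G Phi ->
    exists Phi', [/\ {in C3_group, Phi' =1 Phi}, C3_hom G Phi', free_on G (Phi' C3)
      & P G Phi'].
Proof.
move=> P0 PS G Phi [k [Gs [Phis [[A [A3 G0]] hom nontriv step [<- PhiE]]]]].
have P_le i : (i <= k)%N -> free_on (Gs i) (Phis i C3) /\ P (Gs i) (Phis i).
  elim: i => [_|i IHi lt_ik].
    have hom0 : C3_hom (complete_graph A) (Phis 0%N) by rewrite -G0; exact: hom.
    have [a sa AE] := nontrivial_triangle hom0 A3 nontriv.
    have [_ _ s3 _] := C3_homE hom0.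
    rewrite G0; split; last exact: P0 sa AE.
    move=> b; rewrite [V _]/= AE !inE => /orP[/orP[]|]/eqP->;
      by rewrite ?(inj_eq perm_inj).
  have [freei Pi] := IHi (ltnW lt_ik); have homi := hom i (ltnW lt_ik).
  split; last exact: PS homi freei Pi (hom _ lt_ik) (step _ lt_ik).
  have [v [w [z [moves agree [sv sw sz]]]]] := step _ lt_ik.
  have newV : new_vertices (Gs i) v w z (Gs i.+1) by case: moves => -[].
  apply: (step_free freei newV _ sv sw sz) => a aV.
  by rewrite agree // !inE eqxx orbT.
have [freek Pk] := P_le k (leqnn k).
by exists (Phis k); split=> //; exact: hom.
Qed.

End MovesIndependent.

(** * Symmetric tree partitions *)

Section TreeGrowth.
Variable T : finType.
Implicit Types (H : graph T) (a b x y : T).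

(** The graph [H] with a new vertex [x] joined to the vertex [y]. *)
Definition add_leaf H x y : graph T := mkgraph (x |: V H) ([set x; y] |: E H).

Lemma new_edge_notin H x y : x \notin V H -> [set x; y] \notin E H.
Proof. by apply: contra => /edge_sub/subsetP; apply; exact: set21. Qed.

Lemma add_leafE H x y : x \notin V H -> y \in V H -> E (add_leaf H x y) = [set x; y] |: E H.
Proof.
move=> xV yV; apply: mkgraphE; apply/subsetP => e; rewrite !inE => /orP[/eqP->|eE].
  have -> : #|[set x; y]| = 2%N by rewrite cards2 (contraTneq _ yV) // => <-.
  by rewrite subUset !sub1set !inE eqxx yV orbT.
by rewrite (subset_trans (edge_sub eE)) ?subsetU1 // (edge_card eE).
Qed.

Lemma add_leaf_tree H x y : x \notin V H -> y \in V H -> tree H -> tree (add_leaf H x y).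
Proof.
move=> xV yV /tree_card[conH VE]; apply/tree_card; split; last first.
  by rewrite add_leafE // [V _]/= !cardsU1 xV (new_edge_notin _ xV) VE.
have yV' : y \in V (add_leaf H x y) by rewrite !inE yV orbT.
apply: (connected_root yV') => a; rewrite !inE => /orP[/eqP->|aV].
  by apply: connect1; rewrite /adj add_leafE // setUC setU11.
apply: connect_sub (conH.2 _ _ yV aV) => b c bc; apply: connect1.
by rewrite /adj add_leafE // setU1r.
Qed.

(** The graph [H] with the edge [{a, b}] replaced by a path through [x]. *)
Definition subdivide H x a b : graph T :=
  mkgraph (x |: V H) ([set x; a] |: ([set x; b] |: E H :\ [set a; b])).

Lemma subdivideE H x a b : x \notin V H -> adj H a b ->
  E (subdivide H x a b) = [set x; a] |: ([set x; b] |: E H :\ [set a; b]).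
Proof.
move=> xV ab; have aV := adj_Vl ab; have bV := adj_Vr ab.
have xne y : y \in V H -> x != y by apply: contraTneq => <-.
apply: mkgraphE; apply/subsetP => e; rewrite !inE => /or3P[/eqP->|/eqP->|/andP[_ eE]].
- by rewrite subUset !sub1set !inE eqxx aV orbT cards2 xne.
- by rewrite subUset !sub1set !inE eqxx bV orbT cards2 xne.
- by rewrite (subset_trans (edge_sub eE)) ?subsetU1 // (edge_card eE).
Qed.

Lemma subdivide_tree H x a b : x \notin V H -> adj H a b -> tree H -> tree (subdivide H x a b).
Proof.
move=> xV ab /tree_card[conH VE]; have aV := adj_Vl ab; have bV := adj_Vr ab.
have EE := subdivideE xV ab; apply/tree_card; split; last first.
  have xb : [set x; b] \notin E H :\ [set a; b].
    by rewrite in_setD1 negb_and new_edge_notin ?orbT.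
  have xa : [set x; a] \notin [set x; b] |: E H :\ [set a; b].
    rewrite in_setU1 negb_or in_setD1 negb_and new_edge_notin // orbT andbT.
    by apply/eqP => /set2_inj abE; have := adj_neq ab; rewrite abE eqxx.
  by rewrite EE [V _]/= !cardsU1 xV xa xb VE (cardsD1 [set a; b] (E H)) (ab : _ \in _).
have aV' : a \in V (subdivide H x a b) by rewrite !inE aV orbT.
have xa : adj (subdivide H x a b) a x by rewrite /adj EE setUC !inE eqxx.
have xb : adj (subdivide H x a b) x b by rewrite /adj EE !inE eqxx orbT.
apply: (connected_root aV') => c; rewrite !inE => /orP[/eqP->|cV]; first exact: connect1.
apply: connect_sub (conH.2 _ _ aV cV) => p q pq.
have ab' : connect (adj (subdivide H x a b)) a b.
  exact: connect_trans (connect1 xa) (connect1 xb).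
have [pqE|pqE] := eqVneq [set p; q] [set a; b].
  move/eqP: pqE; rewrite set2_eq => /orP[]/andP[/eqP-> /eqP->] //.
  by rewrite connect_adjC.
by apply: connect1; rewrite /adj EE !inE pqE (pq : _ \in _) !orbT.
Qed.

End TreeGrowth.

Section C3Trees.
Variable T : finType.
Implicit Types (G H : graph T) (s : {perm T}) (a b v w z : T) (e : {set T}).

(** A tree whose images under the powers of [s] form a partition of the edges covering
    each vertex twice: its edges are representatives of the orbits of edges, and
    it avoids exactly one vertex of each orbit of vertices. *)
Definition C3tree G s H : Prop :=
  [/\ tree H, subgraph H G, {in E H, forall e, s @: e \notin E H},
      {in E G, forall e, [|| e \in E H, s @: e \in E H | s @: (s @: e) \in E H]}
    & {in V G, forall a,
        ((a \notin V H) + (s a \notin V H) + (s (s a) \notin V H) = 1)%N}].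

Section TreeStep.
Variables (G G' H : graph T) (s s' : {perm T}) (v w z : T).
Hypotheses (sA : s \in Aut G) (s3 : forall x, s (s (s x)) = x).
Hypothesis newV : new_vertices G v w z G'.
Hypotheses (s'E : {in V G, s' =1 s}) (s'v : s' v = w) (s'w : s' w = z) (s'z : s' z = v).
Hypothesis treeH : C3tree G s H.

Let s'_old e : e \subset V G -> s' @: e = s @: e.
Proof. by move=> /subsetP eV; apply: eq_in_imset => a /eV; exact: s'E. Qed.

Let s_old e : e \subset V G -> s @: e \subset V G.
Proof. by move=> /subsetP eV; apply/subsetP => _ /imsetP[a /eV aV ->]; rewrite aut_V. Qed.

Let new_s' a : a \in [set v; w; z] -> s' a \in [set v; w; z].
Proof.
by rewrite !inE => /orP[/orP[]|]/eqP->; rewrite ?s'v ?s'w ?s'z eqxx ?orbT.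
Qed.

Let is_new e := [exists a in [set v; w; z], a \in e].

Let newN e : is_new e -> ~~ (e \subset V G).
Proof.
case: newV => _ [vV wV zV] _ /exists_inP[a aN ae]; apply/negP => /subsetP/(_ a ae).
by move: aN; rewrite !inE => /orP[/orP[]|]/eqP->; apply/negP.
Qed.

Let new_s e : is_new e -> is_new (s' @: e).
Proof.
by move=> /exists_inP[a aN ae]; apply/exists_inP; exists (s' a); rewrite ?new_s' ?imset_f.
Qed.

(** The effect of a move on the tree: the edges [X] are replaced by [N], in the
    tree and, with their orbits, in the graph. *)
Lemma C3tree_step (H' : graph T) (X N : {set {set T}}) :
    tree H' ->
    (exists2 n, n \in [set v; w; z] & V H' = V H :|: ([set v; w; z] :\ n)) ->
    E H' = (E H :\: X) :|: N -> X \subset E H ->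
    (forall e, e \in N -> is_new e) -> (forall e, e \in N -> s' @: e \notin N) ->
    E G' = [set e in E G | [&& e \notin X, s @: e \notin X & s @: (s @: e) \notin X]] :|:
           [set e | [|| e \in N, s' @: e \in N | s' @: (s' @: e) \in N]] ->
  C3tree G' s' H'.
Proof.
move=> treeH' [n nN VH'] EH' XH newN' N_free EG'.
case: treeH => _ [VHG EHG] H_free H_cover H_miss; case: newV => uniq_new [vV wV zV] VG'.
have s3e e : s @: (s @: (s @: e)) = e by exact: imset_order3.
split=> //.
- split.
    rewrite VH' VG' setUSS ?subD1set //.
  rewrite EH' EG'; apply/subsetP => e; rewrite !inE => /orP[/andP[eX eH]|->]; last first.
    by rewrite orbT.
  rewrite eX (subsetP EHG _ eH) /=; apply/orP; left; apply/andP; split.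
    by apply: contra (H_free _ eH); exact: (subsetP XH).
  by apply/negP => /(subsetP XH)/H_free; rewrite s3e eH.
- move=> e; rewrite EH' !inE => /orP[/andP[_ eH]|eN].
    have eV := edge_sub (subsetP EHG _ eH); rewrite s'_old // (negbTE (H_free _ eH)) andbF /=.
    by apply/negP => /newN' /newN; rewrite s_old.
  rewrite (negbTE (N_free _ eN)) orbF; apply/negP => /andP[_ /(subsetP EHG)/edge_sub].
  exact/negP/newN/new_s/newN'.
- move=> e; rewrite EG' EH' !inE => /orP[/andP[eG /and3P[e1 e2 e3]]|].
    have eV := edge_sub eG; rewrite !s'_old ?s_old // e1 e2 e3 /=.
    by have /or3P[] := H_cover _ eG => ->; rewrite ?orbT.
  by case/or3P => ->; rewrite ?orbT.
move=> a; rewrite VG' inE => /orP[aV|aN].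
  have sV b : b \in V G -> s b \in V G by rewrite aut_V.
  have old b : b \in V G -> (b \in V H') = (b \in V H).
    move=> bV; rewrite VH' !inE; case: (b \in V H) => //=.
    apply: contraTF bV => /andP[_ /orP[/orP[]|]/eqP->] //.
  by rewrite s'E // s'E ?sV // !old ?sV // H_miss.
have new b : b \in [set v; w; z] -> (b \notin V H') = (b == n).
  move=> bN; rewrite VH' inE inE bN andbT negb_or inE negbK.
  have -> // : b \notin V H.
  by apply/negP => /(subsetP VHG); apply/negP; move: bN; rewrite !inE => /orP[/orP[]|]/eqP->.
rewrite !new ?new_s' //; move: aN nN uniq_new; rewrite !inE /= !inE negb_or andbT.
move=> aN nN /andP[/andP[/negbTE vw /negbTE vz] /negbTE wz].
by case/orP: aN => [/orP[]|]/eqP->; case/orP: nN => [/orP[]|]/eqP->;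
  rewrite ?s'v ?s'w ?s'z ?s'v ?s'w ?s'z ?eqxx ?vw ?vz ?wz ?(eq_sym w) ?(eq_sym z) ?vw ?vz ?wz.
Qed.

End TreeStep.
End C3Trees.

Section C3TreeMoves.
Variable T : finType.
Implicit Types (G H : graph T) (s : {perm T}) (a b v w z : T) (e f : {set T}).

(** The orbit of an edge under a symmetry. *)
Definition edge_orbit s e : {set {set T}} := orbit3 (fun f : {set T} => s @: f) e.

Lemma edge_orbitE s e : edge_orbit s e = [set e; s @: e; s @: (s @: e)].
Proof. by []. Qed.

Lemma edge_orbit_step s e : (forall x, s (s (s x)) = x) -> edge_orbit s (s @: e) = edge_orbit s e.
Proof. by move=> s3; apply: orbit3_step => f; exact: imset_order3. Qed.

(** Membership in the orbit of [e], by moving [f] instead of [e]. *)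
Lemma in_edge_orbit s e f : (forall x, s (s (s x)) = x) ->
  (f \in edge_orbit s e) = [|| f == e, s @: f == e | s @: (s @: f) == e].
Proof.
move=> s3; rewrite !inE -orbA; apply/or3P/or3P => -[] /eqP fE.
- by rewrite fE; constructor 1.
- by rewrite fE imset_order3 //; constructor 3.
- by rewrite fE imset_order3 //; constructor 2.
- by rewrite -fE; constructor 1.
- by rewrite -fE imset_order3 //; constructor 3.
- by rewrite -fE imset_order3 //; constructor 2.
Qed.

Lemma new_vertices_rot G G' v w z : new_vertices G v w z G' -> new_vertices G w z v G'.
Proof.
case=> uniq_vwz [vV wV zV] VG'; split=> //.
  by rewrite -(rot_uniq 2).
by rewrite VG'; apply/setP => a; rewrite !inE;
    case: (a == v); case: (a == w); case: (a == z); rewrite ?orbT ?orbF.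
Qed.

(** The moves are first treated when the place of the new vertex [v] is such that
    the data of the move at [v] belongs to the tree; [v] and its images play the
    same role, so that a rotation of the names reduces to this case. *)
Section Normalized.
Variables (G G' H : graph T) (s s' : {perm T}) (v w z : T).
Hypotheses (sA : s \in Aut G) (s3 : forall x, s (s (s x)) = x).
Hypothesis s'3 : forall x, s' (s' (s' x)) = x.
Hypothesis newV : new_vertices G v w z G'.
Hypotheses (s'E : {in V G, s' =1 s}) (s'v : s' v = w) (s'w : s' w = z) (s'z : s' z = v).
Hypothesis treeH : C3tree G s H.

Let vV : v \notin V G. Proof. by case: newV => _ []. Qed.
Let wV : w \notin V G. Proof. by case: newV => _ []. Qed.
Let zV : z \notin V G. Proof. by case: newV => _ []. Qed.
Let vw : v == w = false.
Proof. by case: newV => /= /and3P[]; rewrite !inE negb_or => /andP[/negbTE]. Qed.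
Let vz : v == z = false.
Proof. by case: newV => /= /and3P[]; rewrite !inE negb_or => /andP[_ /negbTE]. Qed.
Let wz : w == z = false.
Proof. by case: newV => /= /and3P[]; rewrite !inE => _ /negbTE. Qed.
Let VHG : V H \subset V G. Proof. by case: treeH => _ []. Qed.
Let notH x : x \notin V G -> x \notin V H.
Proof. by apply: contra; exact: (subsetP VHG). Qed.

Let pairE x a y b : x \notin V G -> a \in V G -> y \notin V G -> b \in V G ->
  ([set x; a] == [set y; b]) = (x == y) && (a == b).
Proof.
move=> xV aV yV bV; rewrite set2_eq orbC; case: eqP => // xb.
by rewrite xb bV in xV.
Qed.

Let step := C3tree_step sA s3 newV s'E s'v s'w s'z treeH.

Let isnew x a : x \in [set v; w; z] -> [exists b in [set v; w; z], b \in [set x; a]].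
Proof. by move=> xN; apply/exists_inP; exists x; rewrite ?set21. Qed.

(* The vertex orbit of [a] meets the tree at one of the two places other than [a]
   itself, where a leaf can be attached. *)
Let second_place a : a \in V G -> exists n n' b,
  [/\ (n, n', b) \in [:: (w, z, s a); (z, w, s (s a))], b \in V H & b \in V G].
Proof.
move=> aV; have sV b : b \in V G -> s b \in V G by rewrite aut_V.
case: treeH => _ _ _ _ /(_ a aV).
case: (boolP (s a \in V H)) => saH miss.
  by exists w, z, (s a); rewrite !inE eqxx sV.
case: (boolP (s (s a) \in V H)) miss => ssaH miss.
  by exists z, w, (s (s a)); rewrite !inE eqxx orbT !sV.
by move: miss; rewrite /=; case: (a \notin V H).
Qed.

(** The tree gets two leaves from the new orbit. *)
Lemma vertex_addition_tree v1 v2 : v1 \in V H -> v2 \in V G -> v1 != v2 ->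
    E G' = E G :|: edge_orbit s' [set v; v1] :|: edge_orbit s' [set v; v2] ->
  exists H', C3tree G' s' H'.
Proof.
move=> v1H v2V v12 EG'; have v1V := subsetP VHG _ v1H.
have sV a : a \in V G -> s a \in V G by rewrite aut_V.
have [n [n' [b [nb bH bV]]]] := second_place v2V.
have nV : n \notin V G by move: nb; rewrite !inE => /orP[]/eqP[-> _ _].
have vn : v == n = false by move: nb; rewrite !inE => /orP[]/eqP[-> _ _].
have nH' : n \notin V (add_leaf H v v1) by rewrite !inE eq_sym vn notH.
have bH' : b \in V (add_leaf H v v1) by rewrite !inE bH orbT.
pose N := [set [set v; v1]; [set n; b]].
exists (add_leaf (add_leaf H v v1) n b).
apply: (step (X := set0) (N := N)).
- by apply: add_leaf_tree => //; apply: add_leaf_tree => //; [exact: notH | case: treeH].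
- exists n'; first by move: nb; rewrite !inE => /orP[]/eqP[_ -> _]; rewrite eqxx ?orbT.
  apply/setP => a; rewrite !inE; case: (a \in V H); rewrite ?orbT //= orbF.
  move: nb; rewrite !inE => /orP[]/eqP[-> -> _].
    have [->|] := eqVneq a z; first by rewrite !(eq_sym z) vz wz.
    by rewrite orbF orbC.
  have [->|] := eqVneq a w; first by rewrite !(eq_sym w) vw eq_sym wz.
  by rewrite orbF orbC.
- rewrite !add_leafE ?notH // setD0; apply/setP => e; rewrite !inE.
  by case: (e == [set n; b]); case: (e == [set v; v1]); case: (e \in E H).
- exact: sub0set.
- by move=> e; rewrite !inE => /orP[]/eqP->; apply: isnew;
    move: nb; rewrite !inE ?eqxx // => /orP[]/eqP[-> _ _]; rewrite eqxx ?orbT.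
- move=> e; rewrite !inE => /orP[]/eqP->; rewrite imset_pair (s'E v1V, s'E bV).
    rewrite s'v !pairE ?sV // eq_sym vw /=.
    move: nb; rewrite !inE => /orP[]/eqP[-> _ ->]; last by rewrite wz.
    by rewrite eqxx (inj_eq perm_inj).
  move: nb; rewrite !inE => /orP[]/eqP[-> _ ->].
    by rewrite s'w !pairE ?sV // !(eq_sym z) vz wz.
  by rewrite s'z s3 !pairE ?sV // eqxx vz orbF /= eq_sym.
- have nbE : edge_orbit s' [set v; v2] = edge_orbit s' [set n; b].
    move: nb; rewrite !inE => /orP[]/eqP[-> _ ->].
      by rewrite -(edge_orbit_step _ s'3) imset_pair s'v s'E.
    by rewrite -2!(edge_orbit_step _ s'3) !imset_pair s'v s'w !s'E ?sV.
  rewrite EG' nbE; apply/setP => e; rewrite -setUA in_setU in_setU in_setU !in_edge_orbit //.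
  rewrite !inE /= andbT; congr (_ || _).
  by rewrite orbACA [X in _ || X = _]orbACA.
Qed.

(** The tree is extended by the path from [v0] through [v] to [w]. *)
Lemma Delta_extension_tree v0 : v0 \in V H ->
    E G' = E G :|: edge_orbit s' [set v; w] :|: edge_orbit s' [set v; v0] ->
  exists H', C3tree G' s' H'.
Proof.
move=> v0H EG'; have v0V := subsetP VHG _ v0H.
have sV a : a \in V G -> s a \in V G by rewrite aut_V.
have wH' : w \notin V (add_leaf H v v0) by rewrite !inE eq_sym vw notH.
have vH' : v \in V (add_leaf H v v0) by rewrite !inE eqxx.
pose N := [set [set v; w]; [set v; v0]].
exists (add_leaf (add_leaf H v v0) w v).
apply: (step (X := set0) (N := N)).
- by apply: add_leaf_tree => //; apply: add_leaf_tree => //; [exact: notH | case: treeH].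
- exists z; first by rewrite !inE eqxx orbT.
  apply/setP => a; rewrite !inE; case: (a \in V H); rewrite ?orbT //= orbF.
  have [->|] := eqVneq a z; first by rewrite !(eq_sym z) vz wz.
  by rewrite orbF orbC.
- rewrite !add_leafE ?notH // setD0 [[set w; v]]setUC; apply/setP => e; rewrite !inE.
  by case: (e == [set v; w]); case: (e == [set v; v0]); case: (e \in E H).
- exact: sub0set.
- by move=> e; rewrite !inE => /orP[]/eqP->; apply: isnew; rewrite !inE eqxx.
- move=> e; rewrite !inE => /orP[]/eqP->; rewrite imset_pair s'v.
    by rewrite s'w !set2_eq (eq_sym w v) (eq_sym z v) vw vz !andbF.
  rewrite s'E // !set2_eq (eq_sym w) vw eqxx /=.
  apply/norP; split; last by apply: contraNN wV => /andP[/eqP-> _].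
  by apply: contraNN vV => /eqP<-; rewrite sV.
- rewrite EG'; apply/setP => e; rewrite -setUA in_setU in_setU in_setU !in_edge_orbit //.
  rewrite !inE /= andbT; congr (_ || _).
  by rewrite orbACA [X in _ || X = _]orbACA.
Qed.

(** The tree gets one subdivided edge and one leaf. *)
Lemma edge_split_tree v1 v2 v3 : [set v1; v2] \in E H -> v3 \in V G ->
    uniq [:: v1; v2; v3] ->
    E G' = (E G :\: edge_orbit s' [set v1; v2]) :|: edge_orbit s' [set v; v1] :|:
           edge_orbit s' [set v; v2] :|: edge_orbit s' [set v; v3] ->
  exists H', C3tree G' s' H'.
Proof.
move=> v12H v3V uniq123 EG'.
have v1H := adj_Vl v12H; have v2H := adj_Vr v12H.
have v1V := subsetP VHG _ v1H; have v2V := subsetP VHG _ v2H.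
have sV a : a \in V G -> s a \in V G by rewrite aut_V.
have [n [n' [b [nb bH bV]]]] := second_place v3V.
have nV : n \notin V G by move: nb; rewrite !inE => /orP[]/eqP[-> _ _].
have vn : v == n = false by move: nb; rewrite !inE => /orP[]/eqP[-> _ _].
have nH' : n \notin V (subdivide H v v1 v2) by rewrite !inE eq_sym vn notH.
have bH' : b \in V (subdivide H v v1 v2) by rewrite !inE bH orbT.
pose N := [set [set v; v1]; [set v; v2]; [set n; b]].
exists (add_leaf (subdivide H v v1 v2) n b).
apply: (step (X := [set [set v1; v2]]) (N := N)).
- by apply: add_leaf_tree => //; apply: subdivide_tree => //; [exact: notH | case: treeH].
- exists n'; first by move: nb; rewrite !inE => /orP[]/eqP[_ -> _]; rewrite eqxx ?orbT.
  apply/setP => a; rewrite !inE; case: (a \in V H); rewrite ?orbT //= orbF.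
  move: nb; rewrite !inE => /orP[]/eqP[-> -> _].
    have [->|] := eqVneq a z; first by rewrite !(eq_sym z) vz wz.
    by rewrite orbF orbC.
  have [->|] := eqVneq a w; first by rewrite !(eq_sym w) vw eq_sym wz.
  by rewrite orbF orbC.
- rewrite add_leafE // subdivideE ?notH //; apply/setP => e; rewrite !inE.
  by case: (e == [set n; b]); case: (e == [set v; v1]); case: (e == [set v; v2]);
    rewrite ?orbT ?orbF.
- by rewrite sub1set.
- by move=> e; rewrite !inE => /orP[/orP[]|]/eqP->; apply: isnew;
    move: nb; rewrite !inE ?eqxx // => /orP[]/eqP[-> _ _]; rewrite eqxx ?orbT.
- have v13 : v1 != v3.
    by move: uniq123; rewrite /= !inE negb_or => /andP[/andP[]].
  have v23 : v2 != v3.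
    by move: uniq123; rewrite /= !inE negb_or => /and3P[].
  move=> e; rewrite !inE => /orP[/orP[]|]/eqP->; rewrite imset_pair (s'E v1V, s'E v2V, s'E bV).
  + rewrite s'v !pairE ?sV // !(eq_sym w) vw /=.
    move: nb; rewrite !inE => /orP[]/eqP[-> _ ->]; last by rewrite !(eq_sym z) wz.
    by rewrite eqxx (inj_eq perm_inj).
  + rewrite s'v !pairE ?sV // !(eq_sym w) vw /=.
    move: nb; rewrite !inE => /orP[]/eqP[-> _ ->]; last by rewrite !(eq_sym z) wz.
    by rewrite eqxx (inj_eq perm_inj).
  move: nb; rewrite !inE => /orP[]/eqP[-> _ ->].
    by rewrite s'w !pairE ?sV // !(eq_sym z) vz wz.
  by rewrite s'z s3 !pairE ?sV // eqxx vz orbF /= negb_or !(eq_sym v3) v13.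
- have nbE : edge_orbit s' [set v; v3] = edge_orbit s' [set n; b].
    move: nb; rewrite !inE => /orP[]/eqP[-> _ ->].
      by rewrite -(edge_orbit_step _ s'3) imset_pair s'v s'E.
    by rewrite -2!(edge_orbit_step _ s'3) !imset_pair s'v s'w !s'E ?sV.
  rewrite EG' nbE; apply/setP => e.
  have memO f := in_edge_orbit f e s'3.
  move: (edge_orbit s') memO => O memO; rewrite -!setUA !inE !memO /=.
  have s'e f : f \in E G -> s' @: f = s @: f.
    by move/edge_sub/subsetP => fV; apply: eq_in_imset => a /fV; exact: s'E.
  congr (_ || _); last first.
    case: (e == [set v; v1]); rewrite ?orbT //=.
    case: (e == [set v; v2]); rewrite ?orbT //=.
    case: (e == [set n; b]); rewrite ?orbT //=.
    case: (s' @: e == [set v; v1]); rewrite ?orbT //=.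
    case: (s' @: e == [set v; v2]); rewrite ?orbT //=.
    case: (s' @: e == [set n; b]); rewrite ?orbT //=.
    by case: (s' @: (s' @: e) == [set v; v1]).
  rewrite andbC; apply: andb_id2l => eG.
  by rewrite !negb_or !s'e ?aut_edge.
Qed.

End Normalized.
End C3TreeMoves.

Section Sequences.
Variables (R : realType) (T : finType).
Implicit Types (G H K : graph T) (Phi : 'M[R]_2 -> {perm T}) (s : {perm T}).
Implicit Types (a b v w z : T) (e f : {set T}).

Section OneStep.
Variables (G G' : graph T) (Phi Phi' : 'M[R]_2 -> {perm T}) (v w z : T).
Hypotheses (hPhi : C3_hom G Phi) (hPhi' : C3_hom G' Phi') (free : free_on G (Phi C3)).
Hypothesis newV : new_vertices G v w z G'.
Hypothesis agree : {in C3_group, forall x, {in V G, Phi' x =1 Phi x}}.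
Hypotheses (s'v : Phi' C3 v = w) (s'w : Phi' C3 w = z) (s'z : Phi' C3 z = v).

Let s := Phi C3.
Let s' := Phi' C3.

Let sA : s \in Aut G. Proof. by have [] := C3_homE hPhi. Qed.
Let s3 x : s (s (s x)) = x. Proof. by have [_ _ ->] := C3_homE hPhi. Qed.
Let s'3 x : s' (s' (s' x)) = x. Proof. by have [_ _ ->] := C3_homE hPhi'. Qed.
Let s'E : {in V G, s' =1 s}.
Proof. by move=> a aV; apply: agree; rewrite // !inE eqxx orbT. Qed.
Let ss a : Phi (C3 *m C3) a = s (s a).
Proof. by have [_ -> _ _] := C3_homE hPhi; rewrite permM. Qed.
Let sV a : a \in V G -> s a \in V G. Proof. by rewrite aut_V. Qed.

Let orbit_new a : a \in V G -> edge_orbit s' [set v; a] =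
  [set [set v; a]; [set w; s a]; [set z; s (s a)]].
Proof. by move=> aV; rewrite edge_orbitE !imset_pair s'v s'w !s'E ?sV. Qed.

(* Renaming the new vertices so that the neighbour [a'] of the first one lies in
   the tree. *)
Let tree_rot a b H : a \in V G -> b \in V G -> C3tree G s H ->
  exists v' w' z' a' b', [/\ new_vertices G v' w' z' G',
    [/\ s' v' = w', s' w' = z' & s' z' = v'], a' \in V H,
    [/\ b' \in V G, edge_orbit s' [set v'; a'] = edge_orbit s' [set v; a] &
        edge_orbit s' [set v'; b'] = edge_orbit s' [set v; b]]
    & (a == b) = (a' == b') /\ edge_orbit s' [set v'; w'] = edge_orbit s' [set v; w]].
Proof.
move=> aV bV [_ _ _ _ /(_ a aV) miss].
have : [\/ a \in V H, s a \in V H | s (s a) \in V H].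
  by apply/or3P; move: miss; case: (a \in V H); case: (s a \in V H); case: (s (s a) \in V H).
case=> [aH|aH|aH].
- by exists v, w, z, a, b.
- exists w, z, v, (s a), (s b); split; rewrite ?(inj_eq perm_inj) ?sV //.
  + exact: new_vertices_rot.
  + split=> //; rewrite ?sV //.
      by rewrite -[RHS](edge_orbit_step _ s'3) imset_pair s'v s'E.
    by rewrite -[RHS](edge_orbit_step _ s'3) imset_pair s'v s'E.
  + by split=> //; rewrite -[RHS](edge_orbit_step _ s'3) imset_pair s'v s'w.
- exists z, v, w, (s (s a)), (s (s b)); split; rewrite ?(inj_eq perm_inj) ?sV //.
  + by do 2!apply: new_vertices_rot.
  + split=> //; rewrite ?sV ?sV //.
      rewrite -[RHS](edge_orbit_step _ s'3) -[RHS](edge_orbit_step _ s'3).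
      by rewrite !imset_pair s'v s'w !s'E ?sV.
    rewrite -[RHS](edge_orbit_step _ s'3) -[RHS](edge_orbit_step _ s'3).
    by rewrite !imset_pair s'v s'w !s'E ?sV.
  + split=> //; rewrite -[RHS](edge_orbit_step _ s'3) -[RHS](edge_orbit_step _ s'3).
    by rewrite !imset_pair s'v s'w s'z.
Qed.

Lemma vertex_addition_step : vertex_addition G Phi v w z G' ->
  (sym_independent R G s -> sym_independent R G' s') /\
  ((exists H, C3tree G s H) -> exists H, C3tree G' s' H).
Proof.
case=> _ [v1 [v2 [v1V v2V v12 EG']]]; rewrite !ss in EG'.
split=> [|[H treeH]].
  exact: (vertex_addition_independent sA s3 free newV s'E s'v s'w s'z v1V v2V v12 EG').
have EG2 : E G' = E G :|: edge_orbit s' [set v; v1] :|: edge_orbit s' [set v; v2].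
  rewrite EG' !orbit_new //; apply/setP => e; rewrite !inE.
  case: (e == [set v; v1]); case: (e == [set v; v2]); case: (e == [set w; s v1]);
  case: (e == [set w; s v2]); case: (e == [set z; s (s v1)]); rewrite ?orbT ?orbF //.
have [v' [w' [z' [a [b [newV' [sv sw sz] aH [bV oa ob] [abE _]]]]]]] := tree_rot v1V v2V treeH.
have ab : a != b by rewrite -abE.
rewrite -oa -ob in EG2.
exact: (vertex_addition_tree sA s3 s'3 newV' s'E sv sw sz treeH aH bV ab EG2).
Qed.

Lemma Delta_extension_step : Delta_extension G Phi v w z G' ->
  (sym_independent R G s -> sym_independent R G' s') /\
  ((exists H, C3tree G s H) -> exists H, C3tree G' s' H).
Proof.
case=> _ [v0 [v0V sv0 EG']]; rewrite !ss in EG'.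
split=> [|[H treeH]].
  exact: (Delta_extension_independent sA s3 free newV s'E s'v s'w s'z v0V EG').
have EG2 : E G' = E G :|: edge_orbit s' [set v; w] :|: edge_orbit s' [set v; v0].
  have -> : edge_orbit s' [set v; w] = [set [set v; w]; [set w; z]; [set z; v]].
    by rewrite edge_orbitE !imset_pair s'v s'w s'z.
  rewrite EG' !orbit_new //; apply/setP => e; rewrite !inE.
  case: (e == [set v; w]); case: (e == [set w; z]); case: (e == [set z; v]);
  case: (e == [set v; v0]); case: (e == [set w; s v0]); rewrite ?orbT ?orbF //.
have [v' [w' [z' [a [_ [newV' [sv sw sz] aH [_ oa _] [_ ow]]]]]]] := tree_rot v0V v0V treeH.
rewrite -oa -ow in EG2.
exact: (Delta_extension_tree sA s3 s'3 newV' s'E sv sw sz treeH aH EG2).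
Qed.

Lemma edge_split_step : edge_split G Phi v w z G' ->
  (sym_independent R G s -> sym_independent R G' s') /\
  ((exists H, C3tree G s H) -> exists H, C3tree G' s' H).
Proof.
case=> _ [v1 [v2 [v3 [[v1V v2V v3V] uniq123 v12E _ EG']]]].
have {}EG' : E G' = (E G :\: [set [set v1; v2]; [set s v1; s v2]; [set s (s v1); s (s v2)]])
               :|: [set [set v; a] | a in [set v1; v2; v3]]
               :|: [set [set w; s a] | a in [set v1; v2; v3]]
               :|: [set [set z; s (s a)] | a in [set v1; v2; v3]].
  by rewrite EG' !ss; congr (_ :|: _); apply: eq_in_imset => a _; rewrite ss.
split=> [|[H treeH]].
  exact: (edge_split_independent sA s3 free newV s'E s'v s'w s'z v1V v2V v3V uniq123 v12E EG').
have EG2 : E G' = (E G :\: edge_orbit s' [set v1; v2]) :|: edge_orbit s' [set v; v1] :|: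
           edge_orbit s' [set v; v2] :|: edge_orbit s' [set v; v3].
  have -> : edge_orbit s' [set v1; v2] =
      [set [set v1; v2]; [set s v1; s v2]; [set s (s v1); s (s v2)]].
    by rewrite edge_orbitE !imset_pair !s'E ?sV.
  rewrite EG' !orbit_new // !imsetU !imset_set1 -!setUA; congr (_ :|: _).
  apply/setP => e; rewrite !inE.
  case: (e == [set v; v1]); rewrite ?orbT //=.
  case: (e == [set v; v2]); rewrite ?orbT //=.
  case: (e == [set v; v3]); rewrite ?orbT //=.
  case: (e == [set w; s v1]); rewrite ?orbT //=.
  case: (e == [set w; s v2]); rewrite ?orbT //=.
  case: (e == [set w; s v3]); rewrite ?orbT //=.
have key v' w' z' a b c : new_vertices G v' w' z' G' -> s' v' = w' -> s' w' = z' -> s' z' = v' ->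
    [set a; b] \in E H -> c \in V G -> uniq [:: a; b; c] ->
    edge_orbit s' [set a; b] = edge_orbit s' [set v1; v2] ->
    edge_orbit s' [set v'; a] = edge_orbit s' [set v; v1] ->
    edge_orbit s' [set v'; b] = edge_orbit s' [set v; v2] ->
    edge_orbit s' [set v'; c] = edge_orbit s' [set v; v3] ->
    exists H', C3tree G' s' H'.
  move=> newV' sv sw sz abH cV uabc o1 o2 o3 o4.
  apply: (edge_split_tree sA s3 s'3 newV' s'E sv sw sz treeH abH cV uabc).
  by rewrite o1 o2 o3 o4.
have [_ _ _ /(_ _ v12E) /or3P[] eH _] := treeH.
- exact: (key v w z v1 v2 v3).
- rewrite imset_pair in eH.
  apply: (key w z v (s v1) (s v2) (s v3)); rewrite ?sV //.
  + exact: new_vertices_rot.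
  + by rewrite -(map_inj_uniq (@perm_inj _ s)) /= in uniq123.
  1-4: by rewrite -[RHS](edge_orbit_step _ s'3) imset_pair ?s'v !s'E.
- rewrite !imset_pair in eH.
  apply: (key z v w (s (s v1)) (s (s v2)) (s (s v3))); rewrite ?sV ?sV //.
  + by do 2!apply: new_vertices_rot.
  + by rewrite -(map_inj_uniq (inj_comp (@perm_inj _ s) (@perm_inj _ s))) /= in uniq123.
  1-4: by rewrite -[RHS](edge_orbit_step _ s'3) -[RHS](edge_orbit_step _ s'3)
    !imset_pair ?s'v ?s'w !s'E ?sV.
Qed.

End OneStep.

Lemma triangle_C3tree s a : (forall x, s (s (s x)) = x) -> s a != a ->
  exists H, C3tree (complete_graph (orbit3 s a)) s H.
Proof.
move=> s3 sa; have ssa := order3_step2_neq s3 sa.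
pose H := mkgraph [set a; s a] [set [set a; s a]].
have EH : E H = [set [set a; s a]].
  apply: mkgraphE; apply/subsetP => e; rewrite !inE => /eqP->.
  by rewrite subxx cards2 (eq_sym a) sa.
have asa : adj H a (s a) by rewrite /adj EH set11.
have aO : {subset [set a; s a] <= orbit3 s a}.
  by move=> b; rewrite !inE => /orP[]/eqP->; rewrite eqxx ?orbT.
exists H; split.
- apply/tree_card; split; last by rewrite EH cards1 /= cards2 (eq_sym a) sa.
  apply: (@connected_root _ _ a) => [|b]; first by rewrite !inE eqxx.
  by rewrite !inE => /orP[]/eqP-> //; exact: connect1.
- split; first exact/subsetP.
  rewrite EH sub1set inE cards2 (eq_sym a) sa andbT; exact/subsetP.
- move=> e; rewrite EH !inE => /eqP->; rewrite imset_pair set2_eq (negbTE sa) /=.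
  by rewrite (negbTE ssa) andbF.
- move=> e /edgeP[b [c [-> bc bO cO]]]; rewrite EH !inE.
  rewrite !imset_pair; move: bc bO cO; rewrite !inE.
  move=> bc /orP[/orP[]|]/eqP bE /orP[/orP[]|]/eqP cE; move: bc; rewrite bE cE ?eqxx // => _;
    rewrite ?s3 !set2_eq ?s3 !eqxx ?orbT //.
move=> b; rewrite !inE.
have as_ : (a == s a) = false by rewrite eq_sym (negbTE sa).
have ass : (a == s (s a)) = false by rewrite eq_sym (negbTE ssa).
by move=> /orP[/orP[]|]/eqP->; rewrite ?s3 ?(inj_eq perm_inj) !eqxx ?(negbTE sa)
  ?(negbTE ssa) ?as_ ?ass ?(inj_eq perm_inj) ?(negbTE sa) ?as_.
Qed.

(** What is carried along a construction sequence. *)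
Lemma sequence_facts G Phi : has_construction_sequence G Phi ->
  [/\ free_on G (Phi C3), sym_independent R G (Phi C3) & exists H, C3tree G (Phi C3) H].
Proof.
move=> seqG.
have c2 : (C3 : 'M[R]_2) \in C3_group by rewrite !inE eqxx orbT.
pose P G Phi := sym_independent R G (Phi C3) /\ exists H, C3tree G (Phi C3) H.
have base A Phi0 a : C3_hom (complete_graph A) Phi0 -> Phi0 C3 a != a ->
    A = orbit3 (Phi0 C3) a -> P (complete_graph A) Phi0.
  move=> hom0 sa AE; have [_ _ s3 _] := C3_homE hom0; split.
    exact: (triangle_independent R s3 sa).
  by rewrite AE; exact: triangle_C3tree.
have step Gi Phii Gi' Phii' : C3_hom Gi Phii -> free_on Gi (Phii C3) -> P Gi Phii ->
      C3_hom Gi' Phii' -> construction_step Gi Phii Gi' Phii' -> P Gi' Phii'.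
  move=> hi freei [indi treei] hi' [v [w [z [moves agree [sv sw sz]]]]].
  have [iind itree] : (sym_independent R Gi (Phii C3) -> sym_independent R Gi' (Phii' C3)) /\
      ((exists H, C3tree Gi (Phii C3) H) -> exists H, C3tree Gi' (Phii' C3) H).
    case: moves => mv; have newV := mv.1.
    + exact: (vertex_addition_step hi hi' freei newV agree sv sw sz).
    + exact: (edge_split_step hi hi' freei newV agree sv sw sz).
    + exact: (Delta_extension_step hi hi' freei newV agree sv sw sz).
  by split; [exact: iind | exact: itree].
have [Phi' [PhiE hPhi' free [ind tree]]] := construction_ind base step seqG.
by rewrite -PhiE.
Qed.

Section Image.
Variable s : {perm T}.
Hypothesis s3 : forall x, s (s (s x)) = x.

Lemma in_image_V H a : (a \in V (image_graph s H)) = (s (s a) \in V H).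
Proof. by rewrite -{1}(s3 a) /= mem_imset //; exact: perm_inj. Qed.

Lemma in_image_E H e : (e \in E (image_graph s H)) = (s @: (s @: e) \in E H).
Proof.
rewrite -{1}(imset_order3 e s3) /= mem_imset //; exact/imset_inj/perm_inj.
Qed.

Lemma image_graph3 H : image_graph s (image_graph s (image_graph s H)) = H.
Proof.
apply: graph_ext; apply/setP => x.
  by rewrite !in_image_V !s3.
by rewrite !in_image_E !imset_order3.
Qed.

Lemma image_tree H : tree H -> tree (image_graph s H).
Proof.
move=> /tree_card[conH VE]; apply/tree_card; split; last first.
  by rewrite /= !card_imset ?VE //; [exact/imset_inj/perm_inj | exact: perm_inj].
have adjs a b : adj H a b -> adj (image_graph s H) (s a) (s b).
  by rewrite /adj in_image_E !imset_pair !s3.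
have cons a b : connect (adj H) a b -> connect (adj (image_graph s H)) (s a) (s b).
  move=> /connectP[q pq ->]; elim: q a pq => //= c q IHq a /andP[ac /IHq].
  exact/connect_trans/connect1/adjs.
case: conH => /set0Pn[r rV] conH; split=> [|a b].
  by apply/set0Pn; exists (s r); rewrite in_image_V s3.
by rewrite !in_image_V -{2}(s3 a) -{2}(s3 b) => aV bV; apply: cons; exact: conH.
Qed.

(** The three rotated copies of the tree form a partition. *)
Lemma C3tree_threeTree2 G H : s \in Aut G -> C3tree G s H ->
  exists Tr : 'Z_3 -> graph T,
    threeTree2 G Tr /\ forall i, image_graph s (Tr i) = Tr (i + 1).
Proof.
move=> sA [treeH [VHG EHG] H_free H_cover H_miss].
pose Tr (i : 'Z_3) := iter i (image_graph s) H; exists Tr; split; last first.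
  case=> -[|[|[|//]]] lt3; rewrite /Tr //=; exact: image_graph3.
have Tr_V a : [/\ (a \in V (Tr 0)) = (a \in V H), (a \in V (Tr 1)) = (s (s a) \in V H)
    & (a \in V (Tr (1 + 1))) = (s a \in V H)].
  by split; rewrite /Tr ?in_image_V ?s3.
have Tr_E e : [/\ (e \in E (Tr 0)) = (e \in E H), (e \in E (Tr 1)) = (s @: (s @: e) \in E H)
    & (e \in E (Tr (1 + 1))) = (s @: e \in E H)].
  by split; rewrite /Tr ?in_image_E ?imset_order3.
have Z3 (i : 'Z_3) : [\/ i = 0, i = 1 | i = 1 + 1].
  case: i => -[|[|[|//]]] lt3; [constructor 1 | constructor 2 | constructor 3]; exact: val_inj.
have sum3 (F : 'Z_3 -> nat) : (\sum_i F i = F 0%R + F 1%R + F (1 + 1)%R)%N.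
  rewrite 3!big_ord_recl big_ord0 addn0 addnA; congr (F _ + F _ + F _)%N; exact: val_inj.
have EG e : (e \in E G) = [|| e \in E H, s @: e \in E H | s @: (s @: e) \in E H].
  apply/idP/idP => [/H_cover //|].
  by case/or3P => /(subsetP EHG) // eE; rewrite -(imset_order3 e s3);
    do 3?[exact: eE | apply: (aut_edge sA)].
have free2 e : e \in E H -> s @: (s @: e) \notin E H.
  by move=> eH; apply/negP => /H_free; rewrite imset_order3 // eH.
split.
- move=> i; split.
    by rewrite /Tr; elim: (nat_of_ord i) => //= n; exact: image_tree.
  split; apply/subsetP => x.
    have [V0 V1 V2] := Tr_V x.
    case: (Z3 i) => ->; rewrite ?V0 ?V1 ?V2 => /(subsetP VHG); by rewrite ?aut_V.
  have [E0 E1 E2] := Tr_E x.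
  by case: (Z3 i) => ->; rewrite ?E0 ?E1 ?E2 EG => ->; rewrite ?orbT.
- move=> i j ij; apply/pred0P => e /=; have [E0 E1 E2] := Tr_E e.
  apply/negbTE/negP => /andP[]; move: ij.
  case: (Z3 i) => ->; case: (Z3 j) => ->; rewrite ?eqxx // ?E0 ?E1 ?E2 => _ ei ej.
  + by rewrite (negbTE (free2 _ ei)) in ej.
  + by rewrite (negbTE (H_free _ ei)) in ej.
  + by rewrite (negbTE (free2 _ ej)) in ei.
  + by rewrite (negbTE (H_free _ ej)) in ei.
  + by rewrite (negbTE (H_free _ ej)) in ei.
  + by rewrite (negbTE (H_free _ ei)) in ej.
- apply/setP => e; have [E0 E1 E2] := Tr_E e; rewrite EG.
  apply/idP/bigcupP => [/or3P[]eH|[i _]].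
  + by exists 0; rewrite ?E0.
  + by exists (1 + 1); rewrite ?E2.
  + by exists 1; rewrite ?E1.
  by case: (Z3 i) => ->; rewrite ?E0 ?E1 ?E2 => ->; rewrite ?orbT.
move=> a aV; rewrite -sum1dep_card big_mkcond /= sum3.
have [-> -> ->] := Tr_V a; have := H_miss a aV.
by case: (a \in V H); case: (s a \in V H); case: (s (s a) \in V H).
Qed.

End Image.

(** Two trees of a partition with the same vertex set [X] would give the
    subgraph on [X] as many as [2 #|X| - 2] edges. *)
Lemma sparse_proper G (Tr : 'Z_3 -> graph T) : threeTree2 G Tr ->
    (forall H, subgraph H G -> (2 <= #|V H|)%N -> (#|E H| <= 2 * #|V H| - 3)%N) ->
  proper_family Tr.
Proof.
move=> [trees disj _ _] sparse i j H K ij treeH [VH EH] EH0 treeK [VK EK] EK0 VHK.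
pose M := mkgraph (V H) (E H :|: E K).
have EM : E M = E H :|: E K.
  apply: mkgraphE; apply/subsetP => e; rewrite !inE => /orP[]eE.
    by rewrite edge_sub // (edge_card eE).
  by rewrite VHK edge_sub // (edge_card eE).
have [_ [VTr ETr]] := trees i; have [_ [_ ETr']] := trees j.
have subM : subgraph M G.
  split; first exact: subset_trans VH VTr.
  by rewrite EM subUset (subset_trans EH ETr) (subset_trans EK ETr').
have disjHK : E H :&: E K = set0.
  apply/eqP; rewrite setI_eq0; exact: disjointWr EK (disjointWl EH (disj i j ij)).
have [_ cH] := (tree_card H).1 treeH; have [_ cK] := (tree_card K).1 treeK.
have EH1 : (0 < #|E H|)%N by rewrite card_gt0.
have V2 : (2 <= #|V M|)%N by rewrite [V M]/= cH ltnS.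
have := sparse M subM V2; rewrite EM cardsU disjHK cards0 [V M]/=.
move: cH cK EH1; rewrite -VHK; move: #|V H| #|E H| #|E K| => n x y; clear; lia.
Qed.

End Sequences.

(** * Counting edges in a proper tree partition *)

Section Partition.
Variable T : finType.
Implicit Types (G H K : graph T) (s : {perm T}) (a b : T) (e : {set T}).

Lemma sum_Z3 (F : 'Z_3 -> nat) k : (\sum_i F i = F k + F (k + 1)%R + F (k + 2)%R)%N.
Proof.
have -> : (\sum_i F i = \sum_i F (k + i)%R)%N.
  by rewrite (reindex (fun i => k + i)) //; exists (fun i => - k + i) => i _;
    rewrite ?addKr ?addNKr.
rewrite 3!big_ord_recl big_ord0 addn0 addnA -[in F k](addr0 k).
congr (F _ + F _ + F _)%N; congr (k + _); exact: val_inj.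
Qed.

Section Family.
Variables (G : graph T) (Tr : 'Z_3 -> graph T).
Hypothesis partTr : threeTree2 G Tr.

(** Each vertex is counted twice. *)
Lemma threeTree2_vertices (X : {set T}) : X \subset V G ->
  (\sum_i #|X :&: V (Tr i)| = 2 * #|X|)%N.
Proof.
move=> /subsetP XG; case: partTr => _ _ _ two.
transitivity (\sum_i \sum_(a in X) (a \in V (Tr i) : nat))%N.
  apply: eq_bigr => i _; rewrite -sum1_card big_mkcond [RHS]big_mkcond /=.
  by apply: eq_bigr => a _; rewrite inE; case: (a \in X); case: (a \in _).
rewrite exchange_big /= mulnC -sum_nat_const; apply: eq_bigr => a /XG aV.
apply: etrans (two a aV); rewrite -sum1dep_card [RHS]big_mkcond.
by apply: eq_bigr => i _; case: (a \in _).
Qed.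

(** Each edge is counted once. *)
Lemma threeTree2_edges (F : {set {set T}}) : F \subset E G ->
  (\sum_i #|F :&: E (Tr i)| = #|F|)%N.
Proof.
move=> /subsetP FG; case: partTr => _ disj EG _.
transitivity (\sum_i \sum_(e in F) (e \in E (Tr i) : nat))%N.
  apply: eq_bigr => i _; rewrite -sum1_card big_mkcond [RHS]big_mkcond /=.
  by apply: eq_bigr => e _; rewrite inE; case: (e \in F); case: (e \in _).
rewrite exchange_big /= -sum1_card; apply: eq_bigr => e /FG.
rewrite EG => /bigcupP[i _ ei]; rewrite (bigD1 i) //= ei big1 // => j ji.
by have /pred0P/(_ e)/= := disj j i ji; rewrite ei andbT => ->.
Qed.

Lemma threeTree2_card : (2 * #|V G| = #|E G| + 3)%N.
Proof.
rewrite -(threeTree2_vertices (subxx _)) -(threeTree2_edges (subxx _)).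
case: partTr => trees _ _ _.
transitivity (\sum_i #|E G :&: E (Tr i)| + \sum_(i : 'Z_3) 1)%N; last first.
  by rewrite sum_nat_const card_ord.
rewrite -big_split /=; apply: eq_bigr => i _; have [tree_i [VG EG]] := trees i.
have [_ c] := (tree_card _).1 tree_i.
by rewrite (setIidPr VG) (setIidPr EG) c addn1.
Qed.

(** A proper partition is sparse: on a vertex set [X] the forests cut out by the
    trees have in all [2 #|X|] vertices, hence at least three components unless
    two of them are trees spanning [X]. *)
Lemma proper_sparse H : proper_family Tr -> subgraph H G -> (2 <= #|V H|)%N ->
  (#|E H| <= 2 * #|V H| - 3)%N.
Proof.
move=> proper [VHG EHG] V2; case: (partTr) => trees _ _ _.
pose F i := mkgraph (V H :&: V (Tr i)) (E H :&: E (Tr i)).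
have EF i : E (F i) = E H :&: E (Tr i).
  apply: mkgraphE; apply/subsetP => e; rewrite !inE => /andP[eH ei].
  by rewrite subsetI (edge_sub eH) (edge_sub ei) (edge_card eH).
have sub_F i : subgraph (F i) (Tr i) by split; rewrite ?EF subsetIr.
have acF i : acyclic (F i).
  have [[_ acT] _] := trees i; apply: acyclic_sub acT => a b; rewrite /adj EF inE.
  by case/andP.
have cF i : V (F i) != set0 -> (#|E (F i)| < #|V (F i)|)%N /\
    (#|V (F i)| = #|E (F i)|.+1 -> tree (F i)).
  move=> V0; have [lt conF] := acyclic_card (acF i) V0; split=> // /conF conFi.
  by split.
have c0 i : #|V (F i)| = 0%N -> #|E (F i)| = 0%N.
  move=> /eqP; rewrite cards_eq0 => /eqP V0; apply/eqP; rewrite cards_eq0; apply/eqP/setP => e.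
  by rewrite in_set0; apply/negP => /edgeP[a [_ [_ _ aV _]]]; rewrite V0 in_set0 in aV.
have sumV : (\sum_i #|V (F i)| = 2 * #|V H|)%N := threeTree2_vertices VHG.
have sumE : (\sum_i #|E (F i)| = #|E H|)%N.
  by rewrite -(threeTree2_edges EHG); apply: eq_bigr => i _; rewrite EF.
have leV i : (#|V (F i)| <= #|V H|)%N := subset_leq_card (subsetIl _ _).
case: (pickP (fun k => V (F k) == set0)) => [k Vk|nonempty]; last first.
  have lt i : (#|E (F i)| < #|V (F i)|)%N by have [] := cF i (negbT (nonempty i)).
  move: sumV sumE (lt 0) (lt (0 + 1)) (lt (0 + 2)); rewrite !(sum_Z3 _ 0).
  move: (#|V (F 0)|) (#|V (F (0 + 1))|) (#|V (F (0 + 2))|) => v0 v1 v2.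
  move: (#|E (F 0)|) (#|E (F (0 + 1))|) (#|E (F (0 + 2))|) => e0 e1 e2.
  by move: #|V H| #|E H| => n m; clear; lia.
have Vk0 : #|V (F k)| = 0%N by rewrite (eqP Vk) cards0.
have Ek0 := c0 _ Vk0.
have V1 : #|V (F (k + 1))| = #|V H|.
  move: sumV (leV (k + 1)) (leV (k + 2)); rewrite (sum_Z3 _ k) Vk0.
  by move: #|V (F (k + 1))| #|V (F (k + 2))| #|V H|; clear; lia.
have V2' : #|V (F (k + 2))| = #|V H|.
  move: sumV (leV (k + 1)) (leV (k + 2)); rewrite (sum_Z3 _ k) Vk0.
  by move: #|V (F (k + 1))| #|V (F (k + 2))| #|V H|; clear; lia.
have n1 : V (F (k + 1)) != set0 by rewrite -card_gt0 V1 ltnW.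
have n2 : V (F (k + 2)) != set0 by rewrite -card_gt0 V2' ltnW.
have [lt1 tree1] := cF _ n1; have [lt2 tree2] := cF _ n2.
rewrite leqNgt; apply/negP => big.
have [E1 E2] : #|V (F (k + 1))| = #|E (F (k + 1))|.+1 /\ #|V (F (k + 2))| = #|E (F (k + 2))|.+1.
  move: sumE big lt1 lt2 V2; rewrite (sum_Z3 _ k) Ek0 V1 V2'.
  by move: #|E (F (k + 1))| #|E (F (k + 2))| #|V H| #|E H|; clear; lia.
have VE1 : V (F (k + 1)) = V H by apply/eqP; rewrite eqEcard subsetIl V1 /=.
have VE2 : V (F (k + 2)) = V H by apply/eqP; rewrite eqEcard subsetIl V2' /=.
have k12 : k + 1 != k + 2 by rewrite (inj_eq (addrI k)).
apply: (proper _ _ _ _ k12 (tree1 E1) (sub_F _) _ (tree2 E2) (sub_F _)).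
- by rewrite -card_gt0; move: E1 V2; rewrite V1; move: #|V H| #|E _|; clear; lia.
- by rewrite -card_gt0; move: E2 V2; rewrite V2'; move: #|V H| #|E _|; clear; lia.
- by rewrite VE1 VE2.
Qed.

(** A fixed vertex would lie in all three trees or in none. *)
Lemma threeTree2_free s : (forall i, image_graph s (Tr i) = Tr (i + 1)) -> free_on G s.
Proof.
move=> rotTr a aV; apply/eqP => sa; case: partTr => _ _ _ /(_ a aV).
have step i : (a \in V (Tr (i + 1))) = (a \in V (Tr i)).
  by rewrite -rotTr /= -{1}sa mem_imset //; exact: perm_inj.
rewrite -sum1dep_card big_mkcond /= (sum_Z3 _ 0).
have -> : 0 + 2 = 0 + 1 + 1 :> 'Z_3 by exact: val_inj.
by rewrite !step; case: (a \in V (Tr 0)).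
Qed.

End Family.
End Partition.

(** * Reducing a symmetric sparse graph *)

Section Sparse.
Variable T : finType.
Implicit Types (G H : graph T) (s : {perm T}) (a b c v w z : T) (e f : {set T}) (X Y A : {set T}).

(** Every set of at least two vertices spans at most [2 #|X| - 3] edges. A set with
    equality is called tight. *)
Definition sparse G : Prop :=
  forall X, X \subset V G -> (2 <= #|X|)%N -> (#|spanned G X| + 3 <= 2 * #|X|)%N.

Lemma spanned_supermodular G X Y :
  (#|spanned G X| + #|spanned G Y| <= #|spanned G (X :|: Y)| + #|spanned G (X :&: Y)|)%N.
Proof.
rewrite -cardsUI leq_add //; apply: subset_leq_card; apply/subsetP => e; rewrite !inE.
  by move=> /orP[]/andP[-> eX]; rewrite (subset_trans eX) ?subsetUl ?subsetUr.
by move=> /andP[/andP[-> eX] /andP[_ eY]]; rewrite subsetI eX eY.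
Qed.

Lemma spanned_mono G X Y : X \subset Y -> spanned G X \subset spanned G Y.
Proof.
by move=> XY; apply/subsetP => e; rewrite !inE => /andP[-> eX]; exact: subset_trans XY.
Qed.

Section Symmetric.
Variables (G : graph T) (s : {perm T}).
Hypotheses (sA : s \in Aut G) (s3 : forall x, s (s (s x)) = x) (free : free_on G s).
Hypothesis spG : sparse G.

Let i X := #|spanned G X|.

Lemma spanned_image X : #|spanned G (s @: X)| = #|spanned G X|.
Proof.
rewrite -(card_imset (spanned G X) (imset_inj (@perm_inj _ s))).
apply: eq_card => e; rewrite inE; apply/andP/imsetP => [[eE eX]|[f]].
  exists (s @: (s @: e)); last by rewrite imset_order3.
  rewrite inE !aut_edge //=; apply/subsetP => _ /imsetP[_ /imsetP[a ae ->] ->].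
  by have /imsetP[b bX ->] := subsetP eX _ ae; rewrite s3.
by rewrite inE => /andP[fE fX] ->; rewrite aut_edge // imsetS.
Qed.

Lemma card_image X : #|s @: X| = #|X|.
Proof. exact: card_imset (@perm_inj _ s). Qed.

(** In an invariant set all the orbits of vertices and edges have three members. *)
Lemma card_invariant X : X \subset V G -> s @: X = X ->
  exists m k, #|X| = (3 * m)%N /\ i X = (3 * k)%N.
Proof.
move=> /subsetP XV sX.
have sXin : {in X, forall x, s x \in X} by move=> x xX; rewrite -sX imset_f.
exists #|[set x in X | orep s x == x]|.
exists #|[set e in spanned G X | orep (fun e : {set T} => s @: e) e == e]|; split.
  by apply: card_order3 => // x /XV; exact: free.
apply: card_order3 => [e|e|e]; first exact: imset_order3.
  by rewrite !inE => /andP[eE eX]; rewrite aut_edge //= -sX imsetS.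
by rewrite inE => /andP[eE _]; exact: (free_edge s3 free eE).
Qed.

(** The hull of a set under the action of [s]. *)
Let hull X := (X :|: s @: X) :|: s @: (s @: X).

Let hull_inv X : s @: hull X = hull X.
Proof.
by rewrite /hull !imsetU (imset_order3 _ s3) setUC setUA.
Qed.

(** Combining a set with its images does not increase the deficiency
    [2 #|X| - #|spanned G X|] beyond [d] when all the intersections have
    deficiency at least [d]. *)
Lemma hull_deficiency X d : (2 * #|X| <= i X + d)%N ->
    (i (X :&: s @: X) + d <= 2 * #|X :&: s @: X|)%N ->
    (i ((X :|: s @: X) :&: s @: (s @: X)) + d <= 2 * #|(X :|: s @: X) :&: s @: (s @: X)|)%N ->
  (2 * #|hull X| <= i (hull X) + d)%N.
Proof.
move=> dX d1 d2.
have sup1 := spanned_supermodular G X (s @: X).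
have sup2 := spanned_supermodular G (X :|: s @: X) (s @: (s @: X)).
have c1 := cardsUI X (s @: X); have c2 := cardsUI (X :|: s @: X) (s @: (s @: X)).
rewrite -/(hull X) !spanned_image !card_image in sup1 sup2 c1 c2.
move: dX d1 d2 sup1 sup2 c1 c2; rewrite /i.
move: #|X| #|spanned G X| #|hull X| #|spanned G (hull X)| #|X :|: s @: X|
  #|spanned G (X :|: s @: X)| #|X :&: s @: X| #|spanned G (X :&: s @: X)|
  #|(X :|: s @: X) :&: s @: (s @: X)| #|spanned G ((X :|: s @: X) :&: s @: (s @: X))|.
by clear; lia.
Qed.

(* The pair [{a, b}] is contained in no tight subset of [A]. *)
Section Unblocked.
Variables (A : {set T}) (a b : T).
Hypotheses (AV : A \subset V G) (sAA : s @: A = A).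
Hypothesis unblocked : forall X, X \subset A -> a \in X -> b \in X -> (i X + 4 <= 2 * #|X|)%N.

Let ab : {set T} := [set a; b].
Let O := edge_orbit s ab.

Let imA X : X \subset A -> s @: X \subset A.
Proof. by move=> XA; rewrite -sAA imsetS. Qed.

Let O_step e : e \in O -> s @: e \in O.
Proof.
rewrite /O !in_edge_orbit // imset_order3 // => /or3P[]->; rewrite ?orbT //.
Qed.

(** No subset of [A] containing an edge of the orbit is tight. *)
Lemma unblocked1 X e : X \subset A -> e \in O -> e \subset X -> (i X + 4 <= 2 * #|X|)%N.
Proof.
move=> XA; rewrite /O in_edge_orbit // => /or3P[]/eqP eE eX.
- by apply: unblocked; rewrite // (subsetP eX) // eE ?set21 ?set22.
- rewrite -(card_image X) /i -spanned_image; apply: unblocked; first exact: imA.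
    by rewrite (subsetP (imsetS s eX)) // eE set21.
  by rewrite (subsetP (imsetS s eX)) // eE set22.
- rewrite -(card_image X) -(card_image (s @: X)) /i -(spanned_image X) -spanned_image.
  apply: unblocked; first by do 2!apply: imA.
    by rewrite (subsetP (imsetS s (imsetS s eX))) // eE set21.
  by rewrite (subsetP (imsetS s (imsetS s eX))) // eE set22.
Qed.

Let hullA X : X \subset A -> hull X \subset A.
Proof. by move=> XA; rewrite !subUset XA !imA. Qed.

Let sub_hull X : X \subset hull X.
Proof. by rewrite /hull -setUA subsetUl. Qed.

(** A set containing two edges of the orbit has a larger deficiency. Otherwise the
    deficiency of its hull would be four, but it is a multiple of three. *)
Lemma unblocked2 X e : X \subset A -> e \in O -> e \subset X -> s @: e \subset X ->
  (i X + 5 <= 2 * #|X|)%N.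
Proof.
move=> XA eO eX seX; have le4 := unblocked1 XA eO eX.
rewrite leqNgt; apply/negP => lt5.
have : (2 * #|hull X| <= i (hull X) + 4)%N.
  apply: hull_deficiency; first by lia.
    apply: (@unblocked1 _ (s @: e)); rewrite ?O_step //.
      exact: subset_trans (subsetIl _ _) XA.
    by rewrite subsetI seX imsetS.
  apply: (@unblocked1 _ (s @: (s @: e))); rewrite ?O_step //.
    by apply: subset_trans (subsetIr _ _) _; do 2!apply: imA.
  by rewrite subsetI imsetS ?imsetS // subsetU // imsetS ?orbT.
have := unblocked1 (hullA XA) eO (subset_trans eX (sub_hull X)).
have [m [k [-> ->]]] := card_invariant (subset_trans (hullA XA) AV) (hull_inv X).
clear; lia.
Qed.

(** A set containing the whole orbit has deficiency at least six; for its hull, five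
    is not a multiple of three. *)
Lemma unblocked3 X : X \subset A -> (forall e, e \in O -> e \subset X) ->
  (i X + 6 <= 2 * #|X|)%N.
Proof.
move=> XA OX; have abO : ab \in O by rewrite /O in_edge_orbit ?eqxx.
have le5 := unblocked2 XA abO (OX _ abO) (OX _ (O_step abO)).
rewrite leqNgt; apply/negP => lt6.
have OsX e : e \in O -> e \subset s @: X.
  by move=> eO; rewrite -(imset_order3 e s3) imsetS // OX // !O_step.
have OssX e : e \in O -> e \subset s @: (s @: X).
  by move=> eO; rewrite -(imset_order3 e s3) !imsetS // OX // !O_step.
have : (2 * #|hull X| <= i (hull X) + 5)%N.
  apply: hull_deficiency; first by lia.
    apply: (@unblocked2 _ ab) => //; first exact: subset_trans (subsetIl _ _) XA.
      by rewrite subsetI OX ?OsX.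
    by rewrite subsetI OX ?OsX ?O_step.
  apply: (@unblocked2 _ ab) => //.
  - by apply: subset_trans (subsetIr _ _) _; do 2!apply: imA.
  - by rewrite subsetI subsetU ?OX ?OssX.
  - by rewrite subsetI subsetU ?OX ?OssX ?O_step.
have abX : ab \subset hull X := subset_trans (OX _ abO) (sub_hull X).
have sabX : s @: ab \subset hull X := subset_trans (OX _ (O_step abO)) (sub_hull X).
have := unblocked2 (hullA XA) abO abX sabX.
have [m [k [-> ->]]] := card_invariant (subset_trans (hullA XA) AV) (hull_inv X).
clear; lia.
Qed.

(** Adding the orbit of an unblocked pair keeps the graph sparse. *)
Lemma add_orbit_sparse G' : V G' = A -> E G' = spanned G A :|: O -> sparse G'.
Proof.
move=> VG' EG' X; rewrite VG' => XA X2.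
have XV := subset_trans XA AV; have spX := spG XV X2.
have sub : spanned G' X \subset spanned G X :|: [set e in O | e \subset X].
  apply/subsetP => e; rewrite !inE EG' !inE => /andP[/orP[/andP[-> _]|->] ->] //.
  by rewrite orbT.
have le1 : (#|spanned G' X| <= i X + #|[set e in O | e \subset X]|)%N.
  by rewrite (leq_trans (subset_leq_card sub)) // cardsU leq_subr.
pose e1 := ab; pose e2 := s @: e1; pose e3 := s @: e2.
have [O1 O2 O3] : [/\ e1 \in O, e2 \in O & e3 \in O].
  have O1 : e1 \in O by rewrite /O in_edge_orbit ?eqxx.
  by split; rewrite ?O_step.
have e3s : s @: e3 = e1 by exact: imset_order3.
have le2 : (#|[set e in O | e \subset X]| <= (e1 \subset X) + (e2 \subset X) + (e3 \subset X))%N.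
  have sub2 : [set e in O | e \subset X] \subset
      (if e1 \subset X then [set e1] else set0) :|: (if e2 \subset X then [set e2] else set0)
      :|: (if e3 \subset X then [set e3] else set0).
    apply/subsetP => e; rewrite !inE => /andP[/orP[/orP[]|] /eqP-> eX];
      by rewrite /e3 /e2 /e1 eX !inE eqxx ?orbT.
  apply: leq_trans (subset_leq_card sub2) _.
  have cif (c : bool) e : (#|if c then [set e] else set0| = c)%N.
    by case: c; rewrite ?cards1 ?cards0.
  by do 2!(rewrite (leq_trans (leq_card_setU _ _).1) // ?cif ?leq_add2r).
apply: leq_trans (_ : i X + ((e1 \subset X) + (e2 \subset X) + (e3 \subset X)) + 3 <= _)%N.
  by rewrite leq_add2r (leq_trans le1) // leq_add2l.
case: (boolP (e1 \subset X)) => X1; case: (boolP (e2 \subset X)) => X2';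
  case: (boolP (e3 \subset X)) => X3 /=.
- have := @unblocked3 X XA; rewrite -!addnA; apply.
  by move=> e; rewrite !inE => /orP[/orP[]|] /eqP->.
- by rewrite -addnA; exact: (unblocked2 XA O1).
- by rewrite -addnA; apply: (unblocked2 XA O3) => //; rewrite e3s.
- by rewrite -addnA; exact: (unblocked1 XA O1).
- by rewrite -addnA; exact: (unblocked2 XA O2).
- by rewrite -addnA; exact: (unblocked1 XA O2).
- by rewrite -addnA; exact: (unblocked1 XA O3).
- by rewrite !addn0; exact: spX.
Qed.

End Unblocked.

(** Among three neighbours of [v], two are contained in no tight subset of [A]:
    three tight sets blocking the three pairs would have a tight union, and
    joining [v] to it would give too many edges. *)
Lemma exists_unblocked A v a b c : A \subset V G :\ v -> v \in V G ->
    a \in A -> b \in A -> c \in A -> uniq [:: a; b; c] ->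
    adj G v a -> adj G v b -> adj G v c ->
  let free_pair x y := forall X, X \subset A -> x \in X -> y \in X ->
    (i X + 4 <= 2 * #|X|)%N in
  [\/ free_pair a b, free_pair a c | free_pair b c].
Proof.
move=> AV vV aA bA cA uabc va vb vc free_pair.
have ac : a != c by move: uabc; rewrite /= !inE negb_or => /andP[/andP[]].
have ab : a != b by move: uabc; rewrite /= !inE negb_or => /andP[/andP[]].
have bc : b != c by move: uabc; rewrite /= !inE => /and3P[].
have AV' : A \subset V G by apply: subset_trans AV _; exact: subD1set.
have gt1 (X : {set T}) x y : x \in X -> y \in X -> x != y -> (2 <= #|X|)%N.
  by move=> xX yX xy; apply/card_gt1P; exists x, y.
(* No tight subset of [A] contains the three neighbours. *)
have no3 X : X \subset A -> a \in X -> b \in X -> c \in X -> (i X + 4 <= 2 * #|X|)%N.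
  move=> XA aX bX cX; have vX : v \notin X.
    by apply/negP => /(subsetP XA)/(subsetP AV); rewrite !inE eqxx.
  have sub : spanned G X :|: [set [set v; a]; [set v; b]; [set v; c]] \subset spanned G (v |: X).
    apply/subsetP => e; rewrite !inE => /orP[/andP[-> eX]|].
      by rewrite (subset_trans eX) // subsetUr.
    by move=> /orP[/orP[]|]/eqP->; rewrite (va : _ \in _, vb : _ \in _, vc : _ \in _)
      subUset !sub1set !inE eqxx ?aX ?bX ?cX orbT.
  have vN x : [set v; x] \notin spanned G X.
    by rewrite inE subUset sub1set (negbTE vX) andbF.
  have n2 x y : x != y -> ([set v; x] == [set v; y]) = false.
    by move=> xy; apply/eqP => /set2_inj E1; rewrite E1 eqxx in xy.
  have := subset_leq_card sub; rewrite cardsU (_ : _ :&: _ = set0); last first.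
    apply/setP => e; rewrite inE in_set0; apply/negP => /andP[eX]; rewrite !inE.
    by move=> /orP[/orP[]|]/eqP eE; move: eX; rewrite eE; apply/negP.
  rewrite cards0 subn0 -setUA !cardsU1 cards1 !inE !n2 //= => le.
  have XV : v |: X \subset V G.
    by rewrite subUset sub1set vV (subset_trans XA).
  have X2 : (2 <= #|v |: X|)%N by rewrite cardsU1 vX ltnS; apply/card_gt0P; exists a.
  have := spG XV X2; rewrite cardsU1 vX; move: le; rewrite /i.
  by move: #|spanned G X| #|X| #|spanned G (v |: X)|; clear; lia.
have tight x y : ~ free_pair x y -> exists X, [/\ X \subset A, x \in X, y \in X
    & (2 * #|X| <= i X + 3)%N].
  move=> nfree; apply/not_existsP => H; apply: nfree => X XA xX yX.
  rewrite addnS ltnNge; apply/negP => le.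
  by apply: (H X); split.
have [|nab] := pselect (free_pair a b); first by constructor 1.
have [|nac] := pselect (free_pair a c); first by constructor 2.
have [|nbc] := pselect (free_pair b c); first by constructor 3.
have [X [XA aX bX tX]] := tight _ _ nab.
have [Y [YA aY cY tY]] := tight _ _ nac.
have [Z [ZA bZ cZ tZ]] := tight _ _ nbc.
(* Two tight sets meeting in two vertices would have a tight union. *)
have meet1 X1 X2 : X1 \subset A -> X2 \subset A -> (2 * #|X1| <= i X1 + 3)%N ->
    (2 * #|X2| <= i X2 + 3)%N -> a \in X1 :|: X2 -> b \in X1 :|: X2 -> c \in X1 :|: X2 ->
    (#|X1 :&: X2| <= 1)%N.
  move=> X1A X2A t1 t2 aU bU cU; rewrite leqNgt; apply/negP => gt.
  have := no3 (X1 :|: X2); rewrite subUset X1A X2A => /(_ isT aU bU cU).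
  have := spG (subset_trans (subset_trans (subsetIl X1 X2) X1A) AV') gt.
  have := spanned_supermodular G X1 X2; have := cardsUI X1 X2.
  move: t1 t2; rewrite /i; move: #|X1| #|X2| #|spanned G X1| #|spanned G X2|.
  move: #|X1 :|: X2| #|X1 :&: X2| #|spanned G (X1 :|: X2)| #|spanned G (X1 :&: X2)|.
  by clear; lia.
have XY1 : (#|X :&: Y| <= 1)%N by apply: meet1; rewrite // inE ?aX ?bX ?cY ?orbT.
have XZ1 : (#|X :&: Z| <= 1)%N by apply: meet1; rewrite // inE ?aX ?bX ?cZ ?orbT.
have YZ1 : (#|Y :&: Z| <= 1)%N by apply: meet1; rewrite // inE ?aY ?bZ ?cZ ?orbT.
have disj X1 X2 : (#|X1 :&: X2| <= 1)%N -> spanned G X1 :&: spanned G X2 = set0.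
  move=> le1; apply/setP => e; rewrite !inE; apply/negP => /andP[/andP[eE e1] /andP[_ e2]].
  have : (#|e| <= #|X1 :&: X2|)%N by rewrite subset_leq_card // subsetI e1.
  by rewrite (edge_card eE) leqNgt ltnS le1.
pose U := X :|: Y :|: Z.
have UA : U \subset A by rewrite !subUset XA YA ZA.
have cE : (i X + i Y + i Z <= i U)%N.
  have d3 : (spanned G X :|: spanned G Y) :&: spanned G Z = set0.
    by rewrite setIUl !disj // setU0.
  have -> : (i X + i Y + i Z = #|spanned G X :|: spanned G Y :|: spanned G Z|)%N.
    by rewrite cardsU d3 cards0 subn0 cardsU disj // cards0 subn0.
  by apply: subset_leq_card; rewrite !subUset !spanned_mono //;
    apply/subsetP => x xX; rewrite !inE xX ?orbT.
have cU : (#|U| + 3 <= #|X| + #|Y| + #|Z|)%N.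
  have h1 : (1 <= #|X :&: Y|)%N by apply/card_gt0P; exists a; rewrite inE aX.
  have h2 : (2 <= #|(X :|: Y) :&: Z|)%N.
    by apply: (gt1 _ b c); rewrite ?inE ?bX ?bZ ?cY ?cZ ?orbT.
  have := cardsUI X Y; have := cardsUI (X :|: Y) Z; rewrite -/U; move: h1 h2.
  move: #|X| #|Y| #|Z| #|U| #|X :|: Y| #|X :&: Y| #|(X :|: Y) :&: Z|.
  by clear; lia.
exfalso; have := no3 U UA; rewrite !inE aX bX cZ !orbT => /(_ isT isT isT).
move: tX tY tZ cE cU; rewrite /i.
move: #|X| #|Y| #|Z| #|U| #|spanned G X| #|spanned G Y| #|spanned G Z| #|spanned G U|.
by clear; lia.
Qed.

End Symmetric.
End Sparse.

Section Reduction.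
Variables (R : realType) (T : finType).
Implicit Types (G H : graph T) (Phi : 'M[R]_2 -> {perm T}) (s : {perm T}).
Implicit Types (a b c v w z : T) (e f : {set T}) (X Y A : {set T}).

(** Restriction of a symmetry to an invariant set of vertices. *)
Section Restrict.
Variables (G G' : graph T) (Phi : 'M[R]_2 -> {perm T}).
Hypotheses (hPhi : C3_hom G Phi).
Hypothesis invA : forall a, (Phi C3 a \in V G') = (a \in V G').
Hypothesis invE : forall a b, adj G' (Phi C3 a) (Phi C3 b) = adj G' a b.

(** The homomorphism that restricts the automorphisms to the vertices of [G']. *)
Definition restrict_hom (x : 'M[R]_2) : {perm T} := restr_perm (V G') (Phi x).

Let astab x : x \in C3_group -> Phi x \in ('N(V G' | 'P))%g.
Proof.
have [Phi1 Phi2 _ _] := C3_homE hPhi.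
move=> xC; apply/astabsP => a /=; rewrite /aperm.
move: xC; rewrite !inE => /or3P[]/eqP->; first by rewrite Phi1 perm1.
  exact: invA.
by rewrite Phi2 permM !invA.
Qed.

Lemma restrict_homE x : x \in C3_group -> {in V G', restrict_hom x =1 Phi x}.
Proof. by move=> xC a aV; rewrite /restrict_hom restr_permE // astab. Qed.

Lemma restrict_C3_hom : C3_hom G' restrict_hom.
Proof.
have [Phi1 Phi2 _ _] := C3_homE hPhi; split=> [x xC|x y xC yC].
  rewrite inE restr_perm_on /=; apply/forall_inP => a aV; apply/forall_inP => b bV.
  rewrite !restrict_homE //; move: xC; rewrite !inE => /or3P[]/eqP->.
  - by rewrite Phi1 !perm1.
  - by rewrite invE.
  - by rewrite Phi2 !permM !invE.
rewrite /restrict_hom hPhi.2 //; apply: (morphM (restr_perm_morphism _)); exact: astab.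
Qed.

End Restrict.

Section Reduce.
Variables (G : graph T) (Phi : 'M[R]_2 -> {perm T}).
Hypotheses (hPhi : C3_hom G Phi) (free : free_on G (Phi C3)).
Hypotheses (spG : sparse G) (cardG : (#|E G| + 3 = 2 * #|V G|)%N) (V3 : (3 < #|V G|)%N).

Let s := Phi C3.
Let sA : s \in Aut G. Proof. by have [] := C3_homE hPhi. Qed.
Let s3 x : s (s (s x)) = x. Proof. by have [_ _ ->] := C3_homE hPhi. Qed.
Let ss a : Phi (C3 *m C3) a = s (s a).
Proof. by have [_ -> _ _] := C3_homE hPhi; rewrite permM. Qed.
Let sV a : (s a \in V G) = (a \in V G). Proof. exact: aut_V. Qed.

Lemma sum_degrees : (\sum_(a in V G) #|nbrs G a| = 2 * #|E G|)%N.
Proof.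
transitivity (\sum_(a in V G) \sum_(e in E G) (a \in e : nat))%N.
  apply: eq_bigr => a _; rewrite -card_star -sum1_card big_mkcond [RHS]big_mkcond /=.
  by apply: eq_bigr => e _; rewrite inE; case: (e \in E G); case: (a \in e).
rewrite exchange_big /= mulnC -sum_nat_const; apply: eq_bigr => e eE.
rewrite -(edge_card eE) -sum1_card big_mkcond [RHS]big_mkcond; apply: eq_bigr => a _.
by case: (boolP (a \in e)) => ae; [rewrite (subsetP (edge_sub eE)) | case: (_ \in _)].
Qed.

(** Deleting a vertex of degree at most one would leave too many edges. *)
Lemma degree_ge2 a : a \in V G -> (2 <= #|nbrs G a|)%N.
Proof.
move=> aV; have := card_edges_del G a; have cV := cardsD1 a (V G); rewrite aV in cV.
have V2 : (2 <= #|V G :\ a|)%N by move: cV V3; clear; lia.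
have := spG (subD1set (V G) a) V2; move: cV cardG.
move: #|nbrs G a| #|V G| #|V G :\ a| #|spanned G (V G :\ a)| #|E G|; clear; lia.
Qed.

Lemma exists_degree_le3 : exists2 a, a \in V G & (#|nbrs G a| <= 3)%N.
Proof.
case: (boolP [exists a in V G, #|nbrs G a| <= 3]%N) => [/exists_inP//|/exists_inPn deg4].
have : (\sum_(a in V G) 4 <= \sum_(a in V G) #|nbrs G a|)%N.
  by apply: leq_sum => a aV; have := deg4 a aV; rewrite -ltnNge.
rewrite sum_degrees sum_nat_const; move: cardG; move: #|V G| #|E G|; clear; lia.
Qed.

Lemma card_V_ge6 : (6 <= #|V G|)%N.
Proof.
have [||m [_ [cm _]]] := @card_invariant T G s sA s3 free (V G) => //.
  by apply/setP => a; rewrite -{1}(s3 a) mem_imset ?sV //; exact: perm_inj.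
by move: cm V3; move: #|V G|; clear; lia.
Qed.

Variable v : T.
Hypothesis vV : v \in V G.
Let w := s v.
Let z := s w.
Let A := V G :\: [set v; w; z].

Let vw : (v == w) = false. Proof. by rewrite eq_sym; apply/negbTE/free. Qed.
Let wz : (w == z) = false. Proof. by rewrite (inj_eq perm_inj). Qed.
Let vz : (v == z) = false.
Proof. by rewrite eq_sym; apply/negbTE; apply: (@order3_step2_neq _ s s3 v); exact: free. Qed.
Let sz : s z = v. Proof. exact: s3. Qed.

Let uniq_vwz : uniq [:: v; w; z].
Proof. by rewrite /= !inE vw vz wz. Qed.

Let AV : A \subset V G. Proof. exact: subsetDl. Qed.

Let invA a : (s a \in A) = (a \in A).
Proof.
have ev : (s a == v) = (a == z) by rewrite -{1}sz (inj_eq perm_inj).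
have ew : (s a == w) = (a == v) by rewrite (inj_eq perm_inj).
have ez : (s a == z) = (a == w) by rewrite (inj_eq perm_inj).
by rewrite !inE sV ev ew ez; case: (a == v); case: (a == w); case: (a == z).
Qed.

Let notA x : x \in [set v; w; z] -> x \notin A.
Proof. by move=> xN; rewrite inE xN. Qed.

Let inA a : a \in V G -> a != v -> a != w -> a != z -> a \in A.
Proof. by move=> aV av aw az; rewrite !inE aV andbT !negb_or av aw az. Qed.

Let sAA : s @: A = A.
Proof. by apply/setP => a; rewrite -{1}(s3 a) mem_imset ?invA //; exact: perm_inj. Qed.

Let orbitV : [set v; w; z] \subset V G.
Proof. by apply/subsetP => a; rewrite !inE => /orP[/orP[]|]/eqP->; rewrite ?sV. Qed.

Let cardA : #|V G| = (#|A| + 3)%N.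
Proof.
have c3 : #|[set v; w; z]| = 3%N.
  by rewrite -setUA cardsU1 cards2 !inE vw vz wz.
by rewrite -(cardsID [set v; w; z]) (setIidPr orbitV) c3 addnC.
Qed.

(** The edges outside [A] form the orbits of the edges at [v]. *)
Let edge_split_star e : (e \in E G) =
  (e \in spanned G A) || [exists b in nbrs G v, e \in edge_orbit s [set v; b]].
Proof.
apply/idP/orP => [eE|[|/exists_inP[b]]]; last 2 first.
- by rewrite inE => /andP[].
- rewrite inE in_edge_orbit // => vb /or3P[]/eqP eE.
  + by rewrite eE.
  + by rewrite -(imset_order3 e s3) eE !aut_edge.
  + by rewrite -(imset_order3 e s3) eE aut_edge.
have [eA|eA] := boolP (e \subset A); first by left; rewrite inE eE.
right; have /subsetPn[x xe xA] := eA.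
have xV := subsetP (edge_sub eE) _ xe.
have [b eb] : exists b, e = [set x; b].
  have [p [q [epq _ _ _]]] := edgeP eE; move: xe; rewrite epq !inE => /orP[]/eqP->.
    by exists q.
  by exists p; rewrite setUC.
move: xA; rewrite inE xV andbT negbK !inE => /orP[/orP[]|]/eqP xE; subst x.
- by apply/exists_inP; exists b; rewrite ?in_edge_orbit ?inE /adj -?eb ?eqxx.
- apply/exists_inP; exists (s (s b)).
    by rewrite inE /adj -[v]s3 -imset_pair -[s b]/(s b) -!imset_pair -eb !aut_edge.
  by rewrite in_edge_orbit // eb !imset_pair -/z sz eqxx !orbT.
- apply/exists_inP; exists (s b).
    by rewrite inE /adj -sz -imset_pair -eb aut_edge.
  by rewrite in_edge_orbit // eb imset_pair sz eqxx !orbT.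
Qed.

Let G0 := mkgraph A (E G).
Let EG0 : E G0 = spanned G A. Proof. exact: spannedE. Qed.

Let imA e : e \subset A -> s @: e \subset A.
Proof. by move=> eA; rewrite -sAA imsetS. Qed.

Let spanned_step e : (s @: e \in spanned G A) = (e \in spanned G A).
Proof.
apply/idP/idP; rewrite !inE => /andP[eE eA].
  rewrite -(imset_order3 e s3); apply/andP; split.
    exact: aut_edge sA (aut_edge sA eE).
  exact: imA (imA eA).
by apply/andP; split; [exact: aut_edge | exact: imA].
Qed.

Let card_orbit e : (#|edge_orbit s e| <= 3)%N.
Proof.
rewrite edge_orbitE -setUA cardsU1 cards2; case: (_ \notin _); case: (_ != _) => //.
Qed.

(** The properties required of a graph from which [G] is obtained by a move. *)
Definition reduces_to G' Phi' : Prop :=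
  [/\ C3_hom G' Phi', free_on G' (Phi' C3), sparse G', (#|E G'| + 3 = 2 * #|V G'|)%N &
      (#|V G'| < #|V G|)%N /\ construction_step G' Phi' G Phi].

Let A2 : (2 <= #|A|)%N.
Proof. by have := card_V_ge6; rewrite cardA; move: #|A|; clear; lia. Qed.

Let reduce G' (Phi' := restrict_hom G' Phi) :
    V G' = A -> (forall e, (s @: e \in E G') = (e \in E G')) -> sparse G' ->
    (#|E G| <= #|E G'| + 6)%N ->
    [\/ vertex_addition G' Phi' v w z G, edge_split G' Phi' v w z G
      | Delta_extension G' Phi' v w z G] ->
  exists G' Phi', reduces_to G' Phi'.
Proof.
move=> VG' EG's spG' cE moves.
have invG' a : (Phi C3 a \in V G') = (a \in V G') by rewrite VG' invA.
have adjG' a b : adj G' (Phi C3 a) (Phi C3 b) = adj G' a b.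
  by rewrite /adj -imset_pair EG's.
have hom' := restrict_C3_hom hPhi invG' adjG'.
have rE := restrict_homE hPhi invG'.
have c2 : (C3 : 'M[R]_2) \in C3_group by rewrite !inE eqxx orbT.
exists G', Phi'; split=> //.
- by move=> a aV; rewrite rE //; apply: free; rewrite VG' in aV; exact: (subsetP AV).
- have : sparse G' := spG'; move=> /(_ (V G') (subxx _)); rewrite VG' => /(_ A2).
  have -> : spanned G' A = E G'.
    by apply/setP => e; rewrite inE -VG'; case: (boolP (e \in E G')) => //= /edge_sub.
  by move: cE cardG; rewrite cardA; move: #|E G| #|E G'| #|A|; clear; lia.
split; first by rewrite VG' cardA; move: #|A|; clear; lia.
by exists v, w, z; split=> // x xC a aV; rewrite rE.
Qed.

Let newV G' : V G' = A -> new_vertices G' v w z G.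
Proof.
move=> VG'; split; rewrite ?VG' ?notA ?inE ?eqxx ?orbT //.
apply/setP => a; rewrite in_setU in_setD.
case: (boolP (a \in [set v; w; z])) => [aN|_]; rewrite ?orbT ?orbF //=.
exact: (subsetP orbitV).
Qed.

Let sparse0 : sparse G0.
Proof.
move=> X XA X2; have -> : spanned G0 X = spanned G X.
  apply/setP => e; rewrite {1}/spanned EG0 !inE -andbA; congr (_ && _).
  by case: (boolP (e \subset X)) => eX; rewrite ?andbF // andbT (subset_trans eX XA).
exact: spG (subset_trans XA AV) X2.
Qed.

Let E0step e : (s @: e \in E G0) = (e \in E G0).
Proof. by rewrite EG0 spanned_step. Qed.

Let restr0 G' x a : V G' = A -> (forall e, (s @: e \in E G') = (e \in E G')) ->
  x \in C3_group -> a \in A -> restrict_hom G' Phi x a = Phi x a.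
Proof.
move=> VG' EG's xC aA; apply: (restrict_homE hPhi) => // [b|]; last by rewrite VG'.
by rewrite VG' invA.
Qed.

Let cC : (C3 : 'M[R]_2) \in C3_group. Proof. by rewrite !inE eqxx orbT. Qed.
Let cCC : (C3 *m C3 : 'M[R]_2) \in C3_group. Proof. by rewrite !inE eqxx !orbT. Qed.

Let orbit_new a : edge_orbit s [set v; a] =
  [set [set v; a]; [set w; s a]; [set z; s (s a)]].
Proof. by rewrite edge_orbitE !imset_pair. Qed.

Let card_le_orbits (S : {set {set T}}) e1 e2 :
  (#|S :|: edge_orbit s e1 :|: edge_orbit s e2| <= #|S| + 6)%N.
Proof.
have := leq_card_setU (S :|: edge_orbit s e1) (edge_orbit s e2).
have := leq_card_setU S (edge_orbit s e1).
have := card_orbit e1; have := card_orbit e2.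
move=> h1 h2 [h3 _] [h4 _]; move: h1 h2 h3 h4.
move: #|S| #|edge_orbit s e1| #|edge_orbit s e2| #|S :|: edge_orbit s e1|
  #|S :|: edge_orbit s e1 :|: edge_orbit s e2|; clear; lia.
Qed.

(** A vertex of degree two or three and its orbit are removed by the inverse of a
    move, the kind of which depends on the degree and on the adjacency of the
    vertices of the orbit. *)
Lemma reduce_vertex : (#|nbrs G v| <= 3)%N -> exists G' Phi', reduces_to G' Phi'.
Proof.
move=> le3; have ge2 := degree_ge2 vV.
have adj_wz : adj G v w = adj G v z.
  have -> : adj G v z = adj G z v by exact: adjC.
  by rewrite -[LHS](aut_adj _ _ sA) -[LHS](aut_adj _ _ sA) sz.
have nbrV a : a \in nbrs G v -> a \in V G by rewrite inE => /adj_Vr.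
have [vwE|vwE] := boolP (adj G v w).
  (* The orbit of [v] spans a triangle. *)
  have wN : w \in nbrs G v by rewrite inE.
  have zN : z \in nbrs G v by rewrite inE -adj_wz.
  have wzO : edge_orbit s [set v; z] = edge_orbit s [set v; w].
    by rewrite [[set v; z]]setUC -(edge_orbit_step _ s3) imset_pair sz.
  have [v0 [v0N v0w v0z]] : exists v0, [/\ v0 \in nbrs G v, v0 != w & v0 != z].
    have [/subsetPn[v0 v0N]|sub] := boolP (~~ (nbrs G v \subset [set w; z])).
      by rewrite !inE negb_or => /andP[]; exists v0.
    have EGE : E G \subset spanned G A :|: edge_orbit s [set v; w].
      apply/subsetP => e; rewrite edge_split_star in_setU => /orP[->//|/exists_inP[b bN eO]].
      move: sub; rewrite negbK => /subsetP/(_ b bN)/set2P[] bE;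
        by move: eO; rewrite bE ?wzO => ->; rewrite orbT.
    have := subset_leq_card EGE; have := leq_card_setU (spanned G A) (edge_orbit s [set v; w]).
    have := card_orbit [set v; w]; have := spG AV A2; move: cardG; rewrite cardA.
    move=> h1 h2 h3 [h4 _] h5; exfalso; move: h1 h2 h3 h4 h5.
    move: #|A| #|E G| #|spanned G A| #|edge_orbit s [set v; w]|
      #|spanned G A :|: edge_orbit s [set v; w]|; clear; lia.
  have v0V := nbrV _ v0N.
  have v0v : v0 != v by rewrite eq_sym; move: v0N; rewrite inE => /adj_neq.
  have v0A : v0 \in A by exact: inA.
  have NE : nbrs G v = [set w; z; v0].
    apply/esym/eqP; rewrite eqEcard; apply/andP; split.
      by apply/subsetP => a; rewrite !inE => /orP[/orP[]|]/eqP->; move: wN zN v0N; rewrite !inE.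
    by rewrite -setUA cardsU1 cards2 !inE wz !(eq_sym _ v0) (negbTE v0w) v0z.
  have EGE : E G = E G0 :|: edge_orbit s [set v; w] :|: edge_orbit s [set v; v0].
    apply/setP => e; rewrite edge_split_star EG0 -setUA 2!in_setU; congr (_ || _).
    apply/exists_inP/orP => [[b]|].
      rewrite NE in_setU in_set1 => /orP[/set2P[]|/eqP]->; rewrite ?wzO => eO; by [left|right].
    by case=> eO; [exists w | exists v0].
  apply: (@reduce G0) => //; first by rewrite {1}EGE; exact: card_le_orbits.
  constructor 3; split; first exact: newV.
  exists v0; rewrite !restr0 // ss; split=> //; first exact: free.
  rewrite {1}EGE !orbit_new -/z sz.
  by rewrite -!setUA.
have vzE : ~~ adj G v z by rewrite -adj_wz.
have nbrA a : a \in nbrs G v -> a \in A.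
  rewrite inE => va; apply: inA; first exact: adj_Vr va.
  - by rewrite eq_sym (adj_neq va).
  - by apply: contraNneq vwE => <-.
  - by apply: contraNneq vzE => <-.
have [deg2|deg3] : #|nbrs G v| = 2 \/ #|nbrs G v| = 3.
  by move: ge2 le3; move: #|nbrs G v| => -[|[|[|[|]]]] //; [left | right].
- have /cards2P[v1 [v2 [v12 NE]]] : #|nbrs G v| == 2 by rewrite deg2.
  have [v1A v2A] : v1 \in A /\ v2 \in A by rewrite !nbrA // NE ?set21 ?set22.
  have EGE : E G = E G0 :|: edge_orbit s [set v; v1] :|: edge_orbit s [set v; v2].
    apply/setP => e; rewrite edge_split_star EG0 -setUA 2!in_setU; congr (_ || _).
    apply/exists_inP/orP => [[b]|].
      rewrite NE => /set2P[]-> eO; by [left|right].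
    by case=> eO; [exists v1 | exists v2]; rewrite // NE ?set21 ?set22.
  apply: (@reduce G0) => //; first by rewrite {1}EGE; exact: card_le_orbits.
  constructor 1; split; first exact: newV.
  exists v1, v2; rewrite !restr0 // !ss; split=> //.
  rewrite {1}EGE !orbit_new; apply/setP => e; rewrite !in_setU !in_set1.
  case: (e == [set v; v1]); case: (e == [set v; v2]); case: (e == [set w; s v1]);
    case: (e == [set w; s v2]); case: (e == [set z; s (s v1)]); rewrite ?orbT ?orbF //.
have [v1 [v2 [v3 [NE uniqN]]]] : exists v1 v2 v3,
    nbrs G v = [set v1; v2; v3] /\ uniq [:: v1; v2; v3].
  have /card_gt0P[v1 v1N] : (0 < #|nbrs G v|)%N by rewrite deg3.
  have := cardsD1 v1 (nbrs G v); rewrite v1N deg3 => -[/esym/eqP/cards2P[v2 [v3 [v23 E23]]]].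
  exists v1, v2, v3; split; first by rewrite -setUA -E23 setD1K.
  have : v1 \notin nbrs G v :\ v1 by rewrite setD11.
  by rewrite E23 /= !inE v23 !andbT.
have key a b c : nbrs G v = [set a; b; c] -> uniq [:: a; b; c] ->
    (forall X, X \subset A -> a \in X -> b \in X -> (#|spanned G X| + 4 <= 2 * #|X|)%N) ->
  exists G' Phi', reduces_to G' Phi'.
  move=> {}NE uabc unblocked.
  have [aN bN cN] : [/\ a \in nbrs G v, b \in nbrs G v & c \in nbrs G v].
    by rewrite NE !inE !eqxx ?orbT.
  have [aA bA cA] : [/\ a \in A, b \in A & c \in A] by rewrite !nbrA.
  have ab : a != b by move: uabc; rewrite /= !inE negb_or => /andP[/andP[]].
  have abA : [set a; b] \subset A by rewrite subUset !sub1set aA.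
  have abE : [set a; b] \notin E G.
    apply/negP => abE; have := unblocked _ abA (set21 a b) (set22 a b).
    have : (0 < #|spanned G [set a; b]|)%N.
      by apply/card_gt0P; exists [set a; b]; rewrite inE abE /=.
    by rewrite cards2 ab; move: #|spanned G [set a; b]|; clear; lia.
  pose O := edge_orbit s [set a; b].
  have OA e : e \in O -> (e \subset A) && (#|e| == 2%N).
    have c2 : #|[set a; b]| = 2%N by rewrite cards2 ab.
    rewrite /O edge_orbitE !inE => /orP[/orP[]|]/eqP->; rewrite ?card_imset ?c2 ?eqxx ?andbT //;
      try exact: perm_inj; by rewrite ?imA.
  pose G' := mkgraph A (spanned G A :|: O).
  have EG' : E G' = spanned G A :|: O.
    apply: mkgraphE; apply/subsetP => e; rewrite in_setU [in X in _ -> X]inE => /orP[|/OA //].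
    by rewrite inE => /andP[eE eA]; rewrite eA (edge_card eE).
  have OG e : e \in O -> e \notin E G.
    move=> eO; apply: contra abE => eE; move: eO; rewrite in_edge_orbit // => /or3P[]/eqP<- //;
      by rewrite ?aut_edge.
  have O_step e : (s @: e \in O) = (e \in O).
    by rewrite !in_edge_orbit // imset_order3 // orbA orbC.
  have E's e : (s @: e \in E G') = (e \in E G').
    by rewrite EG' [LHS]in_setU [RHS]in_setU spanned_step O_step.
  have spG' : sparse G'.
    by apply: (@add_orbit_sparse T G s sA s3 free spG A a b AV sAA unblocked G').
  have D : E G' :\: O = spanned G A.
    apply/setP => e; rewrite in_setD EG' in_setU.
    case: (boolP (e \in O)) => eO /=; last by rewrite orbF.
    by rewrite inE (negbTE (OG _ eO)).
  have EGE : E G = (E G' :\: O) :|: edge_orbit s [set v; a] :|: edge_orbit s [set v; b]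
      :|: edge_orbit s [set v; c].
    rewrite D; apply/setP => e; rewrite edge_split_star.
    move: (edge_orbit s) => EO; rewrite -!setUA !in_setU; congr (_ || _).
    apply/exists_inP/or3P => [[x]|].
      rewrite NE in_setU in_set1 => /orP[/set2P[]|/eqP]-> eO;
        by [constructor 1 | constructor 2 | constructor 3].
    by case=> eO; [exists a | exists b | exists c].
  apply: (@reduce G') => //.
    have d0 : spanned G A :&: O = set0.
      apply/setP => e; rewrite in_setI in_set0; apply/negP => /andP[eS /OG].
      by move: eS; rewrite inE => /andP[-> _].
    have [n1 n2 n3] : [/\ s @: [set a; b] != [set a; b],
        s @: (s @: [set a; b]) != [set a; b] & s @: (s @: [set a; b]) != s @: [set a; b]].
      have a_n x : x \in A -> s x != x by move=> xA; apply: free; exact: (subsetP AV).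
      pose K := complete_graph A.
      have abK : [set a; b] \in E K by rewrite inE abA cards2 ab.
      by apply: (@free_edges_uniq T K s _ s3) => // x xA; exact: a_n.
    have cO : #|O| = 3%N.
      by rewrite /O edge_orbitE -setUA cardsU1 cards2 !inE ![[set a; b] == _]eq_sym
        (negbTE n1) (negbTE n2) eq_sym n3.
    have cG' : #|E G'| = (#|spanned G A| + 3)%N by rewrite EG' cardsU d0 cards0 subn0 cO.
    have := card_le_orbits (spanned G A) [set v; a] [set v; b].
    have := leq_card_setU (spanned G A :|: edge_orbit s [set v; a] :|: edge_orbit s [set v; b])
      (edge_orbit s [set v; c]).
    have := card_orbit [set v; c]; rewrite cG' EGE D => h1 [h2 _] h3; move: h1 h2 h3.
    move: #|spanned G A| #|edge_orbit s [set v; c]|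
      #|spanned G A :|: edge_orbit s [set v; a] :|: edge_orbit s [set v; b]|
      #|spanned G A :|: edge_orbit s [set v; a] :|: edge_orbit s [set v; b]
        :|: edge_orbit s [set v; c]|.
    by clear; lia.
  constructor 2; split; first exact: newV.
  exists a, b, c; split=> //.
  - by rewrite EG' in_setU [X in _ || X]in_edge_orbit // eqxx orbT.
  - rewrite !restr0 // => -[sa _]; have := free (subsetP AV _ aA); by rewrite sa eqxx.
  rewrite {1}EGE !orbit_new !restr0 //.
  have -> : [set [set a; b]; [set Phi C3 a; Phi C3 b];
      [set Phi (C3 *m C3) a; Phi (C3 *m C3) b]] = O.
    by rewrite /O edge_orbitE !imset_pair !ss.
  rewrite !imsetU !imset_set1 !restr0 // !ss.
  rewrite -!setUA; congr (_ :|: _).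
  move: [set v; a] [set v; b] [set v; c] [set w; s a] [set w; s b] [set w; s c].
  move: [set z; s (s a)] [set z; s (s b)] [set z; s (s c)] => z1 z2 z3 v1' v2' v3' w1 w2 w3.
  apply/setP => e; rewrite !inE.
  case: (e == v1'); rewrite ?orbT //=; case: (e == v2'); rewrite ?orbT //=.
  case: (e == v3'); rewrite ?orbT //=; case: (e == w1); rewrite ?orbT //=.
  by case: (e == w2); rewrite ?orbT //=; case: (e == w3); rewrite ?orbT.
have [v1N v2N v3N] : [/\ v1 \in nbrs G v, v2 \in nbrs G v & v3 \in nbrs G v].
  by rewrite NE !inE !eqxx ?orbT.
have AVv : A \subset V G :\ v by apply: setDS; rewrite sub1set !inE eqxx.
have vadj a : a \in nbrs G v -> adj G v a by rewrite inE.
have [p|p|p] := @exists_unblocked T G spG A v v1 v2 v3 AVv vV (nbrA _ v1N) (nbrA _ v2N)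
  (nbrA _ v3N) uniqN (vadj _ v1N) (vadj _ v2N) (vadj _ v3N).
- exact: (key v1 v2 v3).
- apply: (key v1 v3 v2) => //; first by rewrite NE setUAC.
  by move: uniqN; rewrite /= !inE !negb_or (eq_sym v3) => /and3P[/andP[-> ->] -> _].
- apply: (key v2 v3 v1) => //; first by rewrite NE -setUA setUC.
  by rewrite -(rot_uniq 2) /=.
Qed.

End Reduce.
End Reduction.

(** * The equivalence *)

Section Construction.
Variables (R : realType) (T : finType).
Implicit Types (G : graph T) (Phi : 'M[R]_2 -> {perm T}).

Lemma construction_base A Phi : C3_hom (complete_graph A) Phi -> #|A| = 3%N ->
  (exists2 x, x \in C3_group & Phi x <> 1%g) ->
  has_construction_sequence (complete_graph A) Phi.
Proof.
move=> hPhi A3 nontriv.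
exists 0%N, (fun=> complete_graph A), (fun=> Phi); split=> //.
by exists A.
Qed.

(** Only the values of the homomorphism on the group matter. *)
Lemma construction_step_ext G Phi1 Phi2 G' Phi' : {in C3_group, Phi1 =1 Phi2} ->
  construction_step G Phi2 G' Phi' -> construction_step G Phi1 G' Phi'.
Proof.
move=> PhiE [v [w [z [moves agree cycle]]]].
have c2 : (C3 : 'M[R]_2) \in C3_group by rewrite !inE eqxx orbT.
have c3 : (C3 *m C3 : 'M[R]_2) \in C3_group by rewrite !inE eqxx !orbT.
exists v, w, z; split=> // [|x xC a aV]; last by rewrite agree // PhiE.
by rewrite /vertex_addition /edge_split /Delta_extension !PhiE.
Qed.

Lemma construction_snoc G Phi G' Phi' : has_construction_sequence G Phi ->
  C3_hom G' Phi' -> construction_step G Phi G' Phi' -> has_construction_sequence G' Phi'.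
Proof.
move=> [k [Gs [Phis [G0 hom nontriv step [Gk Phik]]]]] hom' step'.
exists k.+1, (fun i => if (i <= k)%N then Gs i else G'),
  (fun i => if (i <= k)%N then Phis i else Phi'); split=> //.
- by move=> i _; case: (leqP i k) => ik //; exact: hom.
- move=> i; rewrite ltnS => ik; rewrite ik.
  case: (ltnP i k) => [ltik|leki]; first exact: step.
  have -> : i = k by apply/eqP; rewrite eqn_leq ik.
  by rewrite Gk; exact: construction_step_ext step'.
- by rewrite ltnn.
Qed.

(** Removing orbits until three vertices are left: sparseness and the number of
    edges then leave a triangle. *)
Lemma sparse_construction G Phi : C3_hom G Phi -> free_on G (Phi C3) -> sparse G ->
    (#|E G| + 3 = 2 * #|V G|)%N -> (3 <= #|V G|)%N ->
  has_construction_sequence G Phi.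
Proof.
move Vn : #|V G| => n; elim/ltn_ind: n => n IHn in G Phi Vn *; subst n.
move=> hPhi free spG cardG; rewrite leq_eqVlt => /orP[/eqP V3|V4].
  have GE : G = complete_graph (V G).
    apply: graph_ext => //; apply/eqP; rewrite eqEcard; apply/andP; split.
      by apply/subsetP => e eE; rewrite inE (edge_sub eE) (edge_card eE).
    rewrite [E (complete_graph _)]/= cards_draws -V3 (_ : 'C(3, 2) = 3%N) //.
    by move: cardG; rewrite -V3; move: #|E G|; clear; lia.
  have /card_gt0P[a aV] : (0 < #|V G|)%N by rewrite -V3.
  rewrite GE; apply: construction_base; rewrite -?GE //.
  exists C3; first by rewrite !inE eqxx orbT.
  by move=> Phi1; have := free a aV; rewrite Phi1 perm1 eqxx.
have [v vV le3] := exists_degree_le3 cardG.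
have [G' [Phi' [hPhi' free' spG' cardG' [ltV step]]]] :=
  reduce_vertex hPhi free spG cardG V4 vV le3.
have V3' : (3 <= #|V G'|)%N.
  have [v1 [w1 [z1 [moves _ _]]]] := step.
  have [_ [vN wN zN] _] : new_vertices G' v1 w1 z1 G by case: moves => -[].
  rewrite ltnNge; apply/negP => le2.
  have V2 : (2 <= #|V G'|)%N by move: cardG'; move: #|E G'| #|V G'|; clear; lia.
  have [_ _ s3 sA] := C3_homE hPhi'.
  have [||m [_ [cm _]]] := @card_invariant T G' (Phi' C3) sA s3 free' (V G') => //.
    apply/setP => a; rewrite -{1}(s3 a) mem_imset ?(aut_V _ sA) //; exact: perm_inj.
  by move: cm le2 V2; move: #|V G'|; clear; lia.
apply: (construction_snoc _ hPhi step); exact: (IHn _ ltV).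
Qed.

Lemma sparseE G :
  (forall H, subgraph H G -> (2 <= #|V H|)%N -> (#|E H| <= 2 * #|V H| - 3)%N) -> sparse G.
Proof.
move=> sp X XV X2; have := sp (mkgraph X (E G)); rewrite spannedE [V _]/=.
have sub : subgraph (mkgraph X (E G)) G.
  by split=> //; apply/subsetP => e; rewrite inE => /andP[].
by move=> /(_ sub X2); move: X2; move: #|X| #|spanned G X|; clear; lia.
Qed.

Lemma fixed_free G Phi : #|fixed_vertices G (Phi C3)| = 0%N <-> free_on G (Phi C3).
Proof.
split=> [/eqP|free]; first rewrite cards_eq0 => /eqP fix0 a aV.
  by apply/negP => sa; have := in_set0 a; rewrite -fix0 inE aV sa.
by apply/eqP; rewrite cards_eq0; apply/eqP/setP => a; rewrite !inE;
  apply/andP => -[aV]; apply/negP/free.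
Qed.

Lemma generic_isostatic_sparse G Phi : (3 <= #|V G|)%N -> C3_hom G Phi ->
    (exists p : T -> 'cV[R]_2, sym_realization G Phi p) -> generically_isostatic G Phi ->
  [/\ #|E G| = (2 * #|V G| - 3)%N,
      (forall H : graph T, subgraph H G -> (2 <= #|V H|)%N ->
         (#|E H| <= 2 * #|V H| - 3)%N)
    & #|fixed_vertices G (Phi C3)| = 0%N].
Proof.
move=> V3 hPhi [p0 real0] iso.
have [p symp genp] := exists_generic hPhi real0.
have [/independentE onto rigid] := iso p symp genp.
have [real /(symmetricE _ hPhi) sym] := symp.
have [_ _ s3 sA] := C3_homE hPhi.
have le1 := inf_rigid_maxwell real rigid V3.
have V2 : (2 <= #|V G|)%N by exact: ltnW.
have le2 := onto_edges_sparse onto (conj (subxx _) (subxx _)) V2.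
have E0 := inf_rigid_edge rigid V3.
have le3 := onto_edges_fixed sA s3 sym real E0 onto.
split.
- by move: le1 le2 V3; move: #|E G| #|V G|; clear; lia.
- by move=> H; exact: onto_edges_sparse.
have := cardsID [set a | Phi C3 a == a] (V G).
have -> : V G :&: [set a | Phi C3 a == a] = fixed_vertices G (Phi C3).
  by apply/setP => a; rewrite !inE.
have -> : V G :\: [set a | Phi C3 a == a] = [set a in V G | Phi C3 a != a].
  by apply/setP => a; rewrite !inE andbC.
move: le1 le3; move: #|E G| #|V G| #|fixed_vertices _ _| #|[set a in V G | _]|; clear; lia.
Qed.

Lemma sym_independent_isostatic G Phi : (3 <= #|V G|)%N -> C3_hom G Phi ->
    sym_independent R G (Phi C3) -> #|E G| = (2 * #|V G| - 3)%N ->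
  (exists p : T -> 'cV[R]_2, sym_realization G Phi p) /\ generically_isostatic G Phi.
Proof.
move=> V3 hPhi [p symp onto] cardG; have symp' := (symmetricE p hPhi).2 symp.
split; first by exists p; split=> // a b; exact: onto_edges_neq.
move=> q symq genq; have ontoq := generic_onto_edges genq symp' onto.
split; first exact/independentE.
have /set0Pn[e eE] : E G != set0.
  by rewrite -card_gt0; move: cardG V3; move: #|E G| #|V G|; clear; lia.
have [a [b [eab ab aV bV]]] := edgeP eE.
have adj_ab : adj G a b by rewrite /adj -eab.
apply: (onto_edges_rigid aV bV (onto_edges_neq ontoq adj_ab) ontoq).
by move: cardG V3; move: #|E G| #|V G|; clear; lia.
Qed.

End Construction.

Theorem theorem5p1 (R : realType) (T : finType) (G : graph T)
    (Phi : 'M[R]_2 -> {perm T})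
    (hV : (3 <= #|V G|)%N) (hPhi : C3_hom G Phi) :
  [<-> (exists p : T -> 'cV[R]_2, sym_realization G Phi p) /\
         generically_isostatic G Phi;
       [/\ #|E G| = (2 * #|V G| - 3)%N,
           (forall H : graph T, subgraph H G -> (2 <= #|V H|)%N ->
              (#|E H| <= 2 * #|V H| - 3)%N)
         & #|fixed_vertices G (Phi C3)| = 0%N];
       has_construction_sequence G Phi;
       has_proper_C3_threeTree2 G Phi].
Proof.
have [_ _ s3 sA] := C3_homE hPhi.
have ii_iii : #|E G| = (2 * #|V G| - 3)%N ->
    (forall H : graph T, subgraph H G -> (2 <= #|V H|)%N -> (#|E H| <= 2 * #|V H| - 3)%N) ->
    free_on G (Phi C3) -> has_construction_sequence G Phi.
  move=> cardG sp free; apply: sparse_construction => //; first exact: sparseE.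
  by move: cardG hV; move: #|E G| #|V G|; clear; lia.
tfae.
- by case=> real iso; exact: generic_isostatic_sparse.
- by move=> [cardG sp /fixed_free]; exact: ii_iii.
- move=> /sequence_facts[free [p symp onto] [H treeH]].
  have [Tr [partTr rotTr]] := C3tree_threeTree2 s3 sA treeH.
  exists Tr; split=> //; apply: (sparse_proper partTr) => K KG.
  exact: onto_edges_sparse onto KG.
- move=> [Tr [partTr proper rotTr]].
  have free := threeTree2_free partTr rotTr.
  have cardG : #|E G| = (2 * #|V G| - 3)%N by rewrite (threeTree2_card partTr) addnK.
  have sp H := @proper_sparse T G Tr partTr H proper.
  have [_ ind _] := sequence_facts (ii_iii cardG sp free).
  exact: sym_independent_isostatic.
Qed.
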